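(* Let $(X,T)$ be a minimal Cantor system. Let $(g_n)$ be a sequence of positive real numbers which is subexponential. Then there exists a zero-entropy pseudo-Toeplitz subshift $(Y,S)$ such that (1) $(Y,S)$ and $(X,T)$ are strong orbit equivalent; (2) the complexity of $(Y,S)$ satisfies $\liminf_{n\to\infty}\frac{g_n}{p_Y(n)}=0$.
   Context: Logarithms are natural. A sequence $(g_n)$ of positive reals is subexponential if $\lim_{n\to\infty}\log(g_n)/n=0$. A minimal Cantor system is a pair $(X,T)$ with $X$ a Cantor space and $T$ a homeomorphism of $X$ all of whose orbits are dense. A subshift $(Y,S)$ is a closed shift-invariant subset $Y\subseteq\mathcal{A}^{\mathbb{Z}}$ ($\mathcal{A}$ a finite alphabet) with the left shift $S$; its complexity $p_Y(n)$ is the number of words of length $n$ occurring in elements of $Y$, and its topological entropy is $\lim_n \log(p_Y(n))/n$. Strong orbit equivalence of minimal Cantor systems $(X_1,T_1),(X_2,T_2)$: there is a homeomorphism $\phi\colon X_1\to X_2$ mapping each $T_1$-orbit onto a $T_2$-orbit, and such that the maps $n_1,n_2\colon X_1\to\mathbb{Z}$ determined by $\phi\circ T_1(x)=T_2^{n_1(x)}\circ\phi(x)$ and $\phi\circ T_1^{n_2(x)}(x)=T_2\circ\phi(x)$ each have at most one point of discontinuity. A Bratteli diagram $(V,E)$ is an infinite directed graph (multiple edges allowed) with $V=\bigsqcup_{i\ge0}V_i$, $E=\bigsqcup_{i\ge1}E_i$, all $V_i,E_i$ finite and non-empty, $V_0$ a single point (top vertex), with source and range maps $s,r$ such that $s(E_i)\subseteq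 V_{i-1}$, $r(E_i)\subseteq V_i$, $s^{-1}(v)\ne\emptyset$ for all $v\in V$, $r^{-1}(v)\ne\emptyset$ for all $v\in V\setminus V_0$. The incidence matrix $M_i$ has entry $M_i(v,u)$ equal to the number of edges from $u\in V_i$ to $v\in V_{i+1}$. The diagram is simple if there is a strictly increasing sequence $0=t_0<t_1<\cdots$ such that all products $M_{t_{i+1}-1}\cdots M_{t_i}$ have positive entries. An ordered Bratteli diagram $(V,E,\ge)$ carries a linear order on $r^{-1}(v)$ for each $v\in V\setminus V_0$. It is properly ordered if it is simple and there is exactly one infinite path $x_{\min}$ consisting of minimal edges and exactly one infinite path $x_{\max}$ consisting of maximal edges. Its Bratteli-Vershik system $(X_B,V_B)$: $X_B$ is the (assumed infinite) space of infinite paths $(e_1,e_2,\dots)$, $e_i\in E_i$, $r(e_i)=s(e_{i+1})$, with topology generated by cylinder sets; $V_B(x_{\max})=x_{\min}$, and for $x=(e_i)\ne x_{\max}$, with $k$ the least index such that $e_k$ is not maximal and $f_k$ the successor of $e_k$ in $r^{-1}(r(e_k))$, $V_B(x)=(f_1,\dots,f_{k-1},f_k,e_{k+1},\dots)$, where $(f_1,\dots,f_{k-1})$ is the path of minimal edges from $V_0$ to $s(f_k)$. A Bratteli-Vershik representation of a minimal Cantor system is a properly ordered Bratteli diagram whose Bratteli-Vershik system is conjugate to it. A simple Bratteli diagram is pseudo-ERS if $\lim_{i\to\infty}L_i/\ell_i=1$, where $L_i$ and $\ell_i$ are the maximal and minimal number of paths from the top vertex to vertices of $V_i$. A minimal subshift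 is pseudo-Toeplitz if it admits a Bratteli-Vershik representation $(V,E,\ge)$ with $(V,E)$ pseudo-ERS. *)

(* Defs.v *)
From HB Require Import structures.
From mathcomp Require Import all_boot all_order all_algebra.
From mathcomp Require Import all_classical all_reals all_analysis.

Set Implicit Arguments.
Unset Strict Implicit.
Unset Printing Implicit Defensive.

Import Order.TTheory GRing.Theory Num.Theory.
Import numFieldNormedType.Exports.

Local Open Scope classical_set_scope.
Local Open Scope ring_scope.

Record homeo (X Y : topologicalType) := Homeo {
  hfun :> X -> Y;
  hinv : Y -> X;
  hfunK : cancel hfun hinv;
  hinvK : cancel hinv hfun;
  hfun_continuous : continuous hfun;
  hinv_continuous : continuous hinv
}.

(* [cantor_like] of the library does not entail metrizability, hence the
   homeomorphism with the concrete Cantor space [bool^nat]. *)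
Definition is_cantor (X : topologicalType) : Prop :=
  inhabited (homeo cantor_space X).

Definition zpow (X : topologicalType) (T : homeo X X) (n : int) (x : X) : X :=
  match n with
  | Posz k => iter k T x
  | Negz k => iter k.+1 (hinv T) x
  end.

Definition zorbit (X : topologicalType) (T : homeo X X) (x : X) : set X :=
  range (fun n : int => zpow T n x).

Definition minimal (X : topologicalType) (T : homeo X X) : Prop :=
  forall x : X, dense (zorbit T x).

Definition minimal_cantor_system (X : topologicalType) (T : homeo X X) : Prop :=
  is_cantor X /\ minimal T.

Definition discontinuities (X Y : topologicalType) (f : X -> Y) : set X :=
  [set x | ~ {for x, continuous f}].

(* Minimal Cantor systems have no periodic points, so that the orbit cocycles
   [n1] and [n2] below are determined by [phi]. *)
Definition strong_orbit_equivalent (X1 X2 : topologicalType)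
    (T1 : homeo X1 X1) (T2 : homeo X2 X2) : Prop :=
  exists (phi : homeo X1 X2) (n1 n2 : X1 -> discrete_topology int),
    [/\ forall x, exists y, phi @` zorbit T1 x = zorbit T2 y,
        forall x, phi (T1 x) = zpow T2 (n1 x) (phi x),
        forall x, phi (zpow T1 (n2 x) x) = T2 (phi x),
        is_subset1 (discontinuities n1) &
        is_subset1 (discontinuities n2)].

Section Restriction.
Variables (X : topologicalType) (T : homeo X X) (Y : set X).
Hypothesis TY : T @` Y = Y.

Lemma restr_fun_subproof (y : set_type Y) : T (val y) \in Y.
Proof.
have : (T @` Y) (T (val y)) by exists (val y) => //; exact: set_valP.
by move=> Ty; apply/mem_set; move: Ty; rewrite TY.
Qed.

Lemma restr_inv_subproof (y : set_type Y) : hinv T (val y) \in Y.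
Proof.
apply/mem_set; have : (T @` Y) (val y) by rewrite TY; exact: set_valP.
by case=> z Yz <-; rewrite hfunK.
Qed.

Definition restr_fun (y : set_type Y) : set_type Y :=
  exist _ (T (val y)) (restr_fun_subproof y).

Definition restr_inv (y : set_type Y) : set_type Y :=
  exist _ (hinv T (val y)) (restr_inv_subproof y).

Lemma restr_funK : cancel restr_fun restr_inv.
Proof. by move=> y; apply: val_inj; rewrite /= hfunK. Qed.

Lemma restr_invK : cancel restr_inv restr_fun.
Proof. by move=> y; apply: val_inj; rewrite /= hinvK. Qed.

Lemma restr_fun_continuous : continuous restr_fun.
Proof.
apply: continuous_comp_initial => y.
apply: (@continuous_comp _ _ _ (set_val : set_type Y -> X) T).
  exact: initial_continuous.
exact: hfun_continuous.
Qed.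

Lemma restr_inv_continuous : continuous restr_inv.
Proof.
apply: continuous_comp_initial => y.
apply: (@continuous_comp _ _ _ (set_val : set_type Y -> X) (hinv T)).
  exact: initial_continuous.
exact: hinv_continuous.
Qed.

Definition restr_homeo : homeo (set_type Y) (set_type Y) :=
  Homeo restr_funK restr_invK restr_fun_continuous restr_inv_continuous.

End Restriction.

Section Subshifts.
Variable A : finType.

Definition full_shift : topologicalType :=
  prod_topology (fun _ : int => discrete_topology A).

Definition shift_fun (y : full_shift) : full_shift := fun i => y (i + 1).

Definition shift_inv (y : full_shift) : full_shift := fun i => y (i - 1).

Lemma shift_funK : cancel shift_fun shift_inv.
Proof.
by move=> y; apply: functional_extensionality_dep => i;
  rewrite /shift_inv /shift_fun subrK.
Qed.

Lemma shift_invK : cancel shift_inv shift_fun.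
Proof.
by move=> y; apply: functional_extensionality_dep => i;
  rewrite /shift_inv /shift_fun addrK.
Qed.

Lemma full_shift_coord_continuous (j : int) :
  continuous ((fun y => y j) : full_shift -> discrete_topology A).
Proof.
move=> y; have [cvgj _] := @cvg_sup _ _ (fun j : int => Topological.class
  (initial_topology (fun z : (int -> discrete_topology A) => z j)))
  (nbhs y) y (nbhs_filter y).
move=> U yU; apply: (cvgj (fun V => id) j).
by apply: (@initial_continuous _ _ (fun z : (int -> discrete_topology A) => z j)).
Qed.

Lemma reindex_continuous (s : int -> int) :
  continuous ((fun y i => y (s i)) : full_shift -> full_shift).
Proof.
move=> y; pose f : full_shift -> full_shift := fun z i => z (s i).
have FF : Filter (f @ nbhs y) by exact: fmap_filter.
have [_ fcvg] := @cvg_sup _ _ (fun j : int => Topological.class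
  (initial_topology (fun z : (int -> discrete_topology A) => z j)))
  (f @ nbhs y) (f y) FF.
apply: fcvg => i.
have /(_ y) : continuous (f : full_shift ->
    initial_topology (fun z : (int -> discrete_topology A) => z i)).
  apply: continuous_comp_initial; exact: (@full_shift_coord_continuous (s i)).
by [].
Qed.

Lemma shift_fun_continuous : continuous shift_fun.
Proof. exact: (@reindex_continuous (fun i => i + 1)). Qed.

Lemma shift_inv_continuous : continuous shift_inv.
Proof. exact: (@reindex_continuous (fun i => i - 1)). Qed.

Definition shift_map : homeo full_shift full_shift :=
  Homeo shift_funK shift_invK shift_fun_continuous shift_inv_continuous.

Record subshift := Subshift {
  points :> set full_shift;
  points_closed : closed points;
  points_invariant : shift_map @` points = points
}.

Definition subshift_map (Y : subshift) :
    homeo (set_type (points Y)) (set_type (points Y)) :=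
  restr_homeo (points_invariant Y).

Definition language (Y : subshift) (n : nat) : {set n.-tuple A} :=
  [set w : n.-tuple A | `[< exists (y : full_shift) (i : int),
     points Y y /\ forall k : 'I_n, y (i + k%:Z) = tnth w k >]]%SET.

Definition complexity (Y : subshift) (n : nat) : nat := #|language Y n|.

Definition has_entropy (R : realType) (Y : subshift) (h : R) : Prop :=
  (ln (complexity Y n)%:R / n%:R : R) @[n --> \oo] --> h.

End Subshifts.

(* [edge B i] is the edge set E_{i+1}, joining level [i] to level [i.+1]. *)
Record bratteli := Bratteli {
  vertex : nat -> finType;
  edge : nat -> finType;
  src : forall i, edge i -> vertex i;
  rng : forall i, edge i -> vertex i.+1;
  vertex_nonempty : forall i, (0 < #|vertex i|)%N;
  edge_nonempty : forall i, (0 < #|edge i|)%N;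
  vertex_top : #|vertex 0| = 1%N;
  src_surj : forall i (v : vertex i), exists e : edge i, src e = v;
  rng_surj : forall i (v : vertex i.+1), exists e : edge i, rng e = v
}.

Definition incidence (B : bratteli) (i : nat) :
    'M[nat]_(#|vertex B i.+1|, #|vertex B i|) :=
  \matrix_(v, u) #|[set e : edge B i | (src e == enum_val u) &&
                                       (rng e == enum_val v)]%SET|.

(* M_{i+k-1} ... M_i *)
Fixpoint incidence_prod (B : bratteli) (i k : nat) :
    'M[nat]_(#|vertex B (k + i)|, #|vertex B i|) :=
  match k with
  | 0%N => 1%:M
  | k'.+1 => incidence B (k' + i) *m incidence_prod B i k'
  end.

Definition simple_bratteli (B : bratteli) : Prop :=
  exists t : nat -> nat,
    [/\ t 0%N = 0%N, forall i, (t i < t i.+1)%N &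
        forall i u v, (0 < incidence_prod B (t i) (t i.+1 - t i) u v)%N].

(* Paths from the top vertex to [v], given by their last edge and the path
   from the top vertex to the source of that edge. *)
Fixpoint top_path (B : bratteli) (i : nat) : vertex B i -> finType :=
  match i with
  | 0%N => fun _ => unit : finType
  | i'.+1 => fun v =>
      {e : {e : edge B i' | rng e == v} & top_path (src (val e))} : finType
  end.

Definition max_paths (B : bratteli) (i : nat) : nat :=
  \max_(v : vertex B i) #|{: top_path v}|.

(* The default value [max_paths B i] does not affect this minimum over the
   nonempty level [i]. *)
Definition min_paths (B : bratteli) (i : nat) : nat :=
  \big[minn/max_paths B i]_(v : vertex B i) #|{: top_path v}|.

Definition pseudo_ERS (R : realType) (B : bratteli) : Prop :=
  simple_bratteli B /\
  ((max_paths B i)%:R / (min_paths B i)%:R : R) @[i --> \oo] --> (1 : R).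

(* Only the restriction of [edge_le] to pairs of edges with the same range is
   meaningful. *)
Record ordered_bratteli := OrderedBratteli {
  diagram :> bratteli;
  edge_le : forall i, rel (edge diagram i);
  edge_le_refl : forall i (e : edge diagram i), edge_le e e;
  edge_le_anti : forall i (e f : edge diagram i), rng e = rng f ->
    edge_le e f -> edge_le f e -> e = f;
  edge_le_trans : forall i (e f g : edge diagram i),
    rng e = rng f -> rng f = rng g ->
    edge_le e f -> edge_le f g -> edge_le e g;
  edge_le_total : forall i (e f : edge diagram i), rng e = rng f ->
    edge_le e f || edge_le f e
}.

Section BratteliVershik.
Variable B : ordered_bratteli.

Definition min_edge (i : nat) (e : edge B i) : Prop :=
  forall f : edge B i, rng f = rng e -> edge_le e f.

Definition max_edge (i : nat) (e : edge B i) : Prop :=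
  forall f : edge B i, rng f = rng e -> edge_le f e.

Definition edge_lt (i : nat) (e f : edge B i) : Prop :=
  edge_le e f /\ e <> f.

Definition succ_edge (i : nat) (e f : edge B i) : Prop :=
  [/\ rng f = rng e, edge_lt e f &
      forall g : edge B i, rng g = rng e -> edge_lt e g -> edge_le f g].

Definition edge_seq : topologicalType :=
  prod_topology (fun i : nat => discrete_topology (edge B i)).

Definition path_space : set edge_seq :=
  [set x : edge_seq | forall i : nat, rng (x i) = src (x i.+1)].

Definition min_path (x : edge_seq) : Prop := forall i : nat, min_edge (x i).

Definition max_path (x : edge_seq) : Prop := forall i : nat, max_edge (x i).

Definition properly_ordered : Prop :=
  [/\ simple_bratteli B,
      exists! x : edge_seq, path_space x /\ min_path x &
      exists! x : edge_seq, path_space x /\ max_path x].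

Definition is_vershik_map
    (V : set_type path_space -> set_type path_space) : Prop :=
  forall x : set_type path_space,
    (max_path (val x) -> min_path (val (V x))) /\
    (forall k : nat,
       (forall j, (j < k)%N -> max_edge (val x j)) -> ~ max_edge (val x k) ->
       [/\ forall j, (j < k)%N -> min_edge (val (V x) j),
           succ_edge (val x k) (val (V x) k) &
           forall j, (k < j)%N -> val (V x) j = val x j]).

Definition bratteli_vershik_representation
    (X : topologicalType) (T : homeo X X) : Prop :=
  [/\ properly_ordered, infinite_set path_space &
      exists V : set_type path_space -> set_type path_space,
        is_vershik_map V /\
        exists h : homeo (set_type path_space) X,
          forall x, h (V x) = T (h x)].

End BratteliVershik.

Definition pseudo_toeplitz (R : realType) (A : finType) (Y : subshift A) :
    Prop :=
  minimal_cantor_system (subshift_map Y) /\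
  exists B : ordered_bratteli,
    bratteli_vershik_representation B (subshift_map Y) /\ pseudo_ERS R B.

Definition subexponential (R : realType) (g : nat -> R) : Prop :=
  (forall n, 0 < g n) /\ (ln (g n) / n%:R) @[n --> \oo] --> (0 : R).

(* Main.v *)
Require Import Defs.
From mathcomp Require Import all_boot all_order all_algebra.
From mathcomp Require Import all_classical all_reals all_analysis.
From mathcomp Require Import zify ring lra.
Import Order.TTheory GRing.Theory Num.Theory.
Import numFieldNormedType.Exports.
Local Open Scope classical_set_scope.
Local Open Scope ring_scope.

(** The new system is [T] with its towers reordered. Fix a point [x0] and clopen
bases [C 0 = X], [C 1], ... decreasing to [x0], such that the return times to
[C i] are almost constant. Every tower over [C i.+1] is a concatenation of towers
over [C i]; permuting these blocks, but keeping the first and the last one, at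
every level yields a homeomorphism [S] with the orbits of [T], and the two orbit
cocycles are continuous away from [T^-1 x0], the only point that is on top of the
towers of all levels.

The order of the blocks is chosen as a function of the multiset of the types of
the blocks (and of a bounded amount of further data). The number of vertices of
the resulting Bratteli diagram at level [i.+1] is therefore polynomial in the
height of the towers, whatever the entropy of [T], which gives entropy zero. The
polynomially many types are told apart by a short binary code in two words [ab]
and [ba] at the beginning of the tower, and the first block has a type that does
not occur elsewhere in the tower, so that the itinerary of a point of [X]
determines the point and [S] is a subshift. Finally, each tower over [C i.+1]
also contains all concatenations of [k] words [ab] or [ba]; these are [2 ^ k]
words of length proportional to [k], and [k] can be chosen after [a] and [b], so
that the complexity exceeds [g] infinitely often. *)


Set Implicit Arguments.
Unset Strict Implicit.
Unset Printing Implicit Defensive.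
Local Open Scope nat_scope.

(** * Locally constant functions and hitting times *)

(** The obstacle is that separating points and having few vertices pull in opposite directions: to
    separate points, a label must record the name of a whole tower along [T], and there may be
    exponentially many names. Each tower therefore carries two codes, the label [kap], which knows
    all this, and the vertex [tau], which knows only the multiset of labels of the blocks and one of
    three classes. They are reconciled by making a vertex determine the ordered list of the labels
    of its blocks, not just of their vertices: a vertex one level up reveals the label of every
    block below it. The classes are [first block of its tower] and, for other blocks, the two values
    of one coordinate [chi d]; the latter supply the two distinct vertices from which the words [a]
    and [b] come. A bit written as [ab] or [ba] uses one [a] and one [b] whatever its value, so
    coding never disturbs the multiset. The number of multisets is polynomial in the height, with an
    exponent fixed by the old labels, so codes of [m] bits suffice with [m * i.+1] at most the
    height [N]; hence the logarithm of the number of vertices is at most [N * ln 2 / i.+1]. *)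

Definition locally_constant (X : topologicalType) (S : Type) (f : X -> S) :=
  forall x, \forall y \near x, f y = f x.

Section LocallyConstant.
Variable X : topologicalType.
Local Notation lc := (@locally_constant X _).

Lemma lc_cst S (s : S) : lc (fun=> s).
Proof. by move=> x; exact: nearW. Qed.

Lemma lc_comp S S' (F : S -> S') (f : X -> S) : lc f -> lc (fun x => F (f x)).
Proof. by move=> lf x; apply: filterS (lf x) => y ->. Qed.

(** The parameter [f x] may be frozen near each point. Quantities built from a return time or a
    depth are treated this way: the time becomes a constant and only finitely many iterates
    remain. *)
Lemma lc_dep S S' (f : X -> S) (g : S -> X -> S') :
  lc f -> (forall s, lc (g s)) -> lc (fun x => g (f x) x).
Proof.
move=> lf lg x; apply: filterS2 (lf x) (lg (f x) x) => y -> ->; by [].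
Qed.

Lemma lc_comp2 S1 S2 S (F : S1 -> S2 -> S) (f : X -> S1) (g : X -> S2) :
  lc f -> lc g -> lc (fun x => F (f x) (g x)).
Proof. by move=> lf lg x; apply: filterS2 (lf x) (lg x) => y -> ->. Qed.

Lemma lc_map (I : Type) S (s : seq I) (g : I -> X -> S) :
  (forall i, lc (g i)) -> lc (fun x => [seq g i x | i <- s]).
Proof.
move=> lg; elim: s => [|i s IHs]; first exact: lc_cst.
exact: (lc_comp2 cons).
Qed.

Lemma lc_filter (I : Type) (s : seq I) (p : I -> X -> bool) :
  (forall i, lc (p i)) -> lc (fun x => [seq i <- s | p i x]).
Proof.
move=> lp'; elim: s => [|i s IHs]; first exact: lc_cst.
exact: (lc_comp2 (fun (b : bool) s => if b then i :: s else s)).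
Qed.

Lemma lc_precomp (Y : topologicalType) S (h : Y -> X) (f : X -> S) :
  continuous h -> lc f -> @locally_constant Y S (fun y => f (h y)).
Proof. by move=> ch lf y; exact: (ch y _ (lf (h y))). Qed.

Lemma lc_ext S (f g : X -> S) : f =1 g -> lc f -> lc g.
Proof. by move=> /funext ->. Qed.

Lemma lc_bounded (f : X -> nat) : compact [set: X] -> lc f ->
  exists n, forall x, f x <= n.
Proof.
move=> /compact_near_coveringP cX lf.
have := cX nat \oo (fun n x => f x <= n) _ _.
case=> [x _|n _ Hn]; last by exists n => x; apply: (Hn n) => //=.
exists ([set y | f y = f x], [set n | f x <= n]) => /=; last by move=> [y n] /= [->].
by split; [exact: lf|exists (f x)].
Qed.

Lemma lc_open (p : X -> bool) : lc p -> open [set x | p x].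
Proof.
move=> lp'; rewrite openE => x /= px; rewrite /interior.
by apply: filterS (lp' x) => y /= ->.
Qed.

End LocallyConstant.

Lemma continuous_iter (X : topologicalType) (f : X -> X) n :
  continuous f -> continuous (iter n f).
Proof.
move=> cf; elim: n => [|n IHn] x; first exact: cvg_id.
by apply: (@continuous_comp _ _ _ (iter n f) f); [exact: IHn|exact: cf].
Qed.

Section Hit.
Variable X : Type.
Implicit Types (f : X -> X) (V : X -> bool).

(* The value is 0 when [x] never enters [V]. *)
Definition hit f V x : nat :=
  if pselect (exists n, V (iter n f x)) is left h then ex_minn h else 0.

Lemma hitP f V x n : V (iter n f x) ->
  V (iter (hit f V x) f x) /\ hit f V x <= n.
Proof.
move=> Vn; rewrite /hit; case: pselect => [h|/(_ (ex_intro _ n Vn))//].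
by case: ex_minnP => m Vm mmin; split => //; exact: mmin.
Qed.

Lemma hit_min f V x n : n < hit f V x -> ~~ V (iter n f x).
Proof. by move=> nh; apply/negP => /hitP[_]; rewrite leqNgt nh. Qed.

Lemma hit_eq f V x n : V (iter n f x) ->
  (forall m, m < n -> ~~ V (iter m f x)) -> hit f V x = n.
Proof.
move=> Vn nV; have [Vh hn] := hitP Vn; apply/eqP.
by rewrite eqn_leq hn leqNgt; apply/negP => /nV; rewrite Vh.
Qed.

Lemma hit_eqE f V x n : (V (iter n f x) && all (fun m => ~~ V (iter m f x)) (iota 0 n)) ->
  hit f V x = n.
Proof.
by case/andP => Vn /allP a; apply: hit_eq => // m mn; apply: a; rewrite mem_iota.
Qed.

End Hit.

Lemma lc_hit (X : topologicalType) (f : X -> X) (V : X -> bool) :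
  continuous f -> locally_constant V -> (forall x, exists n, V (iter n f x)) ->
  locally_constant (hit f V).
Proof.
move=> cf lV hV x.
have lm m : locally_constant (fun y => V (iter m f y)).
  by apply: lc_precomp => //; exact: continuous_iter.
have [n Vn] := hV x; have [Vh hn] := hitP Vn.
pose F n y := V (iter n f y) && all (fun m => ~~ V (iter m f y)) (iota 0 n).
have lF : locally_constant (F (hit f V x)).
  apply: (lc_comp2 andb) => //.
  have : locally_constant (fun y => all id [seq ~~ V (iter m f y) | m <- iota 0 (hit f V x)]).
    by apply: lc_comp; apply: lc_map => m; apply: lc_comp.
  by apply: lc_ext => y; rewrite all_map.
apply: filterS (lF x) => y.
have -> : F (hit f V x) x = true.
  by rewrite /F Vh /=; apply/allP => m; rewrite mem_iota => /andP[_ mh]; exact: hit_min.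
exact: hit_eqE.
Qed.

(** * Consequences of compactness *)

Section CompactHausdorff.

Lemma compact_homeo (X Y : topologicalType) (f : X -> Y) (g : Y -> X) :
  compact [set: X] -> hausdorff_space Y -> continuous f ->
  cancel f g -> cancel g f -> continuous g.
Proof.
move=> cX hY cf fK gK; apply/continuous_closedP => A clA.
have -> : g @^-1` A = f @` A.
  apply/seteqP; split => [y /= Ay|_ [x Ax <-] /=]; last by rewrite fK.
  by exists (g y).
apply: compact_closed => //; apply: continuous_compact.
  by apply: continuous_subspaceT.
exact: (subclosed_compact clA cX).
Qed.

(** Cantor's intersection theorem for clopen sets: if every point leaves the sequence, near-covering
    along [\oo] yields one index at which all points have left. *)
Lemma decreasing_compact (X : topologicalType) (Z : nat -> X -> bool) :
  compact [set: X] -> (forall i, locally_constant (Z i)) ->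
  (forall i x, Z i.+1 x -> Z i x) -> (forall i, exists x, Z i x) ->
  exists x, forall i, Z i x.
Proof.
move=> /compact_near_coveringP cX lZ decZ neZ; apply: contrapT => /forallNP nZ.
have := cX nat \oo (fun n x => ~~ Z n x) _ _.
have dec i j x : i <= j -> Z j x -> Z i x.
  by move=> ij; rewrite -(subnK ij); elim: (j - i) => // k IH /decZ.
case=> [x _|n _ Hn]; last first.
  by have [x Zx] := neZ n; move: (Hn n (leqnn n) x I); rewrite /= Zx.
have /existsNP[i /negP nZi] := nZ x.
exists ([set y | Z i y = Z i x], [set n | i <= n]) => /=.
  by split; [exact: lZ|exists i].
by move=> [y n] /= [e ni]; apply/negP => /(dec _ _ _ ni); rewrite e (negbTE nZi).
Qed.

Lemma decreasing_basis (X : topologicalType) (Z : nat -> X -> bool) (x0 : X) U :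
  compact [set: X] -> (forall i, locally_constant (Z i)) ->
  (forall i x, Z i.+1 x -> Z i x) -> (forall x, (forall i, Z i x) -> x = x0) ->
  nbhs x0 U -> exists i, forall x, Z i x -> U x.
Proof.
move=> cX lZ decZ Z0 nU.
have cU : compact (~` U°) by apply: (subclosed_compact _ cX) => //;
  rewrite closedC; exact: open_interior.
move/compact_near_coveringP : cU => cU.
have := cU nat \oo (fun n x => ~~ Z n x) _ _.
have dec i j x : i <= j -> Z j x -> Z i x.
  by move=> ij; rewrite -(subnK ij); elim: (j - i) => // k IH /decZ.
case=> [x Ux|n _ Hn]; last first.
  exists n => x Zx; apply: contrapT => nUx.
  have /(Hn n (leqnn n)) : (~` U°) x by move=> /interior_subset.
  by rewrite /= Zx.
have /existsNP[i /negP nZi] : ~ forall i, Z i x.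
  by move=> /Z0 xx0; apply: Ux; rewrite xx0.
exists ([set y | Z i y = Z i x], [set n | i <= n]) => /=.
  by split; [exact: lZ|exists i].
by move=> [y n] /= [e ni]; apply/negP => /(dec _ _ _ ni); rewrite e (negbTE nZi).
Qed.

Lemma hausdorff_inj (X Y : topologicalType) (f : X -> Y) :
  hausdorff_space Y -> continuous f -> injective f -> hausdorff_space X.
Proof.
move=> hY cf fI x y clxy; apply: fI; apply: hY => U V Ux Vy.
by have [z [Uz Vz]] := clxy _ _ (cf x _ Ux) (cf y _ Vy); exists (f z).
Qed.

Lemma embedding_homeo (X Y : topologicalType) (f : X -> Y) (A : set Y) :
  compact [set: X] -> hausdorff_space Y -> continuous f -> injective f ->
  A = range f -> exists h : homeo X (set_type A), forall x, val (h x) = f x.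
Proof.
move=> cX hY cf fI ->.
pose h (x : X) : set_type (range f) := exist _ (f x) (mem_set (imageT f x)).
have ch : continuous h.
  by apply: continuous_comp_initial; exact: cf.
have hI : injective h by move=> x y /(congr1 val); exact: fI.
have /choice[g gK] (y : set_type (range f)) : exists x, h x = y.
  by have [x _ e] := set_valP y; exists x; exact: val_inj.
have hK : cancel h g by move=> x; apply: hI; rewrite gK.
have hh : hausdorff_space (set_type (range f)).
  exact: (@hausdorff_inj _ _ (set_val : set_type (range f) -> Y) hY
    (@initial_continuous _ _ _) val_inj).
by exists (Homeo hK gK ch (compact_homeo cX hh ch hK gK)).
Qed.

Lemma continuous_product (X : topologicalType) (I : eqType) (K : I -> topologicalType)
    (F : X -> prod_topology K) :
  (forall i, continuous (fun x => F x i)) -> continuous F.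
Proof.
move=> cF x; have FF : Filter (F @ nbhs x) by exact: fmap_filter.
have [_ h] := @cvg_sup _ _ (fun j => Topological.class
  (initial_topology (fun z : (forall i, K i) => z j))) (F @ nbhs x) (F x) FF.
apply: h => i.
have /(_ x) : continuous (F : X -> initial_topology (fun z : (forall i, K i) => z i)).
  by apply: continuous_comp_initial; exact: cF.
by [].
Qed.

Lemma lc_continuous (X : topologicalType) (S : choiceType) (f : X -> S) x :
  (\forall y \near x, f y = f x) ->
  {for x, continuous (f : X -> discrete_topology S)}.
Proof.
move=> lf U /nbhs_singleton Ux.
by apply: filterS lf => y /= ->.
Qed.

Lemma discrete_hausdorff (S : choiceType) : hausdorff_space (discrete_topology S).
Proof.
move=> x y; rewrite /cluster /= => /(_ [set x] [set y]).
rewrite !nbhs_principalE => /(_ _ _)[||z [<-//]]; by apply/principal_filterP.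
Qed.

End CompactHausdorff.

(** * Minimal homeomorphisms of the Cantor space *)

Section Homeo.

Definition homeo_inv (X Y : topologicalType) (f : homeo X Y) : homeo Y X :=
  Homeo (hinvK f) (hfunK f) (@hinv_continuous _ _ f) (@hfun_continuous _ _ f).

Definition homeo_comp (X Y Z : topologicalType) (g : homeo Y Z) (f : homeo X Y) : homeo X Z.
Proof.
refine (@Homeo X Z (g \o f) (hinv f \o hinv g) _ _ _ _).
- by move=> x /=; rewrite !hfunK.
- by move=> x /=; rewrite !hinvK.
- by move=> x; apply: continuous_comp; exact: hfun_continuous.
- by move=> x; apply: continuous_comp; exact: hinv_continuous.
Defined.

Variables (X : topologicalType) (T : homeo X X).

Lemma iter_hinvK n : cancel (iter n T) (iter n (hinv T)).
Proof. by elim: n => [|n IHn] x //; rewrite iterSr iterS hfunK IHn. Qed.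

Lemma iter_hfunK n : cancel (iter n (hinv T)) (iter n T).
Proof. by elim: n => [|n IHn] x //; rewrite iterSr iterS hinvK IHn. Qed.

Lemma iter_hinv_sub m n x : m <= n -> iter m (hinv T) (iter n T x) = iter (n - m) T x.
Proof. by move=> mn; rewrite -{1}(subnKC mn) iterD iter_hinvK. Qed.

Lemma zpowS (n : int) x : zpow T (n + 1)%R x = T (zpow T n x).
Proof.
case: n => n; first by have -> : (n%:Z + 1 = n.+1%:Z)%R by lia.
case: n => [|n]; first by rewrite /= hinvK.
have -> : (Negz n.+1 + 1 = Negz n)%R by rewrite !NegzE; lia.
by rewrite /= hinvK.
Qed.

Lemma zpowB1 (n : int) x : zpow T (n - 1)%R x = hinv T (zpow T n x).
Proof. by rewrite -{2}(subrK 1%R n) zpowS hfunK. Qed.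

Lemma zpowD (m n : int) x : zpow T (m + n)%R x = zpow T m (zpow T n x).
Proof.
elim/int_rect: m => [|m IHm|m IHm]; first by rewrite add0r.
  have -> : (m.+1%:Z + n = m%:Z + n + 1)%R by lia.
  by rewrite zpowS IHm.
have -> : (- m.+1%:Z + n = - m%:Z + n - 1)%R by lia.
rewrite zpowB1 IHm -zpowB1; congr zpow; lia.
Qed.

Lemma zpowN (n : nat) x : zpow T (- n%:Z)%R x = iter n (hinv T) x.
Proof. by case: n => [|n] //; rewrite -NegzE. Qed.

End Homeo.

Lemma zorbit_hinv (X : topologicalType) (T : homeo X X) x : zorbit (homeo_inv T) x = zorbit T x.
Proof.
have h (U : homeo X X) n : zpow (homeo_inv U) n x = zpow U (- n)%R x.
  by case: n => n; [rewrite zpowN|].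
apply/seteqP; split => _ [n _ <-]; exists (- n)%R => //; rewrite h ?opprK //.
Qed.

Section Minimal.
Variables (X : topologicalType) (T : homeo X X).
Hypotheses (cX : compact [set: X]) (hX : hausdorff_space X) (minT : minimal T).

Lemma minimal_inv : minimal (homeo_inv T).
Proof. by move=> x; rewrite zorbit_hinv. Qed.

(** Density of two-sided orbits and compactness bound the hitting time in absolute value by some
    [n]; starting from [iter n T x] instead of [x] turns it into a forward time of at most
    [n + n]. *)
Lemma forward_hit (U : X -> bool) : locally_constant U -> (exists x, U x) ->
  exists N, forall x, exists2 n, n <= N & U (iter n T x).
Proof.
move=> lU [u Uu].
have /choice[z Hz] x : exists n : int, U (zpow T n x).
  have [|y /= [Uy [n _ ny]]] := minT x (O := [set x | U x]) _ (lc_open lU).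
    by exists u.
  by exists n; rewrite ny.
have cz n : continuous (zpow T n).
  case: n => n; apply: continuous_iter; [exact: hfun_continuous|exact: hinv_continuous].
move/compact_near_coveringP : cX => nX.
have := nX nat \oo (fun n x => exists2 m : int, `|m|%R <= n%:Z :> int & U (zpow T m x))%R _ _.
case=> [x _|n _ Hn].
  exists ([set y | U (zpow T (z x) y) = U (zpow T (z x) x)], [set n | `|z x|%N <= n]) => /=.
    split; last by exists `|z x|%N.
    exact: (lc_precomp (cz _) lU).
  by move=> [y n] /= [e ni]; exists (z x); [lia|rewrite e Hz].
exists (n + n) => x.
have [m mn Um] := Hn n (leqnn n) (iter n T x) I.
exists `|(m + n%:Z)%R|%N; first by lia.
move: Um; rewrite -[iter n T x]/(zpow T n%:Z x) -zpowD.
by rewrite -[iter _ T x]/(zpow T `|(m + n%:Z)%R|%N%:Z x); congr (is_true (U (zpow T _ x))); lia.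
Qed.

(** A periodic orbit is finite, hence closed; being dense, it is the whole space. *)
Lemma finite_orbit x n : iter n.+1 T x = x ->
  exists s : seq X, forall y, y \in s.
Proof.
move=> per; pose s := [seq iter k T x | k <- iota 0 n.+1]; exists s => y.
have perM k m : iter (k * n.+1 + m) T x = iter m T x.
  by elim: k => // k IHk; rewrite mulSn -addnA addnC iterD per IHk.
have mods k : iter k T x \in s.
  rewrite (divn_eq k n.+1) perM; apply/mapP; exists (k %% n.+1) => //.
  by rewrite mem_iota /= ltn_mod.
have modz (k : int) : zpow T k x \in s.
  case: k => k; first exact: mods.
  have -> : zpow T (Negz k) x = iter (k.+1 * n.+1 - k.+1) T x.
    rewrite -iter_hinv_sub; last by rewrite mulnS leq_addr.
    by rewrite -[k.+1 * n.+1]addn0 perM.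
  exact: mods.
have cls : closed [set` s].
  exact: (iffLR accessible_finite_set_closed (hausdorff_accessible hX) _ (finite_seq s)).
apply: contrapT => ys.
have [|z [/= zs [k _ kz]]] := minT x (O := ~` [set` s]) _ (closed_openC cls).
  by exists y.
by apply: zs; rewrite -kz; exact: modz.
Qed.

End Minimal.

Section CantorFacts.
Variables (X : topologicalType).
Hypothesis cantorX : is_cantor X.

Lemma cantor_compact : compact [set: X].
Proof.
case: cantorX => h; have -> : [set: X] = h @` [set: cantor_space].
  by apply/seteqP; split => x //= _; exists (hinv h x) => //; rewrite hinvK.
apply: continuous_compact; last exact: cantor_space_compact.
by apply: continuous_subspaceT; exact: hfun_continuous.
Qed.

Lemma cantor_coordinates : exists chi : nat -> X -> bool,
  (forall n, locally_constant (chi n)) /\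
  (forall x y, (forall n, chi n x = chi n y) -> x = y).
Proof.
case: cantorX => h.
exists (fun n x => (hinv h x : nat -> bool) n); split => [n x|x y xy].
  have c : continuous (fun x => (hinv h x : nat -> bool) n).
    move=> z; apply: (@continuous_comp _ _ _ (hinv h) (fun f : cantor_space => (f : nat -> bool) n)).
      exact: hinv_continuous.
    exact: (@proj_continuous _ (fun=> bool) n).
  exact: (c x [set b | b = _] _).
by rewrite -(hinvK h x) -(hinvK h y); congr (h _); apply/funext.
Qed.

Lemma cantor_hausdorff : hausdorff_space X.
Proof.
have [chi [lchi schi]] := cantor_coordinates.
move=> x y clxy; apply: schi => n.
have [z [/= <- <-//]] := clxy _ _ (lchi n x) (lchi n y).
Qed.

Lemma cantor_infinite (s : seq X) : ~ (forall y, y \in s).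
Proof.
move=> sall; case: cantorX => h.
pose f (n : nat) : X := h (fun k => k == n).
have fI : injective f.
  move=> n m /(can_inj (hfunK h)) /(congr1 (fun g : nat -> bool => g n)).
  by rewrite eqxx => /esym/eqP.
have : uniq [seq f n | n <- iota 0 (size s).+1] by rewrite map_inj_uniq ?iota_uniq.
move=> /uniq_leq_size /(_ (fun y _ => sall y)).
by rewrite size_map size_iota ltnn.
Qed.

Lemma minimal_aperiodic (T : homeo X X) n x : minimal T -> iter n.+1 T x <> x.
Proof.
move=> mT /(finite_orbit cantor_hausdorff mT)[s]; exact: cantor_infinite.
Qed.

End CantorFacts.

(** Makes orbit cocycles unique: a formula with a constant exponent near a point forces any chosen
    cocycle to be constant there. *)
Lemma zpow_inj (X : topologicalType) (U : homeo X X) (m n : int) x :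
  (forall k y, iter k.+1 U y <> y) -> zpow U m x = zpow U n x -> m = n.
Proof.
move=> ap; wlog mn : m n / (m <= n)%R.
  by move=> w; case/orP: (le_total m n) => h; [exact: w|move=> /esym /(w _ _ h)].
move=> e; have : zpow U (n - m)%R (zpow U m x) = zpow U m x by rewrite -zpowD subrK.
have [k ek] : exists k : nat, (n - m = k%:Z)%R by exists `|(n - m)%R|%N; lia.
by rewrite ek; case: k ek => [|k] ek; [lia|move=> /ap].
Qed.

Lemma zpow_conj (X Y : topologicalType) (f : X -> Y) (U : homeo X X) (V : homeo Y Y) n x :
  (forall x, f (U x) = V (f x)) -> f (zpow U n x) = zpow V n (f x).
Proof.
move=> fUV; have fUVi y : f (hinv U y) = hinv V (f y).
  by rewrite -[in RHS](hinvK U y) fUV hfunK.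
by case: n => n /=; [elim: n => //= n IH; rewrite fUV IH|rewrite fUVi; congr hinv;
  elim: n => //= n IH; rewrite fUVi IH].
Qed.

(** * Marker sets with almost constant return times *)

Section Return.
Variables (X : topologicalType) (T : homeo X X).
Implicit Types (C : X -> bool).

(** It is total, also for points outside [C], and the outer successor makes it positive by
    computation. *)
Definition return_time C x := (hit T C (T x)).+1.
Definition depth C x := hit (hinv T) C x.
Definition tower_base C x := iter (depth C x) (hinv T) x.

Local Notation rt := return_time.

Lemma return_time_eq C x n : 0 < n -> C (iter n T x) ->
  (forall m, 0 < m < n -> ~~ C (iter m T x)) -> rt C x = n.
Proof.
case: n => // n _ Cn nC; congr _.+1; apply: hit_eq => [|m mn].
  by rewrite -iterSr.
by rewrite -iterSr nC.
Qed.

Lemma return_time_le C x n : 0 < n -> C (iter n T x) -> rt C x <= n.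
Proof. by case: n => // n _; rewrite iterSr => h; have [] := hitP h. Qed.

Lemma return_time_notin C x m : 0 < m < rt C x -> ~~ C (iter m T x).
Proof. by case: m => // m; rewrite ltnS iterSr /= => h; exact: hit_min h. Qed.

Lemma depth_iter C x j : C x -> j < rt C x -> depth C (iter j T x) = j.
Proof.
move=> Cx jr; apply: hit_eq => [|m mj]; first by rewrite iter_hinvK.
rewrite iter_hinv_sub 1?ltnW //; apply: return_time_notin; lia.
Qed.

Lemma tower_base_iter C x j : C x -> j < rt C x -> tower_base C (iter j T x) = x.
Proof. by move=> Cx jr; rewrite /tower_base depth_iter // iter_hinvK. Qed.

Lemma depthK C x : iter (depth C x) T (tower_base C x) = x.
Proof. by rewrite /tower_base iter_hfunK. Qed.

End Return.

Section Markers.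
Variables (X : topologicalType) (T : homeo X X).
Hypotheses (cantorX : is_cantor X) (minT : minimal T).
Variables (chi : nat -> X -> bool) (x0 : X).
Hypothesis lchi : forall n, locally_constant (chi n).
Hypothesis schi : forall x y, (forall n, chi n x = chi n y) -> x = y.

Local Notation lc := (@locally_constant X _).
Local Notation rt := (return_time T).
Local Notation bk := (depth T).
Local Notation base := (tower_base T).
Let cX : compact [set: X] := cantor_compact cantorX.
Let cT : continuous T := @hfun_continuous _ _ T.
Let cTi : continuous (hinv T) := @hinv_continuous _ _ T.

Lemma lc_iter n S (f : X -> S) : lc f -> lc (fun x => f (iter n T x)).
Proof. by apply: lc_precomp; exact: continuous_iter. Qed.

Lemma lc_iteri n S (f : X -> S) : lc f -> lc (fun x => f (iter n (hinv T) x)).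
Proof. by apply: lc_precomp; exact: continuous_iter. Qed.

Lemma lc_has (s : seq nat) (p : nat -> X -> bool) : (forall i, lc (p i)) ->
  lc (fun x => has (p^~ x) s).
Proof.
move=> l; have : lc (fun x => has id [seq p i x | i <- s]).
  by apply: lc_comp; exact: lc_map.
by apply: lc_ext => x; rewrite has_map.
Qed.

Lemma lc_all (s : seq nat) (p : nat -> X -> bool) : (forall i, lc (p i)) ->
  lc (fun x => all (p^~ x) s).
Proof.
move=> l; have : lc (fun x => all id [seq p i x | i <- s]).
  by apply: lc_comp; exact: lc_map.
by apply: lc_ext => x; rewrite all_map.
Qed.

Section OneSet.
Variable C : X -> bool.
Hypotheses (lC : lc C) (C0 : exists x, C x).

Lemma hit_ex x : exists n, C (iter n T x).
Proof. by have [N /(_ x)[n _ ?]] := forward_hit cX minT lC C0; exists n. Qed.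

Lemma hit_exi x : exists n, C (iter n (hinv T) x).
Proof.
by have [N /(_ x)[n _ ?]] := forward_hit cX (minimal_inv minT) lC C0; exists n.
Qed.

Lemma return_timeP x : C (iter (rt C x) T x).
Proof. by rewrite iterSr; have [n h] := hit_ex (T x); have [] := hitP h. Qed.

Lemma tower_baseP y : C (base C y).
Proof. by have [n h] := hit_exi y; have [] := hitP h. Qed.

Lemma depth_lt y : bk C y < rt C (base C y).
Proof.
rewrite ltnNge; apply/negP => le; have := return_timeP (base C y).
rewrite /tower_base; set r := rt C _ in le *.
rewrite -{1}(subnKC le) iterD iter_hfunK.
have lt : bk C y - r < bk C y by rewrite -/(tower_base T C y) /r /return_time; move: le; rewrite /r /return_time; lia.
by apply/negP; exact: hit_min lt.
Qed.

Lemma lc_rt : lc (rt C).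
Proof.
apply: lc_comp; apply: (lc_precomp cT); apply: lc_hit => //; exact: hit_ex.
Qed.

Lemma lc_bk : lc (bk C).
Proof. by apply: lc_hit => //; exact: hit_exi. Qed.

Lemma lc_base S (f : X -> S) : lc f -> lc (fun x => f (base C x)).
Proof.
move=> lf; apply: (@lc_dep _ _ _ (bk C) (fun j x => f (iter j (hinv T) x))).
  exact: lc_bk.
by move=> j; exact: lc_iteri.
Qed.

Lemma depth_uniq x y j k : C x -> C y -> j < rt C x -> k < rt C y ->
  iter j T x = iter k T y -> j = k /\ x = y.
Proof.
move=> Cx Cy jx ky e; split; first by rewrite -(depth_iter Cx jx) e depth_iter.
by rewrite -(tower_base_iter Cx jx) e tower_base_iter.
Qed.

End OneSet.

Let aper n x : iter n.+1 T x <> x.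
Proof. exact: minimal_aperiodic. Qed.

(** Aperiodicity gives for each [j > 0] a coordinate [nn j] separating [x0] from its [j]-th image.
    Points of [U'] copy the values at both [x0] and [iter j T x0], so a return at a time [j <= L]
    would identify these two values. *)
Lemma sparse_nbhd (U : X -> bool) L : lc U -> U x0 ->
  exists U' : X -> bool, [/\ lc U', U' x0, (forall x, U' x -> U x) &
    forall x, U' x -> L <= rt U' x].
Proof.
move=> lU U0.
have /choice[nn Hnn] (j : nat) : exists n, 0 < j -> chi n x0 <> chi n (iter j T x0).
  case: j => [|j]; first by exists 0.
  apply: contrapT => /forallNP h; apply: (@aper j x0); apply: schi => n.
  by apply: contrapT => hn; apply: (h n) => _ /esym.
pose p j y := (chi (nn j) y == chi (nn j) x0) &&
   (chi (nn j) (iter j T y) == chi (nn j) (iter j T x0)).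
have lp' j : lc (p j).
  apply: (lc_comp2 andb); apply: (lc_comp (fun b => b == _)) => //.
  exact: lc_iter.
exists (fun y => U y && all (p^~ y) (iota 1 L)); split.
- by apply: (lc_comp2 andb) => //; exact: lc_all.
- by rewrite U0 /=; apply/allP => j _; rewrite /p !eqxx.
- by move=> x /andP[].
move=> x /[dup] U'x /andP[_ /allP px]; rewrite leqNgt; apply/negP => lt.
have lU' : lc (fun y => U y && all (p^~ y) (iota 1 L)).
  by apply: (lc_comp2 andb) => //; exact: lc_all.
have /andP[_ /allP] := return_timeP lU' (ex_intro _ x U'x) x.
set j := rt _ x in lt *.
have j0 : 0 < j by [].
have jin : j \in iota 1 L by rewrite mem_iota; move: j0 lt; clearbody j; lia.
move=> /(_ j jin) /andP[/eqP e1 _]; have /andP[_ /eqP e2] := px _ jin.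
by apply: (Hnn j); rewrite -?e1 -?e2.
Qed.

(** The very long return intervals of a sparse set [U'] are cut into nearly equal pieces of length
    about [A = N + H], and each cut is delayed to the next visit to [U], by at most [H]. The end
    points already lie in [U], so the cuts of consecutive intervals fit together. *)
Lemma near_constant_marker (U : X -> bool) e : lc U -> U x0 ->
  exists N0, forall N, N0 <= N -> exists C : X -> bool,
   [/\ lc C, C x0, (forall x, C x -> U x) &
       forall x, C x -> N <= rt C x <= N + N %/ e.+1].
Proof.
move=> lU U0.
have [H HH] := forward_hit cX minT lU (ex_intro _ x0 U0).
pose fh := hit T U.
have fhP z : U (iter (fh z) T z) /\ fh z <= H.
  by have [n nH Un] := HH z; have [? h] := hitP Un; split => //; exact: leq_trans h nH.
(* The gaps lie between [A - H = N] and [A + 1 + H = N + 2 * H + 1]; this threshold makes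
   [N %/ e.+1] absorb the excess. *)
exists (e.+1 * (2 * H + 2)) => N N0N.
pose A := N + H.
have [U' [lU' U'0 U'U U'L]] := sparse_nbhd (A * A).+1 lU U0.
have N2 : 2 * H + 2 <= N %/ e.+1 by rewrite leq_divRL // mulnC.
have N1 : 0 < N by have := leq_div N e.+1; move: N2; set q := N %/ _; lia.
(* With [m = r %/ A] pieces this is [(i * r) %/ m]; consecutive values differ by [A] or [A + 1]
   because [r %% A < A <= m], which is where the bound [A * A] comes from. *)
pose a r i := i * A + (i * (r %% A)) %/ (r %/ A).
pose s x i := a (rt U' x) i + fh (iter (a (rt U' x) i) T x).
pose C y := has (fun i => s (base U' y) i == bk U' y) (iota 0 (rt U' (base U' y) %/ A)).
have A0 : 0 < A by rewrite /A; lia.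
have U'ex : exists x, U' x by exists x0.
have lC : lc C.
  apply: (@lc_dep _ _ _ (bk U') (fun j y => has (fun i => s (iter j (hinv T) y) i == j)
     (iota 0 (rt U' (iter j (hinv T) y) %/ A)))); first exact: lc_bk.
  move=> j; apply: (@lc_iteri _ _ (fun x => has (fun i => s x i == j) (iota 0 (rt U' x %/ A)))).
  apply: (@lc_dep _ _ _ (rt U') (fun r x => has (fun i => a r i + fh (iter (a r i) T x) == j)
     (iota 0 (r %/ A)))); first exact: lc_rt.
  move=> r; apply: lc_has => i; apply: (lc_comp (fun n => a r i + n == j)).
  apply: lc_iter; apply: lc_hit => // x; exact: (hit_ex lU (ex_intro _ x0 U0)).
have U'm x : U' x -> A <= rt U' x %/ A.
  by move=> /U'L h; rewrite leq_divRL //; lia.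
have aS x i : U' x -> A <= a (rt U' x) i.+1 - a (rt U' x) i <= A.+1.
  move=> U'x; rewrite /a; have := U'm x U'x.
  have := ltn_pmod (rt U' x) A0.
  set r := _ %% _; set m := _ %/ A => rA Am.
  have h1 : (i * r) %/ m <= (i.+1 * r) %/ m by rewrite leq_div2r // leq_mul.
  have m0 : 0 < m by lia.
  have h2 : (i.+1 * r) %/ m <= ((i * r) %/ m).+1.
    have <- : (1 * m + i * r) %/ m = ((i * r) %/ m).+1 by rewrite divnMDl.
    by rewrite leq_div2r // mulSn mul1n leq_add2r; lia.
  by move: h1 h2; rewrite (mulSn i A); lia.
have a0 r : a r 0 = 0 by rewrite /a !mul0n div0n.
have am x : U' x -> a (rt U' x) (rt U' x %/ A) = rt U' x.
  move=> U'x; rewrite /a mulKn -?divn_eq //; have := U'm x U'x; lia.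
have sS x i : U' x -> N <= s x i.+1 - s x i <= N + N %/ e.+1.
  move=> U'x; have := aS x i U'x; rewrite /s.
  have [_ h1] := fhP (iter (a (rt U' x) i) T x).
  have [_ h2] := fhP (iter (a (rt U' x) i.+1) T x).
  rewrite /A; move: N2; set q := N %/ _; lia.
have smono x i j : U' x -> i <= j -> s x i <= s x j.
  move=> U'x ij; rewrite -(subnK ij); elim: (j - i) => // k IH.
  by apply: leq_trans IH _; have := sS x (k + i) U'x; rewrite addSn; lia.
have hit0 x : U x -> fh x = 0 by move=> Ux; apply/eqP; rewrite -leqn0; case: (@hitP _ T U x 0).
have s0 x : U' x -> s x 0 = 0 by move=> /U'U Ux; rewrite /s a0 /= hit0.
have sm x : U' x -> s x (rt U' x %/ A) = rt U' x.
  by move=> U'x; rewrite /s am // hit0 ?addn0 //; apply: U'U; exact: return_timeP.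
have slt x i : U' x -> i < rt U' x %/ A -> s x i < rt U' x.
  move=> U'x im; rewrite -[X in _ < X]sm //.
  by apply: (@leq_trans (s x i.+1)); [have := sS x i U'x; lia|exact: smono].
have C1 x i : U' x -> i < rt U' x %/ A -> C (iter (s x i) T x).
  move=> U'x im; rewrite /C tower_base_iter ?slt // depth_iter ?slt //.
  by apply/hasP; exists i; rewrite ?mem_iota.
have C2 x i : U' x -> i <= rt U' x %/ A -> C (iter (s x i) T x).
  move=> U'x; rewrite leq_eqVlt => /predU1P[->|]; last exact: C1.
  rewrite sm //; have U'y := return_timeP lU' U'ex x.
  rewrite -[iter _ T x]/(iter 0 T _) -(s0 _ U'y); apply: C1 => //.
  by have := U'm _ U'y; lia.
exists C; split => //.
- rewrite -[x0]/(iter 0 T x0) -(s0 _ U'0); apply: C1 => //.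
  by have := U'm _ U'0; lia.
- move=> y /hasP[i _ /eqP si]; rewrite -(depthK T U' y) -si /s iterD.
  by have [] := fhP (iter (a (rt U' (base U' y)) i) T (base U' y)); rewrite -iterD addnC iterD.
move=> y /hasP[i]; rewrite mem_iota /= add0n => im /eqP si.
have U'x := tower_baseP lU' U'ex y.
rewrite -(depthK T U' y) -si; set x := base U' y in U'x im *.
have := sS x i U'x; set d := s x i.+1 - s x i => dN.
have si1 : s x i.+1 = d + s x i by rewrite /d; lia.
have -> // : rt C (iter (s x i) T x) = d.
apply: return_time_eq; first by lia.
  by rewrite -iterD -si1; exact: C2.
move=> t td; rewrite -iterD.
have tr : t + s x i < rt U' x.
  by rewrite -[X in _ < X]sm //; apply: (@leq_trans (s x i.+1)); [lia|exact: smono].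
rewrite /C tower_base_iter // depth_iter //; apply/hasPn => j _; apply/eqP => sj.
have [/(smono _ _ _ U'x)|/(smono _ _ _ U'x)] := leqP j i; lia.
Qed.

Definition visits (C C1 : X -> bool) x := [seq t <- iota 0 (rt C1 x) | C (iter t T x)].

Definition label (C C1 : X -> bool) (P : X -> nat) x : nat :=
  pickle (P x, C1 x, C1 (iter (rt C x) T x)).

Definition labels C C1 P x := [seq label C C1 P (iter t T x) | t <- visits C C1 x].

Definition inner_label (v : nat) : nat := pickle (v, false, false).

(* [C1] is the base of the level above [C]. Labels record whether a block is the
   first or the last one of its tower; [inner_label] is the label of the others.
   [sm] lists the multisets of labels of towers; the factor 3 accounts for the
   three classes of towers (start, [chi d] false, [chi d] true) at the next level. *)
Record marker (C : X -> bool) (P : X -> nat) (e B : nat) (C1 : X -> bool)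
    (N m : nat) (sm : seq (seq nat)) : Prop := Marker {
  marker_lc : lc C1;
  marker_x0 : C1 x0;
  marker_sub : forall x, C1 x -> C x;
  marker_start : forall x, C1 x -> P x = P x0;
  marker_top : forall x, C x -> C1 (iter (rt C x) T x) ->
    P x = P (base C (hinv T x0));
  marker_gt0 : 0 < N;
  marker_m : m * e.+1 <= N;
  marker_e : e <= N;
  marker_rt : forall x, C1 x -> N <= rt C1 x <= N + N %/ e.+1;
  marker_sm : forall x, C1 x -> sort leq (labels C C1 P x) \in sm;
  marker_size : 3 * size sm <= 2 ^ m;
  marker_count : forall x y, C1 x -> C y ->
    m + B <= count_mem (inner_label (P y)) (labels C C1 P x)
}.

(** For [k = m %/ p.+1] the base is at most [D * k.+1], and once [3 * D ^ p <= k] the left side is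
    at most [k.+1 ^ p.+1], hence at most [2 ^ (k * p.+1)]. *)
Lemma poly_le_exp c p : exists m0, forall m, m0 <= m ->
  3 * (2 * (c * m) + 1) ^ p <= 2 ^ m.
Proof.
pose D := (2 * c + 1) * p.+1; exists (p.+1 * (3 * D ^ p)) => m hm.
pose k := m %/ p.+1.
have hk : 3 * D ^ p <= k by rewrite leq_divRL // mulnC.
have h1 : 2 * (c * m) + 1 <= D * k.+1.
  have : m < k.+1 * p.+1 by rewrite /k; have := ltn_pmod m (ltn0Sn p);
    rewrite {2}(divn_eq m p.+1) mulSn; lia.
  by rewrite /D -mulnA (mulnC p.+1); nia.
apply: (@leq_trans (3 * (D * k.+1) ^ p)); first by rewrite leq_mul //; case: (p) => // q; rewrite leq_exp2r.
rewrite expnMn mulnA; apply: (@leq_trans (k.+1 ^ p.+1)).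
  by rewrite expnS leq_mul //; exact: leqW.
apply: (@leq_trans ((2 ^ k) ^ p.+1)); first by rewrite leq_exp2r //; exact: ltn_expl.
by rewrite -expnM leq_exp2l // leq_divM.
Qed.

Lemma count_hits (q : X -> bool) G : (forall z, exists2 t, t < G & q (iter t T z)) ->
  forall n s x, n <= count (fun t => q (iter t T x)) (iota s (n * G)).
Proof.
move=> hq; elim=> [|n IH] s x //.
rewrite mulSn iotaD count_cat -add1n leq_add //.
have [t tG qt] := hq (iter s T x).
rewrite -has_count; apply/hasP; exists (s + t); first by rewrite mem_iota; lia.
by rewrite addnC iterD.
Qed.

Lemma count_le1 (a : pred nat) s : uniq s ->
  (forall i j, i \in s -> j \in s -> a i -> a j -> i = j) -> count a s <= 1.
Proof.
move=> us ha; rewrite -size_filter.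
have : uniq [seq i <- s | a i] by exact: filter_uniq.
have : forall i j, i \in [seq i <- s | a i] -> j \in [seq i <- s | a i] -> i = j.
  by move=> i j; rewrite !mem_filter => /andP[? ?] /andP[? ?]; exact: ha.
case: [seq i <- s | a i] => [|i [|j l]] // h /= /andP[/negP[]].
by rewrite (h i j) ?mem_head // !inE eqxx ?orbT.
Qed.

(** A multiset is given by its multiplicities, one number from [0] to [n] for each entry of [KL];
    [F] picks a sorted representative of each multiplicity function that occurs. *)
Lemma multisets_bound (KL : seq nat) n : exists sm : seq (seq nat),
  size sm = n.+1 ^ size KL /\
  forall s, size s <= n -> {subset s <= KL} -> sort leq s \in sm.
Proof.
pose p := size KL.
pose cf (s : seq nat) : {ffun 'I_p -> 'I_n.+1} :=
  [ffun i : 'I_p => inord (count_mem (nth 0 KL i) s)].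
pose ok (s : seq nat) := size s <= n /\ {subset s <= KL}.
pose F f := sort leq (xget [::] [set s | ok s /\ cf s = f]).
exists [seq F f | f <- enum {: {ffun 'I_p -> 'I_n.+1}}]; split.
  by rewrite size_map -cardE card_ffun !card_ord.
move=> s sn sK; apply/mapP; exists (cf s); first by rewrite mem_enum.
have : [set s' | ok s' /\ cf s' = cf s] s by [].
move=> /(xgetI [::])[[sn' sK'] e]; rewrite /F.
set s' := xget _ _ in sn' sK' e *; clearbody s'.
apply/perm_sort_leP; apply/allP => x; rewrite mem_cat => xs.
have /(nthP 0)[i iK <-] : x \in KL by case/orP: xs; [exact: sK|exact: sK'].
have /= := congr1 (fun f : {ffun 'I_p -> 'I_n.+1} => f (Ordinal iK) : nat) e.
have c t : size t <= n -> count_mem (nth 0 KL i) t < n.+1.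
  by move=> tn; rewrite ltnS; apply: leq_trans tn; exact: count_size.
by rewrite !ffunE !inordK ?c // => /eqP; rewrite eq_sym.
Qed.

(** The gap bound [G] for visits to each value of [P] is fixed before the new base is chosen. Towers
    of height about [N = c * m] thus contain at least [2 * m] copies of each value, while the
    multisets number at most a power of [2 * N + 1] with the exponent [size KL] fixed. A large [m]
    satisfies both demands. *)
Lemma exists_marker (C : X -> bool) (P : X -> nat) e B : lc C -> C x0 -> lc P ->
  exists C1 N m sm, marker C P e B C1 N m sm.
Proof.
move=> lC C0 lP; have Cex : exists x, C x by exists x0.
have [K PK] := lc_bounded cX lP.
have lCP v : lc (fun x => C x && (P x == v)).
  by apply: (lc_comp2 andb) => //; exact: (lc_comp (fun n => n == v)).
have /choice[G0 HG0] v : exists G, (exists y, C y && (P y == v)) ->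
    forall x, exists2 n, n <= G & C (iter n T x) && (P (iter n T x) == v).
  have [|h] := pselect (exists y, C y && (P y == v)).
    by move=> /(forward_hit cX minT (lCP v))[G HG]; exists G.
  by exists 0.
pose G := (\sum_(v < K.+1) G0 v).+1.
have HG v x : (exists y, C y && (P y == v)) ->
    exists2 n, n < G & C (iter n T x) && (P (iter n T x) == v).
  move=> [y /[dup] Cy /andP[_ /eqP Pv]].
  have [n nG Cn] := HG0 v (ex_intro _ y Cy) x; exists n => //.
  have vK : v < K.+1 by rewrite -Pv ltnS.
  by rewrite /G ltnS (bigD1 (Ordinal vK)) //=; apply: leq_trans nG _; exact: leq_addr.
pose pl := P (base C (hinv T x0)).
(* A base inside [U] forces all towers of the next level to share the type of their first block, and
   also that of their last block, which is seen from the base through [hinv T]. *)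
pose U x := [&& C x, P x == P x0 & P (base C (hinv T x)) == pl].
have lU : lc U.
  apply: (lc_comp2 andb) => //; apply: (lc_comp2 andb); apply: (lc_comp (fun n => n == _)) => //.
  by apply: (lc_precomp cTi (f := fun x => P (base C x))); exact: lc_base.
have U0 : U x0 by rewrite /U C0 !eqxx.
have [N0 HN0] := near_constant_marker e lU U0.
pose KL : seq nat := [seq pickle (nat_of_ord w.1.1, w.1.2, w.2) | w <- enum {: 'I_K.+1 * bool * bool}].
pose c := 2 * G * e.+1.
have [m0 Hm0] := poly_le_exp c (size KL).
(* [m0] is for the count of multisets, [N0] for the marker threshold, [B] for the reserve in
   [marker_count], [e] for [marker_e], and [2] for the first and last blocks, which do not count as
   inner ones. *)
pose m := m0 + N0 + B + e + 2.
pose N := c * m.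
have c2 : 2 * e.+1 <= c by rewrite /c; have := ltn0Sn (\sum_(v < K.+1) G0 v); rewrite -/G; nia.
have mN : m * e.+1 <= N by rewrite /N; nia.
have mN' : m <= N by nia.
have [|C1 [lC1 C10 C1U rtC1]] := HN0 N; first by move: mN'; rewrite /m; lia.
have [sm [ssm Hsm]] := multisets_bound KL (2 * N).
have C1ex : exists x, C1 x by exists x0.
have C1C x : C1 x -> C x by move=> /C1U /andP[].
exists C1, N, m, sm; split => //.
- by move=> x /C1U /and3P[_ /eqP].
- move=> x Cx /C1U /and3P[_ _ /eqP]; rewrite /return_time iterS hfunK.
  by rewrite tower_base_iter.
- by move: mN'; rewrite /m; lia.
- by move: mN'; rewrite /m; lia.
- move=> x C1x; apply: Hsm.
    rewrite size_map size_filter; apply: leq_trans (count_size _ _) _.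
    by rewrite size_iota; have := rtC1 x C1x; have := leq_div N e.+1; lia.
  move=> _ /mapP[t _ ->]; apply/mapP.
  have vK : P (iter t T x) < K.+1 by rewrite ltnS.
  exists (Ordinal vK, C1 (iter t T x), C1 (iter (rt C (iter t T x)) T (iter t T x))).
    by rewrite mem_enum.
  by [].
- rewrite ssm; apply: leq_trans (Hm0 m _); last by rewrite /m; lia.
  by rewrite -/N addn1.
move=> x y C1x Cy.
set v := P y; pose q z := C z && (P z == v).
have qG z : exists2 t, t < G & q (iter t T z).
  by apply: HG; exists y; rewrite Cy /=.
pose r := rt C1 x.
have rN : 2 * m * e.+1 * G <= r.
  by have := rtC1 x C1x; rewrite -/r /N /c; nia.
have cq := count_hits qG (2 * m * e.+1) 0 x.
have {}cq : 2 * m <= count (fun t => q (iter t T x)) (iota 0 r).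
  apply: (@leq_trans (2 * m * e.+1)); first by rewrite leq_pmulr.
  by apply: leq_trans cq _; rewrite -(subnKC rN) iotaD count_cat leq_addr.
(* A visit to the value [v] fails to have the inner label only at the first or at the last block of
   the tower, so at most two visits are lost. *)
pose a1 t := C1 (iter t T x).
pose a2 t := C (iter t T x) && C1 (iter (rt C (iter t T x)) T (iter t T x)).
have c1 : count a1 (iota 0 r) <= 1.
  apply: count_le1; first exact: iota_uniq.
  have z i : i \in iota 0 r -> a1 i -> i = 0.
    rewrite mem_iota add0n /= => ir C1i; apply/eqP; rewrite -leqn0 leqNgt.
    apply/negP => i0; have := @return_time_notin _ T C1 x i.
    by rewrite i0 ir => /(_ isT); rewrite [C1 _]C1i.
  by move=> i j /z hi /z hj /hi -> /hj ->.
have c2' : count a2 (iota 0 r) <= 1.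
  apply: count_le1; first exact: iota_uniq.
  have z i : i \in iota 0 r -> a2 i -> i + rt C (iter i T x) = r /\ C (iter i T x).
    rewrite mem_iota add0n /= => ir /andP[Ci]; rewrite -iterD addnC => C1i; split => //.
    apply/eqP; rewrite eqn_leq [X in _ && X]return_time_le ?andbT // ?addn_gt0 ?orbT //.
    rewrite -leq_subRL ?(ltnW ir) // return_time_le ?subn_gt0 //.
    by rewrite -iterD subnK ?(ltnW ir) //; apply: C1C; exact: return_timeP.
  move=> i j /z hi /z hj /hi[ei Ci] /hj[ej Cj].
  wlog ij : i j hi hj ei ej Ci Cj / i < j.
    by move=> w; case: (ltngtP i j) => // h; [exact: w|symmetry; exact: w].
  have := @return_time_le _ T C (iter i T x) (j - i).
  rewrite subn_gt0 ij -iterD subnK ?(ltnW ij) // => /(_ isT Cj).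
  by have : 0 < rt C (iter j T x) by []; lia.
have : count (fun t => q (iter t T x)) (iota 0 r) <=
    count_mem (inner_label v) (labels C C1 P x) + count a1 (iota 0 r) + count a2 (iota 0 r).
  rewrite count_map count_filter.
  elim: (iota 0 r) => //= t s IHs.
  suff : q (iter t T x) <= (label C C1 P (iter t T x) == inner_label v) && C (iter t T x)
    + a1 t + a2 t by move: IHs; lia.
  rewrite /q /a2; case: (C (iter t T x)) => //=; case: eqP => // Pv /=; rewrite andbT.
  rewrite /label /inner_label Pv /a1.
  case: (C1 (iter t T x)); first by rewrite addnC addnA leq_addl.
  case: (C1 _); first by rewrite leq_addl.
  by rewrite eqxx.
by move: cq c1 c2'; rewrite /m; lia.
Qed.

End Markers.

(** * Refining a tower structure *)

Section Arrangement.

(** Each bit costs one [a] and one [b], so all bit strings of a given length use the same multiset,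
    and the number of available copies alone decides whether a code fits. *)
Definition pair_word (a b : nat) (s : seq bool) : seq nat :=
  flatten [seq if c then [:: a; b] else [:: b; a] | c <- s].

Lemma pair_word_cat a b s t : pair_word a b (s ++ t) = pair_word a b s ++ pair_word a b t.
Proof. by rewrite /pair_word map_cat flatten_cat. Qed.

Lemma map_pair_word (h : nat -> nat) a b s :
  map h (pair_word a b s) = pair_word (h a) (h b) s.
Proof. by elim: s => //= c s IH; rewrite map_cat; congr (_ ++ _) => //; case: c. Qed.

Lemma pair_word_inj a b s t : a != b -> pair_word a b s = pair_word a b t -> s = t.
Proof.
move=> ab; elim: s t => [|c s IH] [|d t] //=; [by case: d|by case: c|].
by case: c; case: d => /= -[]; [move/IH ->| |move=> e|move/IH ->] => //;
  move: ab; rewrite ?e ?eqxx // => + e; rewrite e eqxx.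
Qed.

Lemma size_pair_word a b s : size (pair_word a b s) = (size s).*2.
Proof. by elim: s => //= c s IH; rewrite size_cat IH; case: c. Qed.

Lemma count_pair_word a b s z :
  count_mem z (pair_word a b s) = size s * ((a == z) + (b == z)).
Proof. by elim: s => //= c s IH; rewrite count_cat IH mulSn; case: c => /=; lia. Qed.

Lemma perm_catr_exists (u t : seq nat) :
  (forall z, count_mem z u <= count_mem z t) -> exists r, perm_eq (u ++ r) t.
Proof.
elim: u t => [|x u IH] t h; first by exists t.
have xt : x \in t by rewrite -has_pred1 has_count; apply: leq_trans (h x); rewrite /= eqxx.
have [z|r pr] := IH (rem x t).
  have := h z; have /permP/(_ (pred1 z)) := perm_to_rem xt; rewrite /= => ->.
  by rewrite leq_add2l.
exists r; rewrite perm_sym; apply: perm_trans (perm_to_rem xt) _.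
by rewrite /= perm_cons perm_sym.
Qed.

(** Since [f], [l], [a], [b] are distinct, their multiplicities can be compared with those of [ms]
    one at a time; whatever is left over goes into [r]. *)
Lemma arrangement f l a b bits ms : f != l -> a != b ->
  a != f -> b != f -> a != l -> b != l -> f \in ms -> l \in ms ->
  size bits <= count_mem a ms -> size bits <= count_mem b ms ->
  exists r, perm_eq (f :: pair_word a b bits ++ rcons r l) ms.
Proof.
move=> fl ab af bf al bl fms lms ca cb.
have [z|r pr] := @perm_catr_exists (f :: l :: pair_word a b bits) ms.
  rewrite /= count_pair_word.
  have f1 : 0 < count_mem f ms by rewrite -has_count has_pred1.
  have l1 : 0 < count_mem l ms by rewrite -has_count has_pred1.
  have [<-|nf] := eqVneq f z.
    by rewrite (eq_sym l) (negbTE fl) (negbTE af) (negbTE bf) muln0.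
  have [<-|nl] := eqVneq l z; first by rewrite (negbTE al) (negbTE bl) muln0.
  have [<-|na] := eqVneq a z; first by rewrite (eq_sym b) (negbTE ab) muln1.
  by have [<-|nb] := eqVneq b z; rewrite ?muln1 ?muln0.
exists r; apply: perm_trans pr; rewrite /= perm_cons.
by rewrite -cats1 catA -cat_cons perm_catC.
Qed.

Lemma exists_code (s : seq nat) m : size s <= 2 ^ m -> exists code : nat -> seq bool,
  (forall w, size (code w) = m) /\ {in s &, injective code}.
Proof.
move=> sm; pose E := enum {: m.-tuple bool}.
have sE : size E = 2 ^ m by rewrite -cardE card_tuple card_bool.
exists (fun w => tval (nth [tuple of nseq m false] E (index w s))); split=> [w|w w' ws w's].
  by rewrite size_tuple.
move=> /val_inj/eqP; rewrite nth_uniq ?enum_uniq ?sE //;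
  try by apply: leq_trans sm; rewrite index_mem.
by move=> /eqP /(congr1 (nth 0 s)); rewrite !nth_index.
Qed.

(** Writing all patterns into one tower costs [k * 2 ^ k] copies of [a] and of [b]. This is the
    reserve asked for in [inv_marker]; the successor there keeps it positive when [k = 0]. *)
Definition all_patterns k : seq bool := flatten [seq tval t | t <- enum {: k.-tuple bool}].

Lemma size_all_patterns k : size (all_patterns k) = k * 2 ^ k.
Proof.
have -> : 2 ^ k = size (enum {: k.-tuple bool}) by rewrite -cardE card_tuple card_bool.
rewrite /all_patterns; elim: (enum _) => [|t E IH]; first by rewrite muln0.
by rewrite /= size_cat IH size_tuple mulnS.
Qed.

Lemma flatten_infix (T : eqType) (ss : seq (seq T)) s : s \in ss ->
  exists u v, flatten ss = u ++ s ++ v.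
Proof.
elim: ss => //= t ss IH; rewrite inE => /predU1P[->|/IH[u [v ->]]].
  by exists [::], (flatten ss).
by exists (t ++ u), v; rewrite catA.
Qed.

Lemma all_patternsP k (s : seq bool) : size s = k ->
  exists u v, all_patterns k = u ++ s ++ v.
Proof.
move=> sk; apply: flatten_infix; apply/mapP.
by exists (Tuple (introT eqP sk)); rewrite ?mem_enum.
Qed.

End Arrangement.

(* One level: its base [sC], the base [sC1] of the next level, and a preliminary
   label [sP] on [sC]. The complete label [kap] below also tells whether the tower
   is the first or the last block of a tower of the next level; [spt] and [spix]
   read off from it the vertex of the diagram and the order of the tower. Labels
   are encoded as natural numbers, so that all levels have the same type. *)
Record state (X : Type) := State {
  sC : X -> bool;
  sC1 : X -> bool;
  sP : X -> nat;
  spt : nat -> nat;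
  spix : nat -> seq nat
}.

Definition decode (S : countType) (d : S) (n : nat) : S := odflt d (unpickle n).

Lemma decodeK (S : countType) (d s : S) : decode d (pickle s) = s.
Proof. by rewrite /decode pickleK. Qed.

Section Step.
Variables (X : topologicalType) (T : homeo X X).
Hypotheses (cantorX : is_cantor X) (minT : minimal T).
Variables (chi : nat -> X -> bool) (x0 : X).
Hypothesis lchi : forall n, locally_constant (chi n).
Hypothesis schi : forall x y, (forall n, chi n x = chi n y) -> x = y.
(** The comparison with the given sequence is kept abstract: the construction only has to obtain [k]
    once the length [L] is known. *)
Variable grows : nat -> nat -> nat -> Prop.
Hypothesis growsP : forall i L, 0 < L -> exists k, i <= k /\ grows i k L.

Local Notation lc := (@locally_constant X _).
Local Notation rt := (return_time T).
Local Notation base := (tower_base T).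
Let cX : compact [set: X] := cantor_compact cantorX.
Let cT : continuous T := @hfun_continuous _ _ T.

(** The full label, with no useful bound on the number of its values. The vertex [tau] and the order
    [ix] are functions of it, so that levels can be compared through labels alone. *)
Definition kap (s : state X) x := label T (sC s) (sC1 s) (sP s) x.
Definition tau s x := spt s (kap s x).
Definition ix s x := spix s (kap s x).

(** [inv_names] lets labels separate more and more points. By [inv_class] the vertex of a block
    shows whether it starts a tower of the next level; by [inv_top] it does not show whether it ends
    one, which keeps inner blocks available as representatives. [inv_marker] fixes the next base
    together with the two towers [ya], [yb] that will serve as [a] and [b]. *)
Record admissible (i : nat) (s : state X) : Prop := Inv {
  inv_lC : lc (sC s);
  inv_C0 : sC s x0;
  inv_lP : lc (sP s);
  inv_perm : forall x, sC s x -> perm_eq (ix s x) (iota 0 (rt (sC s) x));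
  inv_head : forall x, sC s x -> exists u, ix s x = 0 :: u;
  inv_last : forall x, sC s x -> last 0 (ix s x) = (rt (sC s) x).-1;
  inv_rt : forall x y, sC s x -> sC s y -> sP s x = sP s y -> rt (sC s) x = rt (sC s) y;
  inv_names : forall x y n j, sC s x -> sC s y -> sP s x = sP s y ->
    n < i -> j < rt (sC s) x -> chi n (iter j T x) = chi n (iter j T y);
  inv_class : forall x y, sC s x -> sC s y -> tau s x = tau s y -> sC1 s x -> sC1 s y;
  inv_top : forall (v : nat) (b t : bool),
    spt s (pickle (v, b, t)) = spt s (pickle (v, b, false));
  inv_marker : exists N m sm k ya yb,
    [/\ marker T x0 (sC s) (sP s) i (k * 2 ^ k).+1 (sC1 s) N m sm,
        sC s ya /\ sC s yb,
        spt s (inner_label (sP s ya)) <> spt s (inner_label (sP s yb)),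
        i <= k & grows i k (rt (sC s) ya + rt (sC s) yb)]
}.

(* [od] lists the times of the blocks in the new order, [sg] their labels, which
   depend only on the vertex of the tower. *)
Record refinement (i : nat) (s s' : state X) (sg : nat -> seq nat) (od : X -> seq nat)
    (N : nat) (sW : seq nat) (k a b : nat) : Prop := Good {
  good_C : sC s' = sC1 s;
  good_od : forall x, sC s' x -> perm_eq (od x) (visits T (sC s) (sC s') x);
  good_sg : forall x, sC s' x -> [seq kap s (iter t T x) | t <- od x] = sg (tau s' x);
  good_ix : forall x, sC s' x ->
    ix s' x = flatten [seq [seq t + j | j <- ix s (iter t T x)] | t <- od x];
  good_inj : forall x y, sC s' x -> sC s' y ->
    map (spt s) (sg (tau s' x)) = map (spt s) (sg (tau s' y)) -> tau s' x = tau s' y;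
  good_ab : spt s a != spt s b;
  good_k : i <= k;
  good_grows : grows i k (size (spix s a) + size (spix s b));
  good_rich : forall x (bits : seq bool), sC s' x -> size bits = k ->
    exists u v, sg (tau s' x) = u ++ pair_word a b bits ++ v;
  good_N : 0 < N /\ i <= N;
  good_rt : forall x, sC s' x -> N <= rt (sC s') x <= N + N %/ i.+1;
  good_sW : forall x, sC s' x -> tau s' x \in sW;
  good_size : size sW ^ i.+1 <= 2 ^ N;
  good_sub : forall x, sC s' x -> sC s x;
  good_pos : forall x y, sC s' x -> sC s y ->
    exists2 t, t \in visits T (sC s) (sC s') x & tau s (iter t T x) = tau s y
}.

Implicit Types (C : X -> bool) (P : X -> nat).

Lemma lc_label C C1 P : lc C -> (exists x, C x) -> lc C1 -> lc P -> lc (label T C C1 P).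
Proof.
move=> lC C0 lC1 lP.
apply: (lc_comp2 (fun (u : nat * bool) v => pickle (u, v))).
  exact: (lc_comp2 pair).
apply: (@lc_dep _ _ _ (rt C) (fun r x => C1 (iter r T x))); first exact: lc_rt.
by move=> r; exact: lc_iter.
Qed.

Lemma lc_visits C C1 : lc C -> lc C1 -> (exists x, C1 x) -> lc (visits T C C1).
Proof.
move=> lC lC1 C1ex.
apply: (@lc_dep _ _ _ (rt C1) (fun r x => [seq t <- iota 0 r | C (iter t T x)])).
  exact: lc_rt.
by move=> r; apply: (lc_filter _ (p := fun t x => C (iter t T x))) => t; exact: lc_iter.
Qed.

Lemma lc_labels C C1 P : lc C -> (exists x, C x) -> lc C1 -> (exists x, C1 x) -> lc P ->
  lc (labels T C C1 P).
Proof.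
move=> lC C0 lC1 C1ex lP.
apply: (@lc_dep _ _ _ (visits T C C1) (fun v x => [seq label T C C1 P (iter t T x) | t <- v])).
  exact: lc_visits.
by move=> v; apply: lc_map => t; apply: lc_iter; exact: lc_label.
Qed.

Lemma flatten_visits C x n s : lc C -> C (iter s T x) -> C (iter (s + n) T x) ->
  flatten [seq iota t (rt C (iter t T x)) | t <- iota s n & C (iter t T x)] = iota s n.
Proof.
move=> lC; have [M] := ubnP n; elim: M n s => // M IH n s nM Cs Csn.
case: (posnP n) => [->//|n0].
set r := rt C (iter s T x).
have rn : r <= n by apply: return_time_le; rewrite // -iterD addnC.
have r0 : 0 < r by [].
rewrite -{1}(subnKC rn) iotaD filter_cat map_cat flatten_cat (IH (n - r) (s + r)).
- have -> : [seq t <- iota s r | C (iter t T x)] = [:: s].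
    rewrite -(prednK r0) /= Cs; congr cons; apply/eqP; rewrite -(negbK (_ == _)) -has_filter.
    apply/hasPn => t; rewrite mem_iota => ts.
    have -> : t = (t - s) + s by lia.
    by rewrite iterD; apply: return_time_notin; move: ts; rewrite -/r /r /return_time; lia.
  by rewrite -[flatten _]/(iota s r ++ [::]) cats0 -iotaD subnKC.
- by lia.
- by rewrite addnC iterD; apply: return_timeP => //; exists (iter s T x).
- by rewrite -addnA subnKC.
Qed.

Section MarkerFacts.
Variables (C : X -> bool) (P : X -> nat) (e B : nat) (C1 : X -> bool) (N m : nat) (sm : seq (seq nat)).
Hypotheses (lC : lc C) (C0 : C x0) (B0 : 0 < B).
Hypothesis mk : marker T x0 C P e B C1 N m sm.

Definition first_label : nat := pickle (P x0, true, false).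
Definition last_label : nat := pickle (P (base C (hinv T x0)), false, true).

Let C1C x : C1 x -> C x := marker_sub mk (x := x).
Let lC1 : lc C1 := marker_lc mk.
Let C1ex : exists x, C1 x. Proof. by exists x0; exact: marker_x0 mk. Qed.
Let Cex : exists x, C x. Proof. by exists x0. Qed.

Lemma label_inj x y : label T C C1 P x = label T C C1 P y ->
  [/\ P x = P y, C1 x = C1 y & C1 (iter (rt C x) T x) = C1 (iter (rt C y) T y)].
Proof. by move=> /(pcan_inj pickleK)[]. Qed.

Lemma mem_visits t x : (t \in visits T C C1 x) = (t < rt C1 x) && C (iter t T x).
Proof. by rewrite mem_filter mem_iota /= add0n andbC. Qed.

Lemma marker_visit x y : C1 x -> C y -> exists2 t, t \in visits T C C1 x &
  label T C C1 P (iter t T x) = inner_label (P y).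
Proof.
move=> C1x Cy; have : 0 < count_mem (inner_label (P y)) (labels T C C1 P x).
  by apply: leq_trans (marker_count mk C1x Cy); rewrite addn_gt0 B0 orbT.
by rewrite -has_count has_pred1 => /mapP[t tv ->]; exists t.
Qed.

(** An inner block is not the first one, so a tower has more than one block; thus its first block is
    never also its last. *)
Lemma marker_rt_lt x : C1 x -> rt C x < rt C1 x.
Proof.
move=> C1x; have [t] := marker_visit C1x C0.
rewrite mem_visits => /andP[tr Ct] /(pcan_inj pickleK)[_ nC1 _].
apply: leq_ltn_trans tr; apply: return_time_le => //.
by case: t nC1 {Ct} => //=; rewrite C1x.
Qed.

Lemma visits_cons x : C1 x -> exists v, visits T C C1 x = 0 :: v.
Proof. by move=> C1x; rewrite /visits /= C1C //; eexists. Qed.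

Lemma start_label x : C1 x -> label T C C1 P x = first_label.
Proof.
move=> C1x; rewrite /label /first_label (marker_start mk C1x) C1x.
congr (pickle (_, _)); apply/negbTE; apply: return_time_notin.
by rewrite marker_rt_lt.
Qed.

Lemma first_visit x t : C1 x -> t \in visits T C C1 x ->
  label T C C1 P (iter t T x) = first_label -> t = 0.
Proof.
move=> C1x; rewrite mem_visits => /andP[tr _] /(pcan_inj pickleK)[_ C1t _].
apply/eqP; rewrite -leqn0 leqNgt; apply/negP => t0.
by have := @return_time_notin _ T C1 x t; rewrite C1t t0 tr => /(_ isT).
Qed.

Lemma visit_rt_le x t : C1 x -> t \in visits T C C1 x -> t + rt C (iter t T x) <= rt C1 x.
Proof.
move=> C1x; rewrite mem_visits => /andP[tr Ct].
rewrite -leq_subRL ?(ltnW tr) // return_time_le ?subn_gt0 //.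
by rewrite -iterD subnK ?(ltnW tr) //; apply: C1C; exact: return_timeP.
Qed.

Lemma top_visit x t : C1 x -> t \in visits T C C1 x ->
  C1 (iter (rt C (iter t T x)) T (iter t T x)) -> t + rt C (iter t T x) = rt C1 x.
Proof.
move=> C1x tv; rewrite -iterD addnC => C1t; apply/eqP; rewrite eqn_leq visit_rt_le //=.
by apply: return_time_le => //; rewrite addn_gt0 orbT.
Qed.

Lemma last_visit x t : C1 x -> t \in visits T C C1 x ->
  label T C C1 P (iter t T x) = last_label -> t + rt C (iter t T x) = rt C1 x.
Proof.
move=> C1x tv /(pcan_inj pickleK)[_ _ C1t]; exact: top_visit.
Qed.

(** The last block is the one containing the top point [z] of the tower. By [marker_rt_lt] it
    differs from the first block, so its first flag is false. *)
Lemma last_label_mem x : C1 x -> last_label \in labels T C C1 P x.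
Proof.
move=> C1x; set r := rt C1 x; have r0 : 0 < r by [].
pose z := iter r.-1 T x.
have fz : depth T C z <= r.-1.
  have h : C (iter r.-1 (hinv T) z) by rewrite /z iter_hinvK C1C.
  by have [] := hitP h.
set j := depth T C z in fz; set t := r.-1 - j.
have ty : iter t T x = base C z by rewrite /tower_base -/j /z iter_hinv_sub.
have Cy : C (base C z) by exact: tower_baseP.
have jy : j < rt C (base C z) by exact: depth_lt.
have top : iter j.+1 T (base C z) = iter r T x.
  by rewrite -ty -iterD; congr (iter _ T x); rewrite /t; lia.
have rty : rt C (base C z) = j.+1.
  apply/eqP; rewrite eqn_leq jy andbT; apply: return_time_le => //.
  by rewrite top; apply: C1C; exact: return_timeP.
have t0 : t != 0.
  apply/eqP => t0; move: rty; rewrite -ty t0 /= => rtx.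
  by have := marker_rt_lt C1x; rewrite rtx -/r; move: t0; rewrite /t; lia.
have tr : t < r by rewrite /t; lia.
apply/mapP; exists t; first by rewrite mem_visits ty Cy tr.
have C1r : C1 (iter (rt C (base C z)) T (base C z)) by rewrite rty top; exact: return_timeP.
rewrite ty /label /last_label C1r (marker_top mk Cy C1r); congr (pickle (_, _, _)).
by apply/esym/negbTE; rewrite -ty; apply: return_time_notin; rewrite lt0n t0 tr.
Qed.

(** The list must depend on [W x] alone. It is built from any tower with this value, and it is a
    rearrangement of the labels of every other such tower because [W] determines the multiset. The
    code makes [W x] readable from the list; [pat] is carried along. *)
Lemma exists_rearrangement (W : X -> nat) (sW : seq nat) (pat : seq bool) ya yb :
  C ya -> C yb -> P ya <> P yb -> size pat <= B ->
  (forall x, C1 x -> W x \in sW) -> size sW <= 2 ^ m ->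
  (forall x y, C1 x -> C1 y -> W x = W y ->
    perm_eq (labels T C C1 P x) (labels T C C1 P y)) ->
  exists (sg : nat -> seq nat) (code : nat -> seq bool),
   [/\ forall w, size (code w) = m, {in sW &, injective code} &
    forall x, C1 x -> perm_eq (sg (W x)) (labels T C C1 P x) /\
    exists r, sg (W x) = first_label ::
      pair_word (inner_label (P ya)) (inner_label (P yb)) (code (W x) ++ pat) ++
      rcons r last_label].
Proof.
move=> Cya Cyb yab patB WsW sWm WP.
have [code [scode codeI]] := exists_code sWm.
have neq (u v : nat * bool * bool) : u <> v -> pickle u != pickle v.
  by move=> uv; apply/eqP => /(pcan_inj pickleK).
have /choice[sg Hsg] w : exists sg : seq nat, forall x, C1 x -> W x = w ->
    perm_eq sg (labels T C C1 P x) /\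
    exists r, sg = first_label ::
      pair_word (inner_label (P ya)) (inner_label (P yb)) (code w ++ pat) ++
      rcons r last_label.
  have [[x [C1x Wx]]|no] := pselect (exists x, C1 x /\ W x = w); last first.
    by exists [::] => x C1x Wx; case: no; exists x.
  have sz y : C y -> size (code w ++ pat) <= count_mem (inner_label (P y)) (labels T C C1 P x).
    move=> Cy; apply: leq_trans (marker_count mk C1x Cy).
    by rewrite size_cat scode leq_add2l.
  have fl : first_label != last_label by apply: neq => -[].
  have ab : inner_label (P ya) != inner_label (P yb) by apply: neq => -[].
  have nf v : inner_label v != first_label by apply: neq => -[].
  have nl v : inner_label v != last_label by apply: neq => -[].
  have fm : first_label \in labels T C C1 P x.
    rewrite /labels; have [v ->] := visits_cons C1x.
    by rewrite map_cons inE -(start_label C1x) eqxx.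
  have [r pr] := arrangement fl ab (nf _) (nf _) (nl _) (nl _) fm (last_label_mem C1x)
    (sz _ Cya) (sz _ Cyb).
  eexists => y C1y Wy; split; last by exists r.
  by apply: perm_trans pr _; apply: WP => //; rewrite Wy.
exists sg, code; split => // x C1x; exact: Hsg.
Qed.

End MarkerFacts.

(** Labels repeat, so the permutation realizing [sg] is not unique. Choosing it as a function of the
    two lists makes the new order a function of the label of the tower. *)
Definition reorder (lab sg : seq nat) : seq nat :=
  xget [::] [set Is | perm_eq Is (iota 0 (size lab)) /\ sg = [seq nth 0 lab j | j <- Is]].

Lemma reorderP lab sg : perm_eq sg lab -> perm_eq (reorder lab sg) (iota 0 (size lab)) /\
  sg = [seq nth 0 lab j | j <- reorder lab sg].
Proof.
move=> p; rewrite /reorder.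
set A := [set Is | _]; suff : A (xget [::] A) by [].
by apply: xgetPex; have /(perm_iotaP 0)[Is pI e] := p; exists Is.
Qed.

(** The new label [P'] stores the visits, the labels of the blocks and a long name, from which the
    order of the tower is computed. The new vertex [W] retains only the sorted labels and the class,
    which keeps its values within the [2 ^ m] available codes. *)
Lemma step i s : admissible i s -> exists s' sg od N sW k a b,
  refinement i s s' sg od N sW k a b /\ admissible i.+1 s'.
Proof.
move=> [lC C0 lP perm head last_ rtP names cls top [N [m [sm [k [ya [yb [mk [Cya Cyb] ptab ik gr]]]]]]]].
set C := sC s in lC C0 perm head last_ rtP names cls mk Cya Cyb gr.
set P := sP s in lP rtP names mk ptab.
set C1 := sC1 s in cls mk.
have B0 : 0 < (k * 2 ^ k).+1 by [].
have lC1 : lc C1 := marker_lc mk.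
have C10 : C1 x0 := marker_x0 mk.
have C1ex : exists x, C1 x by exists x0.
have Cex : exists x, C x by exists x0.
have C1C x : C1 x -> C x := marker_sub mk (x := x).
pose y1 := iter (rt C1 x0) T x0.
have C1y1 : C1 y1 by exact: return_timeP.
(* [x0] and its first return [y1] both lie in [C1]; the coordinate separating them gives two
   different inner vertices for the next level. *)
have [d Hd] : exists d, chi d y1 <> chi d x0.
  apply/existsNP => h; apply: (@minimal_aperiodic _ cantorX T (rt C1 x0).-1 x0) => //.
  exact: schi.
(* Large enough to contain the coordinate [d] and all coordinates [n < i.+1] required by
   [inv_names]. *)
pose nn := (i + d).+2.
pose nm x := [seq [seq chi n (iter j T x) | n <- iota 0 nn] | j <- iota 0 (rt C1 x)].
pose vs x := visits T C C1 x.
pose ls x := labels T C C1 P x.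
pose P' x : nat := pickle (vs x, ls x, nm x).
have lP' : lc P'.
  apply: (lc_comp2 (fun (u : seq nat * seq nat) (v : seq (seq bool)) => pickle (u, v))).
    by apply: (lc_comp2 pair); [exact: lc_visits|exact: lc_labels].
  apply: (@lc_dep _ _ _ (rt C1) (fun r x => [seq [seq chi n (iter j T x) | n <- iota 0 nn] | j <- iota 0 r])).
    exact: lc_rt.
  by move=> r; apply: lc_map => j; apply: lc_map => n; exact: lc_iter.
(* The two heights are already known, while [C2] is not yet chosen; its markers can therefore
   reserve room for all patterns of [k'] bits. *)
have [k' [ik' gr']] := @growsP i.+1 (rt C1 y1 + rt C1 x0) isT.
have [C2 [N' [m' [sm' mk']]]] :=
  exists_marker cantorX minT lchi schi i.+1 (k' * 2 ^ k').+1 lC1 C10 lP'.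
pose dec' (kp : nat) := let: (p, fl, _) := decode (0, false, false) kp in
  let: (v, l, n) := decode ([::] : seq nat, [::] : seq nat, [::] : seq (seq bool)) p in (v, l, n, fl).
(* Class [0] marks first blocks; the others have class [1] or [2] according to [chi d], read at the
   start of the stored name. The last flag is dropped. *)
pose pt' kp : nat := let: (v, l, n, fl) := dec' kp in
  pickle (sort leq l, if fl then 0 else (nth false (nth [::] n 0) d).+1).
have dec'E p (b1 b2 : bool) : dec' (pickle (P' p, b1, b2)) = (vs p, ls p, nm p, b1).
  by rewrite /dec' decodeK /P' decodeK.
have nmE x : nth false (nth [::] (nm x) 0) d = chi d x.
  rewrite /nm (nth_map 0) ?size_iota // (nth_map 0) ?size_iota ?nth_iota // /nn; lia.
have pt'E p (b1 b2 : bool) : pt' (pickle (P' p, b1, b2)) =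
    pickle (sort leq (ls p), if b1 then 0 else (chi d p).+1).
  by rewrite /pt' dec'E nmE.
pose W x := pt' (label T C1 C2 P' x).
have WE x : W x = pickle (sort leq (ls x), if C2 x then 0 else (chi d x).+1) by exact: pt'E.
pose sW := [seq pickle (ms, c) | ms <- sm, c <- [:: 0; 1; 2]] : seq nat.
have WsW x : C1 x -> W x \in sW.
  move=> C1x; rewrite WE; apply/allpairsP.
  exists (sort leq (ls x), if C2 x then 0 else (chi d x).+1); split => //=.
    exact: (marker_sm mk).
  by case: (C2 x); case: (chi d x).
have sWm : size sW <= 2 ^ m by rewrite size_allpairs mulnC; exact: marker_size mk.
have WP x y : C1 x -> C1 y -> W x = W y -> perm_eq (ls x) (ls y).
  by move=> _ _; rewrite !WE => /(pcan_inj pickleK)[/perm_sort_leP].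
have Pab : P ya <> P yb by move=> e; apply: ptab; rewrite e.
have patB : size (all_patterns k) <= (k * 2 ^ k).+1 by rewrite size_all_patterns.
have [sg [code [scode codeI Hsg]]] :=
  exists_rearrangement lC C0 B0 mk Cya Cyb Pab patB WsW sWm WP.
pose pix' kp := let: (v, l, n, fl) := dec' kp in
  flatten [seq [seq nth 0 v j + t | t <- spix s (nth 0 l j)] | j <- reorder l (sg (pt' kp))].
have pix'E p (b1 b2 : bool) : pix' (pickle (P' p, b1, b2)) =
    flatten [seq [seq nth 0 (vs p) j + t | t <- spix s (nth 0 (ls p) j)]
      | j <- reorder (ls p) (sg (pt' (pickle (P' p, b1, b2))))].
  by rewrite /pix' dec'E.
pose s' := State C1 C2 P' pt' pix'.
pose od x := [seq nth 0 (vs x) j | j <- reorder (ls x) (sg (W x))].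
have sls x : size (ls x) = size (vs x) by rewrite size_map.
have reo x : C1 x -> _ := fun C1x => reorderP (Hsg x C1x).1.
have nthl x j : C1 x -> j \in reorder (ls x) (sg (W x)) ->
    nth 0 (ls x) j = kap s (iter (nth 0 (vs x) j) T x).
  move=> C1x; rewrite (perm_mem (reo x C1x).1) mem_iota /= add0n sls => jv.
  by rewrite (nth_map 0).
have od_perm x : C1 x -> perm_eq (od x) (vs x).
  move=> C1x; have /(perm_map (nth 0 (vs x))) := (reo x C1x).1.
  by rewrite sls map_nth_iota0 // take_size.
have od_lab x : C1 x -> [seq kap s (iter t T x) | t <- od x] = sg (W x).
  move=> C1x; rewrite [RHS](reo x C1x).2 /od -map_comp; apply/eq_in_map => j jI /=.
  by rewrite -nthl.
have ix'E x : C1 x -> ix s' x = flatten [seq [seq t + j | j <- ix s (iter t T x)] | t <- od x].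
  move=> C1x; have -> : ix s' x = _ := pix'E x (C2 x) (C2 (iter (rt C1 x) T x)).
  rewrite -/(label T C1 C2 P' x) -/(W x) /od -map_comp.
  by congr flatten; apply/eq_in_map => j jI /=; rewrite (nthl x j C1x jI).
have tauE x : tau s' x = W x by [].
have odv x t : C1 x -> t \in od x -> t \in vs x by move=> C1x; rewrite (perm_mem (od_perm x C1x)).
have ix_size x : C x -> size (ix s x) = rt C x.
  by move=> Cx; rewrite (perm_size (perm x Cx)) size_iota.
have inner_size y : C y -> size (spix s (inner_label (P y))) = rt C y.
  move=> Cy; have [t tv e] := marker_visit B0 mk C10 Cy.
  rewrite -e -/(kap s (iter t T x0)) -/(ix s _).
  have [_ Ct] : t < rt C1 x0 /\ C (iter t T x0) by apply/andP; rewrite -mem_visits.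
  rewrite ix_size //; apply: rtP => //.
  by move/(pcan_inj pickleK) : e => [].
exists s', sg, od, N, sW, k, (inner_label (P ya)), (inner_label (P yb)); split.
  split => //.
  (* After the first entry, the next [m.*2] vertices spell the code of [W]; the two vertices used
     differ by [ptab], so the code and then [W] are recovered. *)
  - move=> x y C1x C1y; rewrite !tauE.
    have [_ [rx ->]] := Hsg x C1x; have [_ [ry ->]] := Hsg y C1y.
    rewrite /= !map_cat !map_pair_word !pair_word_cat => -[].
    move=> /(congr1 (take m.*2)); rewrite -!catA !take_size_cat ?size_pair_word ?scode //.
    move=> e; apply: codeI; rewrite ?WsW //; apply: pair_word_inj e; exact/eqP.
  - exact/eqP.
  - by rewrite !inner_size.
  - move=> x bits C1x sbits; have [_ [rx ->]] := Hsg x C1x.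
    have [u [v ->]] := all_patternsP sbits.
    exists (first_label P :: pair_word (inner_label (P ya)) (inner_label (P yb)) (code (W x) ++ u)).
    exists (pair_word (inner_label (P ya)) (inner_label (P yb)) v ++ rcons rx (last_label C P)).
    by rewrite !pair_word_cat /= -!catA.
  - by split; [exact: marker_gt0 mk|exact: marker_e mk].
  - exact: marker_rt mk.
  - apply: (@leq_trans ((2 ^ m) ^ i.+1)); first by rewrite leq_exp2r.
    by rewrite -expnM leq_exp2l //; exact: marker_m mk.
  - move=> x y /= C1x Cy.
    (* Towers over [C1] all have the first label, shared by the block at time [0]. Any other vertex
       is already that of an inner block, since [spt] ignores the last flag. *)
    have [C1y|nC1y] := boolP (C1 y).
      exists 0; first by rewrite mem_visits; exact: C1C.
      by rewrite /tau /kap [iter _ _ _]/=; congr (spt s _); rewrite (start_label C0 B0 mk C1x) (start_label C0 B0 mk C1y).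
    have [t tv e] := marker_visit B0 mk C1x Cy; exists t => //.
    rewrite /tau /kap e.
    by rewrite /label /inner_label -/C -/C1 -/P (negbTE nC1y) top.
have odE x : C1 x -> exists v, od x = 0 :: v.
  move=> C1x; have := od_lab x C1x; have [_ [rx ->]] := Hsg x C1x.
  case e : (od x) => [|t v] //= [h _]; exists v; congr cons.
  apply: (first_visit C1x _ h); apply: odv => //; by rewrite e mem_head.
have odE' x : C1 x -> exists v t, od x = rcons v t /\ t + rt C (iter t T x) = rt C1 x /\ C (iter t T x).
  move=> C1x; have := od_lab x C1x; have [_ [rx ->]] := Hsg x C1x.
  case/lastP e : (od x) => [|v t] //; rewrite map_rcons -rcons_cat -rcons_cons.
  move=> /rcons_inj[_ h]; exists v, t; split => //.
  have tv : t \in vs x by apply: odv => //; rewrite e mem_rcons mem_head.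
  split; first exact: (last_visit mk C1x tv h).
  by move: tv; rewrite mem_visits => /andP[].
have perm_fl (f g : nat -> seq nat) (l : seq nat) : (forall t, t \in l -> perm_eq (f t) (g t)) ->
    perm_eq (flatten (map f l)) (flatten (map g l)).
  elim: l => //= t l IH h; apply: perm_cat; first by rewrite h ?mem_head.
  by apply: IH => u ul; rewrite h // inE ul orbT.
have rtP' x y : P' x = P' y -> rt C1 x = rt C1 y.
  move=> /(pcan_inj pickleK)/(congr1 (fun u => size u.2)).
  by rewrite /nm !size_map !size_iota.
have sCE : sC s' = C1 by [].
have sC1E : sC1 s' = C2 by [].
have sPE : sP s' = P' by [].
have sptE : spt s' = pt' by [].
clearbody s'.
split; rewrite ?sCE ?sC1E ?sPE ?sptE.
- exact: lC1.
- exact: C10.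
- exact: lP'.
- move=> x C1x; rewrite ix'E //.
  apply: (@perm_trans _ (flatten [seq [seq t + j | j <- ix s (iter t T x)] | t <- vs x])).
    by apply: perm_flatten; apply: perm_map; exact: od_perm.
  apply: (@perm_trans _ (flatten [seq iota t (rt C (iter t T x)) | t <- vs x])).
    apply: perm_fl => t; rewrite mem_visits => /andP[_ Ct].
    by rewrite -[t in iota t]addn0 iotaDl; apply: perm_map; exact: perm.
  rewrite /vs /visits flatten_visits //; first exact: C1C.
  by apply: C1C; exact: return_timeP.
- move=> x C1x; rewrite ix'E //; have [v ->] := odE x C1x.
  by have [u e] := head x (C1C x C1x); rewrite /= e /=; eexists.
- move=> x C1x; rewrite ix'E //; have [v [t [-> [<- Ct]]]] := odE' x C1x.
  rewrite map_rcons flatten_rcons last_cat.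
  have [u e] := head _ Ct; have := last_ _ Ct; rewrite e.
  by rewrite map_cons /= last_map => ->; rewrite addnS.
- by move=> x y _ _ /rtP'.
- move=> x y n j _ _ e ni jr.
  move: (e) => /(pcan_inj pickleK)/(congr1 (fun u => nth false (nth [::] u.2 j) n)).
  rewrite [(_, _).2]/= [(_, _).2]/=.
  rewrite /nm (nth_map 0) ?size_iota // (nth_map 0) ?size_iota; last by rewrite /nn; lia.
  rewrite (nth_map 0) ?size_iota -?(rtP' _ _ e) // (nth_map 0) ?size_iota; last by rewrite /nn; lia.
  by rewrite !nth_iota // /nn; lia.
- move=> x y _ _; rewrite !tauE !WE => /(pcan_inj pickleK)[_].
  by move=> + C2x; rewrite C2x; case: (C2 y).
- by move=> v b t; rewrite /pt' /dec' !decodeK.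
exists N', m', sm', k', y1, x0; split => //.
rewrite !pt'E => /(pcan_inj pickleK)[_ e].
by apply: Hd; move: e; case: (chi d y1); case: (chi d x0).
Qed.

Lemma return_time_full x : rt xpredT x = 1.
Proof. by apply: return_time_eq => // m; case: m. Qed.

(** Towers are single points, and the three classes of vertices become the alphabet of the subshift.
    The cap [minn p 1] keeps [pt] below [3] on every code. *)
Lemma initial_state : exists s, [/\ admissible 0 s, sC s = xpredT & forall x, tau s x < 3].
Proof.
have lC : lc (xpredT : X -> bool) by exact: lc_cst.
have [d Hd] : exists d, chi d (T x0) <> chi d x0.
  apply/existsNP => h; apply: (@minimal_aperiodic _ cantorX T 0 x0) => //.
  exact: schi.
pose P x : nat := chi d x.
have lP : lc P by apply: lc_comp.
have [k [ik gr]] := @growsP 0 (1 + 1) isT.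
have [C1 [N [m [sm mk]]]] := exists_marker cantorX minT lchi schi 0 (k * 2 ^ k).+1 lC (isT : xpredT x0) lP.
pose pt kp : nat := let: (p, fl, _) := decode (0, false, false) kp in if fl then 0 else (minn p 1).+1.
have ptE (v : nat) (b t : bool) : pt (pickle (v, b, t)) = if b then 0 else (minn v 1).+1.
  by rewrite /pt decodeK.
pose s := State xpredT C1 P pt (fun=> [:: 0]).
have rtE x : rt (sC s) x = 1 := return_time_full x.
exists s; split => //; last first.
  move=> x; rewrite /tau /= ptE; case: ifP => // _; rewrite ltnS.
  by rewrite ltnS geq_minr.
split => //.
- by move=> x _; rewrite rtE.
- by move=> x _; exists [::].
- by move=> x _; rewrite rtE.
- move=> x y _ _; rewrite /tau /= !ptE => e C1x; move: e; rewrite (C1x : sC1 s x) -[sC1 s y]/(C1 y).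
  by case: ifP.
- by move=> v b t; rewrite -[spt s]/pt !ptE.
exists N, m, sm, k, (T x0), x0; split => //.
  by rewrite -[spt s]/pt !ptE => -[]; apply: contra_not Hd; rewrite /P; case: (chi d (T x0)); case: (chi d x0).
by rewrite !rtE.
Qed.

Lemma state_sequence : exists st : nat -> state X,
  [/\ forall i, admissible i (st i), sC (st 0) = xpredT, forall x, tau (st 0) x < 3 &
   exists sg od N sW k a b, forall i,
     refinement i (st i) (st i.+1) (sg i) (od i) (N i) (sW i) (k i) (a i) (b i)].
Proof.
have [s0 [inv0 C0 tau0]] := initial_state.
pose tp := {p : nat * state X | admissible p.1 p.2}.
pose gd i s s' (q : (nat -> seq nat) * (X -> seq nat) * nat * seq nat * nat * nat * nat) :=
  let: (sg, od, N, sW, k, a, b) := q in refinement i s s' sg od N sW k a b.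
pose R (p q : tp) := (sval q).1 = (sval p).1.+1 /\
  exists u, gd (sval p).1 (sval p).2 (sval q).2 u.
have Rex (p : tp) : {q | R p q}.
  apply: cid; case: p => -[i s] ip.
  have [s' [sg [od [N [sW [k [a [b [g i']]]]]]]]] := step ip.
  exists (exist _ (i.+1, s') i'); split => //=.
  by exists (sg, od, N, sW, k, a, b).
have [f [f0 Rf]] := dependent_choice Rex (exist _ (0, s0) inv0).
have fi i : (sval (f i)).1 = i.
  by elim: i => [|i IH]; [rewrite f0|rewrite (Rf i).1 IH].
have /choice[u Hu] i := (Rf i).2.
exists (fun i => (sval (f i)).2); rewrite f0; split => //.
  by move=> i; rewrite -{1}(fi i); exact: (svalP (f i)).
exists (fun i => (u i).1.1.1.1.1.1), (fun i => (u i).1.1.1.1.1.2), (fun i => (u i).1.1.1.1.2),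
  (fun i => (u i).1.1.1.2), (fun i => (u i).1.1.2), (fun i => (u i).1.2), (fun i => (u i).2).
by move=> i; have := Hu i; rewrite fi /gd; case: (u i) => [[[[[[? ?] ?] ?] ?] ?] ?].
Qed.

End Step.

(** * The reordered system and its Bratteli diagram *)

Section Adjacent.
Variable S : eqType.
Implicit Types (s u v : seq S).

Lemma uniq_cat_inj u v u' v' (y : S) : uniq (u ++ y :: v) ->
  u ++ y :: v = u' ++ y :: v' -> u = u' /\ v = v'.
Proof.
elim: u u' => [|x u IH] [|x' u'] //=.
- by move=> _ [->].
- by move=> /andP[yv _] [e1 e2]; move: yv; rewrite e2 mem_cat mem_head orbT.
- by move=> /andP[xu _] [e1 e2]; move: xu; rewrite e1 mem_cat mem_head orbT.
- by move=> /andP[_ un] [-> e]; have [-> ->] := IH u' un e.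
Qed.

Lemma flatten_adjacent (ss : seq (seq S)) u y z v : flatten ss = u ++ y :: z :: v ->
  (exists2 s, s \in ss & exists u' v', s = u' ++ y :: z :: v') \/
  (exists2 s, s \in ss & exists v', s = z :: v').
Proof.
have hd tt z' w : flatten tt = z' :: w -> exists2 s, s \in tt & exists v', s = z' :: v'.
  elim: tt w => //= -[|t s] tt IH w /=.
    by move=> /IH[s ss' e]; exists s; rewrite // inE ss' orbT.
  by move=> [<- _]; exists (t :: s); [exact: mem_head|exists s].
elim: ss u => [|s ss IH] u /=; first by case: u.
suff : s ++ flatten ss = u ++ y :: z :: v ->
    (exists u' v', s = u' ++ y :: z :: v') \/ (exists v', flatten ss = z :: v') \/
    exists u', flatten ss = u' ++ y :: z :: v.
  move=> h /h[h'|[[v' /hd[t tin h']]|[u' /IH[[t tin h']|[t tin h']]]]].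
  - by left; exists s; rewrite ?mem_head.
  - by right; exists t; rewrite // inE tin orbT.
  - by left; exists t; rewrite // inE tin orbT.
  - by right; exists t; rewrite // inE tin orbT.
elim: s u => [|x s IHs] u /=; first by move=> e; right; right; exists u.
case: u => [|x' u] /= [->].
  case: s IHs => [|z' s] IHs /= e; first by right; left; exists v.
  by move: e => [-> _]; left; exists [::], s.
by move=> /IHs[[u' [v' ->]]|h]; [left; exists (x' :: u'), v'|right].
Qed.

End Adjacent.

Lemma map_adjacent (I : Type) (S : eqType) (f : I -> S) l u y z v : map f l = u ++ y :: z :: v ->
  exists u' j k v', [/\ l = u' ++ j :: k :: v', f j = y & f k = z].
Proof.
elim: u l => [|x u IH] [|j l] //=.
  by case: l => //= k v' [<- <- _]; exists [::], j, k, v'.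
by move=> [_ /IH[u' [j' [k [v' [-> ? ?]]]]]]; exists (j :: u'), j', k, v'.
Qed.

Lemma traject_filter_map (X W : Type) (g : X -> X) (p : X -> bool) (f : X -> W) (x y : X) n :
  (forall m, p (iter m g x) = p (iter m g y)) ->
  (forall m, p (iter m g x) -> f (iter m g x) = f (iter m g y)) ->
  [seq f z | z <- traject g x n & p z] = [seq f z | z <- traject g y n & p z].
Proof.
elim: n x y => //= n IH x y pxy fxy.
have e : [seq f z | z <- traject g (g x) n & p z] = [seq f z | z <- traject g (g y) n & p z].
  by apply: IH => m; rewrite -!iterSr //; exact: fxy.
have := fxy 0; rewrite -(pxy 0) /=; case: (p x) => //= ->; by rewrite ?e.
Qed.

Lemma hit_ext (X : Type) (f : X -> X) (V V' : X -> bool) x y :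
  (exists n, V (iter n f x)) ->
  (forall n, V (iter n f x) = V' (iter n f y)) -> hit f V x = hit f V' y.
Proof.
move=> [n Vn] e; apply/esym/hit_eq; first by rewrite -e; have [] := hitP Vn.
by move=> m mh; rewrite -e; exact: hit_min mh.
Qed.

Lemma separated_cat (Q : pred nat) t t' r r' :
  all (predC Q) t -> all (predC Q) t' -> all Q (take 1 r) -> all Q (take 1 r') ->
  t ++ r = t' ++ r' -> t = t' /\ r = r'.
Proof.
elim: t t' => [|x t IH] [|x' t'] //=.
- by move=> _ /andP[nx _] rQ _ e; move: rQ; rewrite e /= (negbTE nx).
- by move=> /andP[nx _] _ _ rQ e; move: rQ; rewrite -e /= (negbTE nx).
- move=> /andP[_ at_] /andP[_ at'] rQ rQ' [-> e].
  by have [-> ->] := IH t' at_ at' rQ rQ' e.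
Qed.

(** [Q] holds exactly at the heads of the pieces, so a concatenation can be cut back into its pieces
    without knowing their lengths. *)
Lemma flatten_map_inj (L : seq nat) (F : nat -> seq nat) (Q : pred nat) :
  (forall v, v \in L -> exists h t, [/\ F v = h :: t, Q h & all (predC Q) t]) ->
  {in L &, injective F} ->
  forall u u', {subset u <= L} -> {subset u' <= L} ->
    flatten (map F u) = flatten (map F u') -> u = u'.
Proof.
move=> FQ FI; have hd w : {subset w <= L} -> all Q (take 1 (flatten (map F w))).
  case: w => //= v w wL; have [h [t [-> Qh _]]] := FQ v (wL _ (mem_head _ _)).
  by rewrite /= take0 /= Qh.
elim=> [|v u IH] [|v' u'] //= uL u'L.
- by have [h [t [-> _ _]]] := FQ v' (u'L _ (mem_head _ _)).
- by have [h [t [-> _ _]]] := FQ v (uL _ (mem_head _ _)).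
have vL := uL _ (mem_head _ _); have v'L := u'L _ (mem_head _ _).
have uL' : {subset u <= L} by move=> z zu; apply: uL; rewrite inE zu orbT.
have u'L' : {subset u' <= L} by move=> z zu; apply: u'L; rewrite inE zu orbT.
have [h [t [e _ nt]]] := FQ v vL; have [h' [t' [e' _ nt']]] := FQ v' v'L.
rewrite e e' /= => -[eh]; move=> /(separated_cat nt nt' (hd _ uL') (hd _ u'L'))[et er].
by rewrite (IH u') // (FI v v') // e e' eh et.
Qed.

Lemma traject_iota (X : Type) (g : X -> X) s x n :
  traject g (iter s g x) n = [seq iter t g x | t <- iota s n].
Proof. by elim: n s => //= n IH s; rewrite -(IH s.+1). Qed.

Section Tower.
Variables (X : topologicalType) (T : homeo X X).
Hypotheses (cantorX : is_cantor X) (minT : minimal T).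
Variables (chi : nat -> X -> bool) (x0 : X).
Hypothesis schi : forall x y, (forall n, chi n x = chi n y) -> x = y.
Variable grows : nat -> nat -> nat -> Prop.
Variables (st : nat -> state X) (sg : nat -> nat -> seq nat) (od : nat -> X -> seq nat)
  (hN : nat -> nat) (sW : nat -> seq nat) (kk aa bb : nat -> nat).
Hypothesis Hinv : forall i, admissible T chi x0 grows i (st i).
Hypothesis HC0 : sC (st 0) = xpredT.
Hypothesis Htau0 : forall x, tau T (st 0) x < 3.
Hypothesis Hgood : forall i,
  refinement T grows i (st i) (st i.+1) (sg i) (od i) (hN i) (sW i) (kk i) (aa i) (bb i).

Local Notation lc := (@locally_constant X _).
Local Notation rt := (return_time T).
Local Notation C i := (sC (st i)).
Local Notation base i := (tower_base T (C i)).
Let cX : compact [set: X] := cantor_compact cantorX.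
Let hX : hausdorff_space X := cantor_hausdorff cantorX.
Let cT : continuous T := @hfun_continuous _ _ T.
Let cTi : continuous (hinv T) := @hinv_continuous _ _ T.

Definition tower i x : seq X := [seq iter j T x | j <- ix T (st i) x].
Definition blocks i x : seq X := [seq iter t T x | t <- od i x].

Let lC i : lc (C i) := inv_lC (Hinv i).
Let Cx0 i : C i x0 := inv_C0 (Hinv i).
Let Cex i : exists x, C i x. Proof. by exists x0. Qed.

Lemma sC1E i : sC1 (st i) = C i.+1.
Proof. by rewrite (good_C (Hgood i)). Qed.

Lemma base_decr i x : C i.+1 x -> C i x.
Proof. exact: (good_sub (Hgood i)). Qed.

Lemma base_le i j x : i <= j -> C j x -> C i x.
Proof. by move=> ij; rewrite -(subnK ij); elim: (j - i) => // n IH /base_decr. Qed.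

(** Points of all bases are first blocks at level [n.+1], so by [marker_start] they share the label
    [sP] of [x0] there, and with it the value of [chi n]. *)
Lemma base_cap x : (forall i, C i x) -> x = x0.
Proof.
move=> Cx; apply: schi => n.
have [N [m [sm [k [ya [yb [mk _ _ _ _]]]]]]] := inv_marker (Hinv n.+1).
have Px : sP (st n.+1) x = sP (st n.+1) x0.
  by apply: (marker_start mk); rewrite sC1E.
by have := @inv_names _ _ _ _ _ _ _ (Hinv n.+1) x x0 n 0 (Cx _) (Cx0 _) Px (leqnn _) isT.
Qed.

Lemma base_nbhs U : nbhs x0 U -> exists i, forall x, C i x -> U x.
Proof. apply: decreasing_basis => //; [exact: base_decr|exact: base_cap]. Qed.

Lemma lc_kap i : lc (kap T (st i)).
Proof.
apply: lc_label => //; last exact: inv_lP (Hinv i).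
by rewrite sC1E; exact: lC.
Qed.

Lemma lc_tau i : lc (tau T (st i)).
Proof. by apply: lc_comp; exact: lc_kap. Qed.

Lemma lc_ix i : lc (ix T (st i)).
Proof. by apply: lc_comp; exact: lc_kap. Qed.

Lemma mem_ix i x j : C i x -> (j \in ix T (st i) x) = (j < rt (C i) x).
Proof. by move=> Cx; rewrite (perm_mem (inv_perm (Hinv i) Cx)) mem_iota. Qed.

Lemma towerP i x y : C i x -> reflect (exists2 j, j < rt (C i) x & y = iter j T x) (y \in tower i x).
Proof.
move=> Cx; apply: (iffP mapP) => -[j ji ->]; exists j => //; by rewrite ?mem_ix // -?(mem_ix _ Cx).
Qed.

Lemma size_tower i x : C i x -> size (tower i x) = rt (C i) x.
Proof. by move=> Cx; rewrite size_map (perm_size (inv_perm (Hinv i) Cx)) size_iota. Qed.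

Lemma tower_uniq i x : C i x -> uniq (tower i x).
Proof.
move=> Cx; rewrite map_inj_in_uniq.
  by rewrite (perm_uniq (inv_perm (Hinv i) Cx)) iota_uniq.
move=> j k; rewrite !mem_ix // => jx kx e.
by have [] := depth_uniq Cx Cx jx kx e.
Qed.

Lemma tower_disj i x x' y : C i x -> C i x' -> y \in tower i x -> y \in tower i x' -> x = x'.
Proof.
move=> Cx Cx'; move=> /(towerP _ Cx)[j jx ->] /(towerP _ Cx')[k kx e].
by have [] := depth_uniq Cx Cx' jx kx e.
Qed.

Lemma tower_cover i y : C i (base i y) /\ y \in tower i (base i y).
Proof.
have Cb : C i (base i y) by apply: tower_baseP.
split => //; apply/(towerP _ Cb); exists (depth T (C i) y); last by rewrite depthK.
exact: depth_lt.
Qed.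

Lemma tower_cons i x : C i x -> exists u, tower i x = x :: u.
Proof.
by move=> Cx; have [u e] := inv_head (Hinv i) Cx; rewrite /tower e; eexists.
Qed.

Lemma base_tower i x : C i x -> x \in tower i x.
Proof. by move=> Cx; have [u ->] := tower_cons Cx; rewrite mem_head. Qed.

Lemma last_tower i x y u : C i x -> tower i x = rcons u y -> T y = iter (rt (C i) x) T x.
Proof.
move=> Cx e; have := inv_last (Hinv i) Cx; have [w ew] := inv_head (Hinv i) Cx.
move=> l; have : last x (tower i x) = iter (last 0 (ix T (st i) x)) T x.
  exact: (last_map (fun j => iter j T x) (ix T (st i) x) 0).

by rewrite e last_rcons l => ->; rewrite -iterS.
Qed.

Lemma towerS i x : C i.+1 x -> tower i.+1 x = flatten [seq tower i y | y <- blocks i x].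
Proof.
move=> Cx; rewrite /tower (good_ix (Hgood i) Cx) map_flatten -map_comp /blocks -map_comp.
congr flatten; apply/eq_map => t /=; rewrite -map_comp; apply/eq_map => j /=.
by rewrite addnC iterD.
Qed.

Lemma blocks_base i x y : C i.+1 x -> y \in blocks i x -> C i y.
Proof.
move=> Cx /mapP[t]; rewrite (perm_mem (good_od (Hgood i) Cx)) mem_visits.
by move=> /andP[_ Ct] ->.
Qed.

Lemma blocks_cover i x : C i x -> C i.+1 (base i.+1 x) /\ x \in blocks i (base i.+1 x).
Proof.
move=> Cx; have [Cb xb] := tower_cover i.+1 x; split => //.
move: xb; rewrite towerS // => /flattenP[s /mapP[y yb ->] xy].
by move: (yb); rewrite -(tower_disj Cx (blocks_base Cb yb) (base_tower Cx) xy).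
Qed.

Lemma blocks_kap i x : C i.+1 x -> map (kap T (st i)) (blocks i x) = sg i (tau T (st i.+1) x).
Proof. by move=> Cx; rewrite -(good_sg (Hgood i) Cx) /blocks -map_comp. Qed.

(** * The reordered homeomorphism *)

Definition next i y z := exists2 x, C i x & exists u v, tower i x = u ++ y :: z :: v.

Lemma nextS i y z : next i y z -> next i.+1 y z.
Proof.
move=> [x Cx [u [v e]]]; have [Cb xb] := blocks_cover Cx.
exists (base i.+1 x) => //; rewrite towerS //.
have [u' [v' ->]] := @flatten_infix _ [seq tower i y | y <- blocks i (base i.+1 x)] (tower i x) (map_f _ xb).
by rewrite e; exists (u' ++ u), (v ++ v'); rewrite -!catA.
Qed.

Lemma next_le i j y z : i <= j -> next i y z -> next j y z.
Proof. by move=> ij n; rewrite -(subnK ij); elim: (j - i) => // k IH; exact: nextS. Qed.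

Lemma next_fun i j y z z' : next i y z -> next j y z' -> z = z'.
Proof.
move=> /(next_le (leq_maxl i j)) + /(next_le (leq_maxr i j)).
set m := maxn i j => -[x Cx [u [v e]]] [x' Cx' [u' [v' e']]].
have xx : x = x'.
  by apply: (@tower_disj m x x' y) => //; rewrite ?e ?e' mem_cat mem_head orbT.
have := tower_uniq Cx; rewrite e => un; move: e; rewrite xx e' => e.
by have [_ []] := uniq_cat_inj un (esym e).
Qed.

Lemma next_inj i j y y' z : next i y z -> next j y' z -> y = y'.
Proof.
move=> /(next_le (leq_maxl i j)) + /(next_le (leq_maxr i j)).
set m := maxn i j => -[x Cx [u [v e]]] [x' Cx' [u' [v' e']]].
have xx : x = x'.
  by apply: (@tower_disj m x x' z) => //; rewrite ?e ?e' mem_cat !inE eqxx !orbT.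
have := tower_uniq Cx; rewrite e -cat_rcons => un; move: e; rewrite xx e' => e.
rewrite -(cat_rcons y u) -(cat_rcons y' u') in e.
by have [/rcons_inj[_ ->]] := uniq_cat_inj un (esym e).
Qed.

Lemma next_ex i y : ~~ C i (T y) -> exists z, next i y z.
Proof.
move=> nC; have [Cb] := tower_cover i y; case/splitPr e : _ / => [u v].
case: v e => [|z v] e; last by exists z, (base i y) => //; exists u, v.
by move: nC; rewrite (last_tower Cb (y := y) (u := u)) ?e ?cats1 // return_timeP.
Qed.

Lemma prev_ex i z : ~~ C i z -> exists y, next i y z.
Proof.
move=> nC; have [Cb] := tower_cover i z; case/splitPr e : _ / => [u v].
case/lastP: u e => [|u y] e.
  have [w e'] := tower_cons Cb; move: nC; move: e; rewrite e' => -[<- _].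
  by rewrite Cb.
by exists y, (base i z) => //; exists u, v; rewrite e cat_rcons.
Qed.

Lemma next_notC i y z : next i y z -> ~~ C i z.
Proof.
move=> [x Cx [u [v e]]]; apply/negP => Cz.
have xz : x = z.
  by apply: (tower_disj Cx Cz _ (base_tower Cz)); rewrite e mem_cat !inE eqxx !orbT.
have [w e'] := tower_cons Cx; have := tower_uniq Cx.
rewrite e in e' *; move: e'; rewrite -xz; case: u {e} => [|x' u] /= [-> _].
  by rewrite mem_head.
by rewrite mem_cat !inE eqxx !orbT.
Qed.

(** A point that [T] sends into the base is the top of its tower in the old order; by [inv_last] it
    stays last in the new one and has no successor there. *)
Lemma next_notT i y z : next i y z -> ~~ C i (T y).
Proof.
move=> [x Cx [u [v e]]]; apply/negP => CT.
have /(towerP _ Cx)[j jx yj] : y \in tower i x by rewrite e mem_cat mem_head orbT.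
have jr : rt (C i) x = j.+1.
  by apply/eqP; rewrite eqn_leq jx andbT; apply: return_time_le => //; rewrite iterS -yj.
have [w ew] : exists w, tower i x = rcons w y.
  have : last x (tower i x) = y.
    have [w e'] := tower_cons Cx; rewrite e' /= yj.
    have := inv_last (Hinv i) Cx; rewrite jr /= => <-.
    by rewrite -[last x w]/(last x (x :: w)) -e'; exact: (last_map (fun j => iter j T x) (ix T (st i) x) 0).
  by case/lastP: (tower i x) (tower_cons Cx) => [[]//|w y' _]; rewrite last_rcons => ->; exists w.
have := tower_uniq Cx; rewrite e => un; move: ew; rewrite e -cats1 => ew.
by have [] := uniq_cat_inj un ew.
Qed.

(** Successors at different levels agree by [next_fun]. The default [T y] is reached only when [y]
    is on top at every level, and is then [x0]. *)
Definition step_map y : X := xget (T y) [set z | exists i, next i y z].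
Local Notation Tn := step_map.

Lemma step_next i y z : next i y z -> Tn y = z.
Proof.
move=> n; apply: xget_unique; first by exists i.
by move=> z' [j n']; exact: next_fun n' n.
Qed.

Lemma step_x0 y : (forall i, C i (T y)) -> Tn y = x0.
Proof.
move=> CT; rewrite -(base_cap CT) /step_map; case: xgetP => // z _ [i /next_notT].
by rewrite CT.
Qed.

(** A successor found at a level [j >= i] is followed down: in a concatenation of towers, either the
    two points stay adjacent inside one block, or the second one starts a block and so lies in the
    lower base. *)
Lemma step_cases i y : next i y (Tn y) \/ (C i (T y) /\ C i (Tn y)).
Proof.
have [CT|nC] := boolP (C i (T y)); last first.
  by have [z n] := next_ex nC; left; rewrite (step_next n).
right; split => //.
have [CTa|/existsNP[j nCj]] := pselect (forall j, C j (T y)); first by rewrite step_x0.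
have nj : ~~ C j (T y) by apply/negP.
have ij : i <= j by rewrite leqNgt; apply/negP => ji; apply: nCj; exact: base_le (ltnW ji) CT.
have [z n] := next_ex nj; rewrite (step_next n).
have down m : m <= j - i -> next (j - m) y z \/ C (j - m) z.
  elim: m => [|m IH] mj; first by rewrite subn0; left.
  have eS : j - m = (j - m.+1).+1 by lia.
  have := IH (ltnW mj); rewrite eS => -[[x Cx [u [v e]]]|Cz]; last by right; exact: base_decr.
  have := e; rewrite towerS // => /flatten_adjacent[] [s /mapP[x' x'b ->]].
    by move=> h; left; exists x' => //; exact: blocks_base x'b.
  move=> [v' e']; right.
  have Cx' := blocks_base Cx x'b; have [w e2] := tower_cons Cx'.
  by move: e'; rewrite e2 => -[<- _].
have := down (j - i) (leqnn _); rewrite subKn // => -[/next_notT|//].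
by rewrite CT.
Qed.

Lemma step_alt y : (exists i, next i y (Tn y)) \/ (T y = x0 /\ Tn y = x0).
Proof.
have [CT|/existsNP[i /negP nC]] := pselect (forall i, C i (T y)).
  by right; split; [exact: base_cap|exact: step_x0].
by left; exists i; have [z n] := next_ex nC; rewrite (step_next n).
Qed.

Lemma step_inj : injective Tn.
Proof.
move=> y y'; have [[i n]|[Ty e]] := step_alt y; have [[j n']|[Ty' e']] := step_alt y' => ee.
- by move: n'; rewrite -ee; exact: (next_inj n).
- by have := next_notC n; rewrite ee e' Cx0.
- by have := next_notC n'; rewrite -ee e Cx0.
- by apply: (can_inj (hfunK T)); rewrite Ty Ty'.
Qed.

Lemma step_surj z : exists y, Tn y = z.
Proof.
have [Cz|/existsNP[i /negP nC]] := pselect (forall i, C i z).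
  by exists (hinv T z); rewrite step_x0 ?hinvK ?(base_cap Cz).
by have [y n] := prev_ex nC; exists y; exact: step_next n.
Qed.

Lemma near_tower i y : let j := depth T (C i) y in
  \forall y' \near y, C i (iter j (hinv T) y') /\
    ix T (st i) (iter j (hinv T) y') = ix T (st i) (base i y).
Proof.
move=> j; have c : continuous (iter j (hinv T)) by exact: continuous_iter.
have h1 : \forall y' \near y, C i (iter j (hinv T) y') = C i (iter j (hinv T) y).
  exact: (c y _ (lC i _)).
have h2 : \forall y' \near y, ix T (st i) (iter j (hinv T) y') = ix T (st i) (iter j (hinv T) y).
  exact: (c y _ (lc_ix i _)).
apply: filterS2 h1 h2 => y' -> ->; split => //.
by have [] := tower_cover i y.
Qed.

(** Points near [y] sit at the same depth in towers with the same order, so the displacement is the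
    difference of the two consecutive entries [j] and [k] of that order. *)
Lemma step_local y : ~ (forall i, C i (T y)) ->
  exists n : int, \forall y' \near y, Tn y' = zpow T n y'.
Proof.
move=> /existsNP[i /negP nC]; have [z [x Cx]] := next_ex nC.
set j := depth T (C i) y; have [Cb yb] := tower_cover i y => -[u [v e]].
have xb : x = base i y by apply: (tower_disj Cx Cb _ yb); rewrite e mem_cat mem_head orbT.
rewrite {}xb in e {Cx}.
have [u' [j' [k [v' [ei ej ek]]]]] := map_adjacent e.
have jj : j' = j.
  have j'r : j' < rt (C i) (base i y) by rewrite -mem_ix // ei mem_cat mem_head orbT.
  have jr : j < rt (C i) (base i y) by exact: depth_lt.
  by have [] := depth_uniq Cb Cb j'r jr (etrans ej (esym (depthK _ _ _))).
exists (k%:Z - j%:Z)%R; apply: filterS (near_tower i y) => y' [Cy' iy'].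
apply: (@step_next i); exists (iter j (hinv T) y') => //.
rewrite /tower iy' ei jj map_cat /= iter_hfunK zpowD zpowN.
by eexists; eexists.
Qed.

Lemma zpow_continuous (U : homeo X X) n : continuous (zpow U n).
Proof.
by case: n => n; apply: continuous_iter; [exact: hfun_continuous|exact: hinv_continuous].
Qed.

(** Only the preimage of [x0] lacks a local formula. There, [T y'] in [C i] forces the new image of
    [y'] into [C i], and these bases shrink to [x0]. *)
Lemma step_continuous : continuous Tn.
Proof.
move=> y; have [CT|nCT] := pselect (forall i, C i (T y)).
  move=> U; rewrite step_x0 // => /base_nbhs[i CU].
  have h : \forall y' \near y, C i (T y') = C i (T y) by exact: (@cT y _ (lC i _)).
  apply: filterS h => y'; rewrite CT => CTy'.
  apply: CU; have [/next_notT|[]//] := step_cases i y'.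
  by rewrite CTy'.
have [n near_n] := step_local nCT => U.
rewrite (nbhs_singleton near_n) => /zpow_continuous nU.
by apply: filterS2 near_n nU => y' /= ->.
Qed.

Definition step_inv z : X := xget z [set y | Tn y = z].

Lemma step_invK : cancel step_inv Tn.
Proof.
by move=> z; have [y e] := step_surj z; exact: (@xgetI _ z [set y | Tn y = z] y e).
Qed.

Lemma stepK : cancel Tn step_inv.
Proof. by move=> y; apply: step_inj; rewrite step_invK. Qed.

Definition step_homeo : homeo X X :=
  Homeo stepK step_invK step_continuous
    (compact_homeo cX hX step_continuous stepK step_invK).

Local Notation S := step_homeo.

Lemma tower_traject i x : C i x -> tower i x = traject S x (rt (C i) x).
Proof.
move=> Cx; rewrite -(size_tower Cx).
have H v u y : tower i x = u ++ y :: v -> y :: v = traject S y (size v).+1.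
  elim: v u y => //= z v IH u y e; congr cons.
  have -> : Tn y = z by apply: (@step_next i); exists x => //; exists u, v.
  by apply: (IH (rcons u y)); rewrite cat_rcons.
by have [u e] := tower_cons Cx; rewrite e; exact: (H u [::] x).
Qed.

Lemma iter_step_mem i x m : C i x -> m < rt (C i) x -> iter m S x \in tower i x.
Proof.
by move=> Cx mr; rewrite tower_traject // -(nth_traject _ mr) mem_nth ?size_traject.
Qed.

Lemma iter_step_notin i x m : C i x -> 0 < m < rt (C i) x -> ~~ C i (iter m S x).
Proof.
move=> Cx /andP[m0 mr]; apply/negP => Cm.
have e := tower_disj Cm Cx (base_tower Cm) (iter_step_mem Cx mr).
have := tower_uniq Cx; rewrite tower_traject // => un.
have := nth_uniq x _ _ un; rewrite size_traject => /(_ m 0 mr (leq_ltn_trans (leq0n m) mr)).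
by rewrite !nth_traject ?(leq_ltn_trans _ mr) // e /= eqxx (gtn_eqF m0).
Qed.

Lemma iter_step_base i x : C i x -> C i (iter (rt (C i) x) S x).
Proof.
move=> Cx; rewrite /return_time iterS; set y := iter _ _ _.
have ty : tower i x = rcons (traject S x (hit T (C i) (T x))) y.
  by rewrite tower_traject // -trajectSr.
have [/next_notT|[]//] := step_cases i y.
by rewrite (last_tower Cx ty) return_timeP.
Qed.

Lemma step_return_time i x : C i x -> return_time S (C i) x = rt (C i) x.
Proof.
move=> Cx; apply: return_time_eq => //; first exact: iter_step_base.
by move=> m; exact: iter_step_notin.
Qed.

Lemma step_tower i y : exists2 b, C i b & exists2 m, m < rt (C i) b & y = iter m S b.
Proof.
have [Cb yb] := tower_cover i y; exists (base i y) => //; move: yb.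
rewrite tower_traject // => /trajectP[m mr e]; by exists m.
Qed.

(** The converse of [step_local]: the exponent is the difference of the places of the times [j.+1]
    and [j] in the new order. *)
Lemma homeo_local y : ~ (forall i, C i (T y)) ->
  exists n : int, \forall y' \near y, T y' = zpow S n y'.
Proof.
move=> /existsNP[i /negP nC].
set j := depth T (C i) y; have [Cb yb] := tower_cover i y.
have jr : j < rt (C i) (base i y) by exact: depth_lt.
have jr1 : j.+1 < rt (C i) (base i y).
  rewrite ltn_neqAle jr andbT; apply/eqP => e.
  have : C i (iter (rt (C i) (base i y)) T (base i y)) by exact: return_timeP.
  by rewrite -e iterS depthK (negbTE nC).
pose l := ix T (st i) (base i y).
exists ((index j.+1 l)%:Z - (index j l)%:Z)%R.
apply: filterS (near_tower i y) => y'; rewrite -/j; set x' := iter j (hinv T) y' => -[Cx' ix'].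
have pos k : k < rt (C i) (base i y) -> iter k T x' = iter (index k l) S x'.
  move=> kr; have kl : k \in l by rewrite mem_ix.
  have ks : index k l < rt (C i) x'.
    by rewrite -size_tower // size_map ix' index_mem.
  have := nth_traject S ks x'; rewrite -tower_traject // => <-.
  by rewrite (nth_map 0) ?ix' ?index_mem // nth_index.
have -> : T y' = iter j.+1 T x' by rewrite iterS iter_hfunK.
rewrite pos // zpowD.
have -> : y' = iter (index j l) S x' by rewrite -pos // iter_hfunK.
by rewrite zpowN iter_hinvK.
Qed.

(** * Common orbits and continuity of the cocycles *)

Lemma hinv_x0 y : (forall i, C i (T y)) -> y = hinv T x0.
Proof. by move=> /base_cap <-; rewrite hfunK. Qed.

Lemma step_zpow y : exists n : int, S y = zpow T n y.
Proof.
have [CT|/step_local[n /nbhs_singleton ?]] := pselect (forall i, C i (T y)).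
  by exists 1%R; rewrite /= step_x0 // (base_cap CT).
by exists n.
Qed.

Lemma homeo_zpow y : exists n : int, T y = zpow S n y.
Proof.
have [CT|/homeo_local[n /nbhs_singleton ?]] := pselect (forall i, C i (T y)).
  by exists 1%R; rewrite /= step_x0 // (base_cap CT).
by exists n.
Qed.

Lemma step_orbit y : zorbit S y = zorbit T y.
Proof.
have H (A B : homeo X X) : (forall y, exists n : int, A y = zpow B n y) ->
    zorbit A y `<=` zorbit B y.
  move=> AB _ [n _ <-]; elim/int_rect: n => [|n [m _ e]|n [m _ e]]; first by exists 0%R.
    by have [k ek] := AB (zpow B m y); exists (k + m)%R => //; rewrite zpowD -ek e.
  have [k ek] := AB (zpow A (- n.+1%:Z)%R y); exists (- k + m)%R => //.
  rewrite zpowD e.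
  have -> : zpow A (- n%:Z)%R y = zpow B k (zpow A (- n.+1%:Z)%R y).
    by rewrite -ek -zpowS; congr zpow; lia.
  by rewrite -zpowD addNr.
by apply/seteqP; split; apply: H; [exact: step_zpow|exact: homeo_zpow].
Qed.

Lemma step_minimal : minimal S.
Proof. by move=> y; rewrite step_orbit. Qed.

Let aperT k y : iter k.+1 T y <> y := minimal_aperiodic cantorX minT (n := k) (x := y).
Let aperS k y : iter k.+1 S y <> y.
Proof. exact: (minimal_aperiodic cantorX step_minimal). Qed.

Lemma step_cocycle : exists n : X -> int, (forall y, S y = zpow T (n y) y) /\
  forall y, ~ (forall i, C i (T y)) -> \forall y' \near y, n y' = n y.
Proof.
have /choice[n Hn] := step_zpow; exists n; split => // y /step_local[m near_m].
have nm y' : Tn y' = zpow T m y' -> n y' = m by rewrite -[Tn y']/(S y') Hn; exact: zpow_inj.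
rewrite (nm _ (nbhs_singleton near_m)).
by apply: filterS near_m => y'; exact: nm.
Qed.

Lemma homeo_cocycle : exists n : X -> int, (forall y, T y = zpow S (n y) y) /\
  forall y, ~ (forall i, C i (T y)) -> \forall y' \near y, n y' = n y.
Proof.
have /choice[n Hn] := homeo_zpow; exists n; split => // y /homeo_local[m near_m].
have nm y' : T y' = zpow S m y' -> n y' = m by rewrite Hn; exact: zpow_inj.
rewrite (nm _ (nbhs_singleton near_m)).
by apply: filterS near_m => y'; exact: nm.
Qed.

Lemma tower_conjugate_soe (Y : topologicalType) (V : homeo Y Y) (h : homeo X Y) :
  (forall x, h (S x) = V (h x)) -> strong_orbit_equivalent V T.
Proof.
move=> hS; have hS' y : hinv h (V y) = S (hinv h y).
  by rewrite -[in LHS](hinvK h y) -hS hfunK.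
have [n1 [Hn1 ln1]] := step_cocycle; have [n2 [Hn2 ln2]] := homeo_cocycle.
have D (n : X -> int) : (forall y, ~ (forall i, C i (T y)) -> \forall y' \near y, n y' = n y) ->
    forall y, discontinuities (n \o hinv h : Y -> discrete_topology int) y -> hinv h y = hinv T x0.
  move=> ln y dy; apply: hinv_x0; apply: contrapT => /ln l; apply: dy.
  by apply: lc_continuous; exact: (@hinv_continuous _ _ h y _ l).
exists (homeo_inv h), (n1 \o hinv h), (n2 \o hinv h); split.
- move=> y; exists (hinv h y); rewrite -step_orbit; apply/seteqP; split.
    by move=> _ [_ [n _ <-] <-]; exists n => //=; exact/esym/(zpow_conj (f := hinv h)).
  move=> _ [n _ <-]; exists (zpow V n y); first by exists n.
  exact: (zpow_conj (f := hinv h)).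
- by move=> y /=; rewrite hS' Hn1.
- by move=> y /=; rewrite (zpow_conj (f := hinv h) (V := S)) // Hn2.
- by move=> y y' /(D _ ln1) e /(D _ ln1) e'; apply: (can_inj (hinvK h)); rewrite e e'.
- by move=> y y' /(D _ ln2) e /(D _ ln2) e'; apply: (can_inj (hinvK h)); rewrite e e'.
Qed.

(** * Addresses of points in the reordered towers *)

Local Notation depthS i := (depth S (C i)).
Local Notation baseS i := (tower_base S (C i)).

Lemma depthS_iter i b m : C i b -> m < rt (C i) b -> depthS i (iter m S b) = m.
Proof. by move=> Cb mr; apply: depth_iter; rewrite ?step_return_time. Qed.

Lemma baseS_iter i b m : C i b -> m < rt (C i) b -> baseS i (iter m S b) = b.
Proof. by move=> Cb mr; apply: tower_base_iter; rewrite ?step_return_time. Qed.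

Lemma baseSP i y : C i (baseS i y) /\ depthS i y < rt (C i) (baseS i y).
Proof. by have [b Cb [m mr ->]] := step_tower i y; rewrite baseS_iter // depthS_iter. Qed.

Lemma depthS_le i y : depthS i y <= depthS i.+1 y.
Proof.
have [Cb _] := baseSP i.+1 y.
by have [] := hitP (base_decr Cb : C i (iter (depthS i.+1 y) (hinv S) y)).
Qed.

Lemma baseS_iterS i y : baseS i y = iter (depthS i.+1 y - depthS i y) S (baseS i.+1 y).
Proof.
have e := depthK S (C i.+1) y; have := depthS_le i y.
rewrite {1}/tower_base; set q := depth S (C i) y; set q' := depth S _ y in e * => qq.
by rewrite -{1}e iter_hinv_sub.
Qed.

(** Label and depth give the old time of the point through [ix]; at level [n.+1] equal labels have
    equal names, so [chi n] agrees at that time. *)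
Lemma address_inj x y : (forall i, depthS i x = depthS i y) ->
  (forall i, kap T (st i) (baseS i x) = kap T (st i) (baseS i y)) -> x = y.
Proof.
move=> dxy kxy; apply: schi => n; set i := n.+1.
have [Cx qx] := baseSP i x; have [Cy qy] := baseSP i y.
have E z : z = iter (nth 0 (ix T (st i) (baseS i z)) (depthS i z)) T (baseS i z).
  have [Cz qz] := baseSP i z.
  rewrite -{1}(depthK S (C i) z) -(nth_traject S qz) -tower_traject //.
  by rewrite (nth_map 0) // -(size_map (fun j => iter j T (baseS i z))) size_tower.
have ixy : ix T (st i) (baseS i x) = ix T (st i) (baseS i y) by rewrite /ix kxy.
have Pxy : sP (st i) (baseS i x) = sP (st i) (baseS i y).
  by have [] := label_inj (kxy i).
rewrite (E x) (E y) -ixy -dxy; apply: (inv_names (Hinv i)) => //.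
rewrite -mem_ix // mem_nth // -(size_map (fun j => iter j T (baseS i x))) size_tower //.
Qed.

Lemma blocks_filter i x : C i.+1 x ->
  blocks i x = [seq z <- traject S x (rt (C i.+1) x) | C i z].
Proof.
move=> Cx; rewrite -tower_traject // towerS //.
have : forall y, y \in blocks i x -> C i y by move=> y; exact: blocks_base.
elim: (blocks i x) => //= b bs IH h; rewrite filter_cat -IH; last first.
  by move=> y yb; apply: h; rewrite inE yb orbT.
rewrite -cat1s; congr (_ ++ _).
have Cb : C i b by apply: h; rewrite mem_head.
have [u e] := tower_cons Cb; have := tower_uniq Cb; rewrite e /= Cb => /andP[bu _].
congr cons; apply/esym/eqP; rewrite -(negbK (_ == _)) -has_filter; apply/hasPn => z zu.
apply/negP => Cz; have := tower_disj Cb Cz _ (base_tower Cz).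
by rewrite e inE zu orbT => /(_ isT) e'; rewrite e' zu in bu.
Qed.

(** * Itineraries in three letters *)

Definition letter x : 'I_3 := inord (tau T (st 0) x).
Definition coding y : full_shift 'I_3 := fun n => letter (zpow S n y).

Lemma letter_inj x y : letter x = letter y -> tau T (st 0) x = tau T (st 0) y.
Proof. by move=> /(congr1 (@nat_of_ord 3)); rewrite !inordK. Qed.

Lemma coding_continuous : continuous coding.
Proof.
apply: continuous_product => n y; apply: lc_continuous.
apply: (lc_precomp (@zpow_continuous S n)).
by apply: lc_comp; exact: lc_tau.
Qed.

Lemma coding_step y : coding (S y) = shift_map 'I_3 (coding y).
Proof. by apply/funext => n; rewrite /coding /= /shift_fun zpowD. Qed.

Lemma coding_iter x y m : coding x = coding y -> coding (iter m S x) = coding (iter m S y).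
Proof. by move=> e; elim: m => //= m IH; rewrite !coding_step IH. Qed.

Lemma coding_iteri x y m : coding x = coding y ->
  coding (iter m (hinv S) x) = coding (iter m (hinv S) y).
Proof.
move=> e; elim: m => //= m IH; apply: (can_inj (@shift_funK 'I_3)).
by rewrite -[shift_fun _]/(shift_map 'I_3 _) -[shift_fun _]/(shift_map 'I_3 _) -!coding_step !hinvK.
Qed.

(** By induction, the vertices at level [i] show the visits to the next base by [inv_class]. This
    delimits the next towers, and the vertices of their blocks determine the vertex above by
    [good_inj]. *)
Lemma coding_levels i x y : coding x = coding y ->
  C i x = C i y /\ (C i x -> tau T (st i) x = tau T (st i) y).
Proof.
elim: i x y => [|i IH] x y e.
  split=> [|_]; first by rewrite HC0.
  by apply: letter_inj; exact: (congr1 (fun z : full_shift 'I_3 => z 0%R) e).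
have half x' y' : coding x' = coding y' -> C i.+1 x' -> C i.+1 y'.
  move=> e' Cx; have Cix := base_decr Cx; have [Ciy txy] := IH _ _ e'.
  rewrite -sC1E; apply: (inv_class (Hinv i) Cix) => //; first by rewrite -Ciy.
    exact: txy.
  by rewrite sC1E.
have CE x' y' : coding x' = coding y' -> C i.+1 x' = C i.+1 y'.
  by move=> e'; apply/idP/idP; apply: half.
split; first exact: CE.
move=> Cx; have Cy := half _ _ e Cx.
have rtE : rt (C i.+1) x = rt (C i.+1) y.
  rewrite -(step_return_time Cx); apply: return_time_eq => //.
    by rewrite (CE _ _ (coding_iter _ e)) iter_step_base.
  by move=> m mr; rewrite (CE _ _ (coding_iter _ e)) iter_step_notin.
apply: (good_inj (Hgood i)) => //.
rewrite -!blocks_kap // !blocks_filter // -!map_comp rtE.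
apply: (traject_filter_map (f := spt (st i) \o kap T (st i))) => m.
  by have [] := IH _ _ (coding_iter m e).
by have [_] := IH _ _ (coding_iter m e).
Qed.

(** Itineraries yield vertices only. The full label of a block is recovered one level up: it is the
    entry of [sg], at the vertex of the surrounding tower, whose index is the number of blocks
    already passed. *)
Lemma coding_inj : injective coding.
Proof.
move=> x y e.
have dE i : depthS i x = depthS i y.
  apply: hit_ext; first by have [Cb _] := baseSP i x; exists (depthS i x).
  by move=> n; have [] := coding_levels i (coding_iteri n e).
have bE i : coding (baseS i x) = coding (baseS i y) by rewrite /tower_base dE; exact: coding_iteri.
apply: address_inj => // i.
have [Cx qx] := baseSP i.+1 x; have [Cy qy] := baseSP i.+1 y.
have [Cbx _] := baseSP i x.
have tE : tau T (st i.+1) (baseS i.+1 x) = tau T (st i.+1) (baseS i.+1 y).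
  by have [_ ->] := coding_levels i.+1 (bE i.+1).
set m := depthS i.+1 x - depthS i x.
have K z : depthS i z = depthS i x -> depthS i.+1 z = depthS i.+1 x ->
    kap T (st i) (baseS i z) = nth 0 (sg i (tau T (st i.+1) (baseS i.+1 z)))
      (size [seq tau T (st i) w | w <- traject S (baseS i.+1 z) m & C i w]).
  move=> e1 e2; have [Cz qz] := baseSP i.+1 z.
  have mr : m < rt (C i.+1) (baseS i.+1 z) by apply: leq_ltn_trans qz; rewrite e2 leq_subr.
  rewrite -blocks_kap // blocks_filter // -(subnKC (ltnW mr)) trajectD filter_cat map_cat.
  rewrite size_map nth_cat size_map ltnn subnn.
  have : 0 < rt (C i.+1) (baseS i.+1 z) - m by rewrite subn_gt0.
  case: (_ - m) => // r _; rewrite trajectS /=.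
  have -> : iter m Tn (baseS i.+1 z) = baseS i z by rewrite (baseS_iterS i z) e1 e2.
  by have [-> _] := baseSP i z.
rewrite (K x) // (K y) // tE; congr (nth _ _ (size _)).
apply: traject_filter_map => n; first by have [] := coding_levels i (coding_iter n (bE i.+1)).
by have [_] := coding_levels i (coding_iter n (bE i.+1)).
Qed.

(* The number of the block of [y] inside its tower of level [j.+1]: as the count
   starts at [1], it omits the bottom block. *)
Definition position j y :=
  count (fun t => C j (iter t S (baseS j.+1 y))) (iota 1 (depthS j.+1 y)).

Lemma lc_depthS j : lc (depthS j).
Proof. by apply: (lc_bk cantorX step_minimal (lC j)); exists x0. Qed.

Lemma lc_baseS j W (f : X -> W) : lc f -> lc (fun y => f (baseS j y)).
Proof. by move=> lf; apply: (lc_base cantorX step_minimal (lC j)) => //; exists x0. Qed.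

Lemma lc_position j : lc (position j).
Proof.
apply: (@lc_dep _ _ _ (depthS j.+1) (fun d y =>
  count (fun t => C j (iter t S (iter d (hinv S) y))) (iota 1 d))); first exact: lc_depthS.
move=> d; apply: (lc_precomp (h := iter d (hinv S))
   (f := fun y => count (fun t => C j (iter t S y)) (iota 1 d))).
  by apply: continuous_iter; exact: hinv_continuous.
have : lc (fun y => count id [seq C j (iter t S y) | t <- iota 1 d]).
  by apply: lc_comp; apply: lc_map => t; exact: lc_iter.
by apply: lc_ext => y; rewrite count_map.
Qed.

Lemma depthS0 j y : C j y -> depthS j y = 0.
Proof. by move=> Cy; apply: hit_eq. Qed.

Lemma baseS0 j y : C j y -> baseS j y = y.
Proof. by move=> Cy; rewrite /tower_base depthS0. Qed.

Lemma position0 j y : C j.+1 y -> position j y = 0.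
Proof. by move=> Cy; rewrite /position depthS0. Qed.

Lemma depthS_lt j y : ~~ C j (S y) -> (depthS j y).+1 < rt (C j) (baseS j y).
Proof.
have [Cb d] := baseSP j y => nC; rewrite ltn_neqAle d andbT; apply/eqP => e; move: nC.
by rewrite -[y in S y](depthK S (C j)) -iterS e iter_step_base.
Qed.

Lemma baseS_step j y : ~~ C j (S y) -> baseS j (S y) = baseS j y.
Proof.
move=> /depthS_lt dl; have [Cb d] := baseSP j y.
by rewrite -[y in S y](depthK S (C j)) -iterS baseS_iter.
Qed.

Lemma depthS_step j y : ~~ C j (S y) -> depthS j (S y) = (depthS j y).+1.
Proof.
move=> /depthS_lt dl; have [Cb d] := baseSP j y.
by rewrite -[y in S y](depthK S (C j)) -iterS depthS_iter.
Qed.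

Lemma position_step j y : ~~ C j.+1 (S y) -> position j (S y) = position j y + C j (S y).
Proof.
move=> nC; rewrite /position baseS_step // depthS_step // -[(depthS j.+1 y).+1]addn1 iotaD count_cat /=.
by rewrite addn0 depthK.
Qed.

Lemma size_blocks i x : C i.+1 x ->
  size (blocks i x) = (count (fun t => C i (iter t S x)) (iota 1 (rt (C i.+1) x).-1)).+1.
Proof.
move=> Cx; rewrite blocks_filter // size_filter; set n := (rt _ _).-1.
have -> : rt (C i.+1) x = n.+1 by [].
by rewrite trajectS (traject_iota S 1) /= base_decr // add1n count_map.
Qed.

Lemma position_last j y : C j.+1 (S y) -> (position j y).+1 = size (blocks j (baseS j.+1 y)).
Proof.
move=> CS; have [Cb d] := baseSP j.+1 y; rewrite size_blocks // /position.
have -> // : rt (C j.+1) (baseS j.+1 y) = (depthS j.+1 y).+1.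
apply/eqP; rewrite eqn_leq d andbT leqNgt; apply/negP => h.
have := iter_step_notin Cb (m := (depthS j.+1 y).+1); rewrite /= depthK CS => /(_ _) /negP.
by apply.
Qed.

Lemma position_lt j y : position j y < size (blocks j (baseS j.+1 y)).
Proof.
have [Cb d] := baseSP j.+1 y; rewrite size_blocks // ltnS /position.
have le : depthS j.+1 y <= (rt (C j.+1) (baseS j.+1 y)).-1 by [].
by rewrite -[_.-1](subnKC le) iotaD count_cat leq_addr.
Qed.

Lemma position_max j y : C j (S y) ->
  (position j y).+1 = size (blocks j (baseS j.+1 y)) -> C j.+1 (S y).
Proof.
move=> CS e; apply: contraT => nC; have := position_lt j (S y).
by rewrite position_step // CS baseS_step // addn1 e ltnn.
Qed.

Lemma position_min j y : C j y -> position j y = 0 -> C j.+1 y.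
Proof.
move=> Cy p0; have [Cb _] := baseSP j.+1 y.
have [d0|d0] := posnP (depthS j.+1 y); first by move: Cb; rewrite /tower_base d0.
have : has (fun t => C j (iter t S (baseS j.+1 y))) (iota 1 (depthS j.+1 y)).
  by apply/hasP; exists (depthS j.+1 y); rewrite ?depthK // mem_iota; lia.
by rewrite has_count -/(position j y) p0.
Qed.

Lemma nth_position j y : exists u v,
  [/\ blocks j (baseS j.+1 y) = u ++ baseS j y :: v, size u = position j y &
      depthS j.+1 y = depthS j y + size (flatten [seq tower j b | b <- u])].
Proof.
have [Cb d] := baseSP j.+1 y; have [Cj dj] := baseSP j y.
set m := depthS j.+1 y - depthS j y.
have mE : depthS j.+1 y = m + depthS j y by rewrite /m subnK // depthS_le.
have mr : m < rt (C j.+1) (baseS j.+1 y) by apply: leq_ltn_trans d; rewrite leq_subr.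
have bE := baseS_iterS j y.
pose u := [seq z <- traject S (baseS j.+1 y) m | C j z].
have [v E] : exists v, blocks j (baseS j.+1 y) = u ++ baseS j y :: v.
  rewrite blocks_filter // -(subnKC (ltnW mr)) trajectD filter_cat.
  have : 0 < rt (C j.+1) (baseS j.+1 y) - m by rewrite subn_gt0.
  case: (_ - m) => // r _; rewrite trajectS /= -bE Cj.
  by eexists.
exists u, v; split => //.
  rewrite size_filter (traject_iota S 0) count_map.
  have -> : position j y = count (fun t => C j (iter t S (baseS j.+1 y))) (iota 1 (m + depthS j y)).
    by rewrite -mE.
  have := base_decr Cb; rewrite -[baseS j.+1 y]/(iter 0 S _) => C0.
  have cm : count (fun t => C j (iter t S (baseS j.+1 y))) (iota 1 (m + depthS j y)) =
     count (fun t => C j (iter t S (baseS j.+1 y))) (iota 1 m).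
    rewrite iotaD count_cat -[RHS]addn0; congr (_ + _); apply/eqP.
    rewrite -leqn0 leqNgt -has_count; apply/hasPn => t; rewrite mem_iota => td.
    have -> : t = (t - m) + m by lia.
    by rewrite iterD -bE; apply: iter_step_notin => //; lia.
  rewrite cm; have Cm : C j (iter m S (baseS j.+1 y)) by rewrite -bE.
  pose p t := C j (iter t S (baseS j.+1 y)).
  have e0 : count p (iota 0 (m + 1)) = count p (iota 0 m) + 1.
    by rewrite iotaD count_cat /= add0n addn0 /p Cm.
  have e1 : count p (iota 0 (m + 1)) = count p (iota 1 m) + 1.
    by rewrite addn1 addn1 /= {1}/p /= base_decr.
  by move: e0; rewrite e1 => /addIn/esym.
have t_uniq := tower_uniq Cb; have tE := towerS Cb.
rewrite E map_cat flatten_cat /= in tE.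
have [w e] := tower_cons Cj; rewrite e /= in tE.
have := tower_traject Cb; rewrite -(subnKC (ltnW mr)) trajectD.
have : 0 < rt (C j.+1) (baseS j.+1 y) - m by rewrite subn_gt0.
case: (_ - m) => // r _; rewrite trajectS -bE => tE'.
rewrite tE in t_uniq tE'; have [-> _] := uniq_cat_inj t_uniq tE'.
by rewrite size_traject mE addnC.
Qed.

(** * The Bratteli diagram of the reordered towers *)

Lemma blocks_cons i x : C i.+1 x -> exists u, blocks i x = x :: u.
Proof.
move=> Cx; rewrite blocks_filter //.
have -> : rt (C i.+1) x = (rt (C i.+1) x).-1.+1 by [].
by rewrite trajectS /= base_decr //; eexists.
Qed.

Lemma size_sg i x : C i.+1 x -> size (sg i (tau T (st i.+1) x)) = size (blocks i x).
Proof. by move=> Cx; rewrite -blocks_kap // size_map. Qed.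

Lemma nth_sg i x p : C i.+1 x -> p < size (blocks i x) ->
  nth 0 (sg i (tau T (st i.+1) x)) p = kap T (st i) (nth x0 (blocks i x) p).
Proof. by move=> Cx pb; rewrite -blocks_kap // (nth_map x0). Qed.

(** Only vertices that occur are kept, so that each has a tower representing it and statements about
    vertices reduce to towers. *)
Definition levels i : seq nat :=
  [seq v <- if i is j.+1 then sW j else iota 0 3 |
    `[< exists2 x, C i x & tau T (st i) x = v >]].

Lemma levelsP i v : v \in levels i <-> exists2 x, C i x & tau T (st i) x = v.
Proof.
rewrite mem_filter; split => [/andP[/asboolP//]|[x Cx e]].
apply/andP; split; first by apply/asboolP; exists x.
rewrite -e; case: i Cx {e} => [|i] Cx; last exact: (good_sW (Hgood i)).
by rewrite mem_iota /= Htau0.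
Qed.

Lemma tau_levels i x : C i x -> tau T (st i) x \in levels i.
Proof. by move=> Cx; apply/levelsP; exists x. Qed.

Definition vertex_label i : finType := seq_sub (levels i).

(** Codes that do not occur are sent to the vertex of [x0], which makes the map total. *)
Definition mk_vertex i (v : nat) : vertex_label i := insubd (SeqSub (tau_levels (Cx0 i))) v.

Lemma mk_vertexK i v : v \in levels i -> val (mk_vertex i v) = v.
Proof. exact: insubdK. Qed.

Lemma val_mk_vertex i x : C i x -> val (mk_vertex i (tau T (st i) x)) = tau T (st i) x.
Proof. by move=> Cx; rewrite mk_vertexK // tau_levels. Qed.

Lemma vertex_ex i (v : vertex_label i) : exists2 x, C i x & v = mk_vertex i (tau T (st i) x).
Proof.
have [x Cx e] := (levelsP i (val v)).1 (valP v); exists x => //.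
by apply: val_inj; rewrite val_mk_vertex.
Qed.

(** An edge is the vertex of a tower together with the number of one of its blocks; comparing these
    numbers orders the edges. *)
Definition edge_list i : seq (nat * nat) :=
  [seq (w, p) | w <- levels i.+1, p <- iota 0 (size (sg i w))].

Lemma edge_listP i w p : ((w, p) \in edge_list i) = (w \in levels i.+1) && (p < size (sg i w)).
Proof.
apply/allpairsPdep/andP => [[w' [p' [w'l p's [-> ->]]]]|[wl ps]].
  by split => //; move: p's; rewrite mem_iota.
by exists w, p; split => //; rewrite mem_iota.
Qed.

Lemma edge_list0 i : (tau T (st i.+1) x0, 0) \in edge_list i.
Proof.
rewrite edge_listP tau_levels //= size_sg //.
by have [u ->] := blocks_cons (Cx0 i.+1).
Qed.

Definition edge_label i : finType := seq_sub (edge_list i).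

Definition mk_edge i (e : nat * nat) : edge_label i := insubd (SeqSub (edge_list0 i)) e.

Lemma val_mk_edge i x p : C i.+1 x -> p < size (blocks i x) ->
  val (mk_edge i (tau T (st i.+1) x, p)) = (tau T (st i.+1) x, p).
Proof. by move=> Cx px; apply: insubdK; rewrite -topredE /= edge_listP tau_levels // size_sg. Qed.

Lemma edge_ex i (e : edge_label i) : exists x p, [/\ C i.+1 x, p < size (blocks i x) &
  e = mk_edge i (tau T (st i.+1) x, p)].
Proof.
have := valP e; case ve : (val e) => [w p] /=.
rewrite edge_listP => /andP[/levelsP[x Cx wE] ps]; exists x, p.
have px : p < size (blocks i x) by rewrite -size_sg // wE.
by split => //; apply: val_inj; rewrite val_mk_edge // ve wE.
Qed.

(** Indices shift by one: towers of level [i] are vertices of level [i.+1], below the single top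
    vertex. *)
Definition bvertex i : finType := if i is j.+1 then vertex_label j else unit.
Definition bedge i : finType := if i is j.+1 then edge_label j else vertex_label 0.

Definition bsrc i : bedge i -> bvertex i :=
  match i with
  | 0 => fun=> tt
  | j.+1 => fun e : edge_label j => mk_vertex j (spt (st j) (nth 0 (sg j (val e).1) (val e).2))
  end.

Definition brng i : bedge i -> bvertex i.+1 :=
  match i with
  | 0 => fun e : vertex_label 0 => e
  | j.+1 => fun e : edge_label j => mk_vertex j.+1 (val e).1
  end.

Lemma bsrcE j x p : C j.+1 x -> p < size (blocks j x) ->
  bsrc (mk_edge j (tau T (st j.+1) x, p) : bedge j.+1) =
  mk_vertex j (tau T (st j) (nth x0 (blocks j x) p)).
Proof. by move=> Cx px; rewrite /= val_mk_edge // nth_sg. Qed.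

Lemma brngE j x p : C j.+1 x -> p < size (blocks j x) ->
  brng (mk_edge j (tau T (st j.+1) x, p) : bedge j.+1) = mk_vertex j.+1 (tau T (st j.+1) x).
Proof. by move=> Cx px; rewrite /= val_mk_edge. Qed.

Lemma edge_between j (u : vertex_label j) (v : vertex_label j.+1) :
  exists e : bedge j.+1, bsrc e = u /\ brng e = v.
Proof.
have [x Cx ->] := vertex_ex v; have [y Cy ->] := vertex_ex u.
have [t tv e] := good_pos (Hgood j) Cx Cy.
have xb : iter t T x \in blocks j x.
  by apply/mapP; exists t => //; rewrite (perm_mem (good_od (Hgood j) Cx)).
exists (mk_edge j (tau T (st j.+1) x, index (iter t T x) (blocks j x))).
by rewrite bsrcE ?brngE ?index_mem // nth_index // e.
Qed.

Lemma bsrc_surj i (v : bvertex i) : exists e : bedge i, bsrc e = v.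
Proof.
case: i v => [|j] v; last first.
  by have [e []] := edge_between v (mk_vertex j.+1 (tau T (st j.+1) x0)); exists e.
by exists (mk_vertex 0 (tau T (st 0) x0)); case: v.
Qed.

Lemma brng_surj i (v : bvertex i.+1) : exists e : bedge i, brng e = v.
Proof.
case: i v => [|j] v; first by exists v.
by have [e [_ ?]] := edge_between (mk_vertex j (tau T (st j) x0)) v; exists e.
Qed.

Lemma bvertex_nonempty i : 0 < #|bvertex i|.
Proof.
case: i => [|j]; first by rewrite card_unit.
by apply/card_gt0P; exists (mk_vertex j (tau T (st j) x0)).
Qed.

Lemma bedge_nonempty i : 0 < #|bedge i|.
Proof.
case: i => [|j]; apply/card_gt0P; first by exists (mk_vertex 0 (tau T (st 0) x0)).
by exists (mk_edge j (tau T (st j.+1) x0, 0)).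
Qed.

Definition tower_bratteli : bratteli :=
  @Bratteli bvertex bedge bsrc brng bvertex_nonempty bedge_nonempty card_unit
    bsrc_surj brng_surj.

Definition bedge_le i : rel (bedge i) :=
  match i with
  | 0 => fun _ _ => true
  | j.+1 => fun e f : edge_label j => (val e).2 <= (val f).2
  end.

Lemma edge_label_eq i (e f : edge_label i) :
  brng (e : bedge i.+1) = brng (f : bedge i.+1) -> (val e).2 = (val f).2 -> e = f.
Proof.
have [x [p [Cx px ->]]] := edge_ex e; have [y [q [Cy qy ->]]] := edge_ex f.
rewrite !brngE // !val_mk_edge //= => /(congr1 val); rewrite !val_mk_vertex // => -> ->.
by [].
Qed.

Lemma bedge_le_refl i (e : bedge i) : bedge_le e e.
Proof. by case: i e => [|j] e //=. Qed.

Lemma bedge_le_anti i (e f : bedge i) : brng e = brng f -> bedge_le e f -> bedge_le f e -> e = f.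
Proof.
case: i e f => [|j] e f //= r ef fe; apply: edge_label_eq r _.
by apply/eqP; rewrite eqn_leq ef fe.
Qed.

Lemma bedge_le_trans i (e f g : bedge i) : brng e = brng f -> brng f = brng g ->
  bedge_le e f -> bedge_le f g -> bedge_le e g.
Proof. by case: i e f g => [|j] e f g //= _ _; exact: leq_trans. Qed.

Lemma bedge_le_total i (e f : bedge i) : brng e = brng f -> bedge_le e f || bedge_le f e.
Proof. by case: i e f => [|j] e f //= _; exact: leq_total. Qed.

Definition tower_ordered : ordered_bratteli :=
  @OrderedBratteli tower_bratteli bedge_le bedge_le_refl bedge_le_anti bedge_le_trans
    bedge_le_total.

Local Notation B := tower_ordered.

(** * Points as infinite paths *)

Definition path_of y : edge_seq B := fun i =>
  match i return bedge i with
  | 0 => mk_vertex 0 (tau T (st 0) y)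
  | j.+1 => mk_edge j (tau T (st j.+1) (baseS j.+1 y), position j y)
  end.

Lemma nth_blocks_position j y :
  nth x0 (blocks j (baseS j.+1 y)) (position j y) = baseS j y.
Proof. by have [u [v [-> <- _]]] := nth_position j y; rewrite nth_cat ltnn subnn. Qed.

Lemma path_of_rng i y : brng (path_of y i) = mk_vertex i (tau T (st i) (baseS i y)).
Proof.
case: i => [|j]; first by rewrite /= baseS0 // HC0.
by have [Cb _] := baseSP j.+1 y; rewrite brngE // position_lt.
Qed.

Lemma path_of_path y : path_space (path_of y : edge_seq B).
Proof.
move=> j; rewrite [LHS]path_of_rng; have [Cb _] := baseSP j.+1 y.
by rewrite [RHS]bsrcE ?position_lt // nth_blocks_position.
Qed.

Lemma path_of_continuous : continuous path_of.
Proof.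
apply: continuous_product => -[|j] y; apply: lc_continuous.
  by apply: (lc_comp (mk_vertex 0)); exact: lc_tau.
apply: (lc_comp2 (fun (t p : nat) => mk_edge j (t, p)) (f := fun y => tau T (st j.+1) (baseS j.+1 y))).
  by apply: lc_baseS; exact: lc_tau.
exact: lc_position.
Qed.

Lemma path_of_inj : injective path_of.
Proof.
move=> x y e.
have E j : tau T (st j.+1) (baseS j.+1 x) = tau T (st j.+1) (baseS j.+1 y) /\
    position j x = position j y.
  have := congr1 (fun f : edge_seq B => val (f j.+1 : edge_label j)) e.
  have [Cx _] := baseSP j.+1 x; have [Cy _] := baseSP j.+1 y.
  by rewrite /= !val_mk_edge ?position_lt // => -[].
have K j z : kap T (st j) (baseS j z) = nth 0 (sg j (tau T (st j.+1) (baseS j.+1 z))) (position j z).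
  by have [Cz _] := baseSP j.+1 z; rewrite nth_sg ?position_lt // nth_blocks_position.
apply: address_inj => [i|j]; last by rewrite (K j x) (K j y); have [-> ->] := E j.
elim: i => [|j IH]; first by rewrite !depthS0 // HC0.
have D z : depthS j.+1 z = depthS j z +
    sumn [seq size (spix (st j) c) | c <- take (position j z) (sg j (tau T (st j.+1) (baseS j.+1 z)))].
  have [u [v [E1 <- ->]]] := nth_position j z; have [Cz _] := baseSP j.+1 z.
  rewrite -blocks_kap // E1 map_cat take_size_cat ?size_map //.
  rewrite size_flatten /shape -!map_comp; congr (_ + sumn _).
  by apply/eq_map => b /=; rewrite size_map.
by rewrite (D x) (D y) IH; have [-> ->] := E j.
Qed.

(** The base [x] is arbitrary among those with the right vertex: the edge selects one of its blocks,
    whose vertex depends only on that of [x], and the induction continues inside this block. *)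
Lemma path_of_prefix (p : edge_seq B) i x : path_space p -> C i x ->
  brng (p i) = mk_vertex i (tau T (st i) x) ->
  exists2 y, baseS i y = x & forall j, j <= i -> path_of y j = p j.
Proof.
move=> pp; elim: i x => [|i IH] x Cx px.
  exists x; first exact: baseS0.
  by case=> // _; rewrite [LHS]/= -px.
have [x' [q [Cx' qx' e]]] := edge_ex (p i.+1 : edge_label i).
move: px; rewrite e brngE // => /(congr1 val); rewrite !val_mk_vertex // => tx.
have sxx : size (blocks i x') = size (blocks i x) by rewrite -!size_sg // tx.
set b := nth x0 (blocks i x) q.
have qx : q < size (blocks i x) by rewrite -sxx.
have binx : b \in blocks i x by exact: mem_nth.
have Cb : C i b by exact: blocks_base binx.
have [|y yb yp] := IH b Cb.
  by have -> : brng (p i) = bsrc (p i.+1) := pp i; rewrite e tx bsrcE.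
have [_ dy] := baseSP i y; rewrite yb in dy.
have yE : y = iter (depthS i y) S b by rewrite -yb depthK.
have [A [D [AD sA]]] : exists A D, blocks i x = A ++ b :: D /\ size A = q.
  exists (take q (blocks i x)), (drop q.+1 (blocks i x)).
  by rewrite -drop_nth // cat_take_drop size_takel // ltnW.
have yx : baseS i.+1 y = x.
  have yt : y \in tower i.+1 x.
    rewrite towerS //; apply/flattenP; exists (tower i b); first exact: map_f.
    by rewrite yE iter_step_mem.
  move: yt; rewrite tower_traject // => /trajectP[m mr ->].
  by rewrite baseS_iter.
have bu : uniq (blocks i x).
  by rewrite blocks_filter // filter_uniq // -tower_traject // tower_uniq.
have pq : position i y = q.
  have := nth_uniq x0 (position_lt i y) _ _; rewrite yx => /(_ q qx bu).
  rewrite -[in X in nth x0 (blocks i X) _ == _]yx nth_blocks_position yb eqxx.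
  by move=> /esym/eqP.
exists y => // j; rewrite leq_eqVlt => /predU1P[->|]; last exact: yp.
by rewrite /= yx pq -tx e.
Qed.

(** The points agreeing with [p] up to a given level form a decreasing sequence of nonempty clopen
    sets. *)
Lemma path_of_surj (p : edge_seq B) : path_space p -> exists y, path_of y = p.
Proof.
move=> pp; pose Z i y := all (fun j => path_of y j == p j :> bedge j) (iota 0 i.+1).
have lZ i : lc (Z i).
  apply: (lc_all _ (p := fun j y => path_of y j == p j :> bedge j)) => j.
  apply: (lc_comp (fun e : bedge j => e == p j)).
  case: j => [|j]; first by apply: (lc_comp (mk_vertex 0)); exact: lc_tau.
  apply: (lc_comp2 (fun (t p : nat) => mk_edge j (t, p)) (f := fun y => tau T (st j.+1) (baseS j.+1 y))).
    by apply: lc_baseS; exact: lc_tau.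
  exact: lc_position.
have [|i|y Zy] := @decreasing_compact _ Z cX lZ.
- by move=> i y; rewrite /Z -[i.+2]addn1 iotaD all_cat => /andP[].
- have [x Cx px] := vertex_ex (brng (p i) : vertex_label i).
  have [y _ yp] := path_of_prefix pp Cx px.
  by exists y; apply/allP => j; rewrite mem_iota => /andP[_ ji]; rewrite yp.
exists y; apply: functional_extensionality_dep => i.
by have /allP/(_ i) := Zy i; rewrite mem_iota /= ltnSn => /(_ isT)/eqP.
Qed.

Lemma max_edge0 (e : bedge 0) : @max_edge B 0 e. Proof. by []. Qed.
Lemma min_edge0 (e : bedge 0) : @min_edge B 0 e. Proof. by []. Qed.

Lemma max_edgeP j y : @max_edge B j.+1 (path_of y j.+1) <->
  (position j y).+1 = size (blocks j (baseS j.+1 y)).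
Proof.
have [Cb _] := baseSP j.+1 y; have pl := position_lt j y; split.
  set n := size _ in pl * => mx; have n1 : n.-1 < n by case: n pl.
  pose f : bedge j.+1 := mk_edge j (tau T (st j.+1) (baseS j.+1 y), n.-1).
  have r : brng f = brng (path_of y j.+1) by rewrite /f !brngE.
  by have := mx f r; rewrite /= !val_mk_edge //=; move: pl; case: (n) => //= n' h1 h2; lia.
move=> e f; have [x [q [Cx qx ->]]] := edge_ex f => r.
have : brng (mk_edge j (tau T (st j.+1) x, q) : bedge j.+1) = brng (path_of y j.+1) by exact: r.
rewrite !brngE // => /(congr1 val); rewrite !val_mk_vertex // => te.
rewrite /= !val_mk_edge //=; move: qx; rewrite -ltnS -(size_sg Cx) te size_sg // -e.
by [].
Qed.

Lemma min_edgeP j y : @min_edge B j.+1 (path_of y j.+1) <-> position j y = 0.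
Proof.
have [Cb _] := baseSP j.+1 y; have pl := position_lt j y; split.
  move=> mn; pose f : bedge j.+1 := mk_edge j (tau T (st j.+1) (baseS j.+1 y), 0).
  have s0 : 0 < size (blocks j (baseS j.+1 y)) by exact: leq_ltn_trans pl.
  have r : brng f = brng (path_of y j.+1) by rewrite /f !brngE.
  by have := mn f r; rewrite /= !val_mk_edge //= leqn0 => /eqP.
by move=> e f _; rewrite /= val_mk_edge //= e.
Qed.

Lemma path_of_step_const j k y : k < j -> ~~ C k (S y) -> path_of (S y) j = path_of y j.
Proof.
case: j => // j; rewrite ltnS => kj nC.
have nCj : ~~ C j (S y) by apply: contra nC; exact: base_le.
have nCj1 : ~~ C j.+1 (S y) by apply: contra nCj; exact: base_decr.
by rewrite /= baseS_step // position_step // (negbTE nCj) addn0.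
Qed.

Lemma max_edges_top k y : (forall j, j < k -> @max_edge B j (path_of y j)) ->
  forall j, j < k -> C j (S y).
Proof.
move=> mx; elim=> [|j IH] jk; first by rewrite HC0.
by apply: position_max; [exact: IH (ltnW jk)|apply/max_edgeP; exact: mx].
Qed.

(** Maximal edges below index [k.+1] mean that the next point lies in [C k]; the nonmaximal edge
    there means that it stays in the same tower of level [k.+1]. So [position k] grows by one and
    larger levels are unaffected. *)
Lemma vershik_step y :
  (max_path (path_of y) -> min_path (path_of (S y))) /\
  (forall k, (forall j, j < k -> @max_edge B j (path_of y j)) ->
     ~ @max_edge B k (path_of y k) ->
     [/\ forall j, j < k -> @min_edge B j (path_of (S y) j),
         @succ_edge B k (path_of y k) (path_of (S y) k) &
         forall j, k < j -> path_of (S y) j = path_of y j]).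
Proof.
split=> [mx [|j]|[|k] mx nmx]; [exact: min_edge0| |by case: nmx; exact: max_edge0|].
  apply/min_edgeP/position0.
  by apply: (@max_edges_top j.+2 y) => // i _; exact: mx.
have top := max_edges_top mx.
have nC : ~~ C k.+1 (S y).
  by apply/negP => CS; apply: nmx; apply/max_edgeP; exact: position_last.
split.
- by case=> [|j] jk; [exact: min_edge0|apply/min_edgeP/position0; exact: top].
- have Ck : C k (S y) by exact: top.
  have pl := position_lt k (S y); have pl0 := position_lt k y.
  have [Cb _] := baseSP k.+1 y.
  move: pl; rewrite [path_of (S y) _]/= position_step // baseS_step // Ck addn1 => pl.
  set e := path_of y k.+1; set f := mk_edge _ _.
  have vf : val (f : edge_label k) = (tau T (st k.+1) (baseS k.+1 y), (position k y).+1) by rewrite val_mk_edge.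
  have ve : val (e : edge_label k) = (tau T (st k.+1) (baseS k.+1 y), position k y) by rewrite val_mk_edge.
  have rfe : brng (f : bedge k.+1) = brng e by rewrite /e !brngE.
  split; first exact: rfe.
    split; first by rewrite /= ve vf /=.
    by move=> ef; move: ve; rewrite ef vf => -[]; lia.
  move=> g rg [eg neg]; have : (val (e : edge_label k)).2 <> (val (g : edge_label k)).2.
    by move=> h; apply: neg; apply: edge_label_eq h; exact: esym.
  by move: eg; rewrite /= ve vf /=; lia.
- by move=> j kj; exact: path_of_step_const nC.
Qed.

Lemma bedge_between i (u : bvertex i) (v : bvertex i.+1) :
  exists e : bedge i, bsrc e = u /\ brng e = v.
Proof. by case: i u v => [|j] u v; [exists v; case: u|exact: edge_between]. Qed.

Lemma incidence_gt0 i u v : 0 < incidence B i v u.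
Proof.
rewrite mxE; have [e [eu ev]] := bedge_between (enum_val u) (enum_val v).
apply/card_gt0P; exists e; rewrite inE; apply/andP; split; apply/eqP.
  exact: eu.
exact: ev.
Qed.

Lemma incidence_prod_gt0 i k u v : 0 < incidence_prod B i k.+1 v u.
Proof.
elim: k v => [|k IH] v; first by rewrite [incidence_prod _ _ _]/= mulmx1 incidence_gt0.
have w := Ordinal (vertex_nonempty B (k.+1 + i)).
rewrite -[incidence_prod _ _ _]/(incidence B (k.+1 + i) *m incidence_prod B i k.+1)%R mxE.
rewrite (bigD1 w) //=; apply: leq_trans (leq_addr _ _).
by rewrite muln_gt0 incidence_gt0 IH.
Qed.

Lemma tower_simple : simple_bratteli B.
Proof.
exists id; split => // i u v; move: u v; have : 0 < i.+1 - i by rewrite subSnn.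
by case: (i.+1 - i) => // k _ u v; exact: incidence_prod_gt0.
Qed.

Lemma path_space_inv (p : edge_seq B) : path_space p -> exists y, p = path_of y.
Proof. by move=> /path_of_surj[y <-]; exists y. Qed.

Lemma unique_min_path : exists! p : edge_seq B, path_space p /\ min_path p.
Proof.
exists (path_of x0); split.
  split; first exact: path_of_path.
  by case=> [|j]; [exact: min_edge0|apply/min_edgeP/position0].
move=> p [/path_space_inv[y ->] mn]; congr path_of; apply/esym/base_cap.
elim=> [|j IH]; first by rewrite HC0.
by apply: position_min => //; apply/min_edgeP; exact: mn.
Qed.

Lemma unique_max_path : exists! p : edge_seq B, path_space p /\ max_path p.
Proof.
have Sx : S (hinv S x0) = x0 by rewrite hinvK.
exists (path_of (hinv S x0)); split.
  split; first exact: path_of_path.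
  by case=> [|j]; [exact: max_edge0|apply/max_edgeP/position_last; rewrite Sx].
move=> p [/path_space_inv[y ->] mx]; congr path_of.
apply: (can_inj (hfunK S)); rewrite Sx; apply/esym/base_cap => i.
by apply: (@max_edges_top i.+1 y) => // j _; exact: mx.
Qed.

Lemma edge_seq_hausdorff : hausdorff_space (edge_seq B).
Proof. by apply: hausdorff_product => i; exact: discrete_hausdorff. Qed.

Lemma path_homeo : exists h : homeo X (set_type (@path_space B)),
  forall y, val (h y) = path_of y.
Proof.
apply: embedding_homeo => //.
- exact: edge_seq_hausdorff.
- exact: path_of_continuous.
- exact: path_of_inj.
apply/seteqP; split => [p /path_of_surj[y <-]|_ [y _ <-]]; first by exists y.
exact: path_of_path.
Qed.

Lemma path_space_infinite : infinite_set (@path_space B).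
Proof.
pose g (p : edge_seq B) := xget x0 [set y | path_of y = p].
have gK y : g (path_of y) = y.
  by apply: xget_unique => // z; exact: path_of_inj.
move=> /(finite_image g) /finite_seqP[s es]; apply: (cantor_infinite cantorX (s := s)) => y.
have : [set` s] y by rewrite -es; exists (path_of y); [exact: path_of_path|exact: gK].
by [].
Qed.

Lemma tower_representation (Y : topologicalType) (V : homeo Y Y) (h : homeo X Y) :
  (forall x, h (S x) = V (h x)) -> bratteli_vershik_representation B V.
Proof.
move=> hS; have [r rE] := path_homeo; split.
- by split; [exact: tower_simple|exact: unique_min_path|exact: unique_max_path].
- exact: path_space_infinite.
exists (fun p => r (S (hinv r p))); split.
  move=> p; have := vershik_step (hinv r p).
  by have -> : path_of (hinv r p) = val p; [rewrite -rE hinvK|rewrite -rE].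
by exists (homeo_comp h (homeo_inv r)) => p /=; rewrite hfunK hS.
Qed.

(** * Path numbers as heights of towers *)

Definition height i (v : bvertex i) : nat := #|{: @top_path B i v}|.

Lemma heightS i (v : bvertex i.+1) :
  height v = \sum_(e : bedge i | brng e == v) height (bsrc e).
Proof.
rewrite /height /= card_tagged sumnE big_map big_enum /=.
rewrite [RHS](reindex_omap (val : {e : bedge i | brng e == v} -> bedge i) insub) /=.
  by apply: eq_bigl => e; rewrite (valP e) valK eqxx.
by move=> e ev; rewrite insubT.
Qed.

(** Counting paths by their last edge matches adding up the heights of the blocks of a tower; at
    level [0] both counts are one. *)
Lemma height_tower i x : C i x -> height (mk_vertex i (tau T (st i) x) : bvertex i.+1) = rt (C i) x.
Proof.
elim: i x => [|j IH] x Cx.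
  rewrite heightS (big_pred1 (mk_vertex 0 (tau T (st 0) x))) ?/height /=; last first.
    by move=> e; rewrite /= eq_sym.
  by rewrite card_unit; apply/esym/return_time_eq; rewrite ?HC0 // => -[].
rewrite heightS; set n := size (blocks j x).
pose h (p : 'I_n) : bedge j.+1 := mk_edge j (tau T (st j.+1) x, nat_of_ord p).
pose h' (e : bedge j.+1) : option 'I_n := insub (val (e : edge_label j)).2.
rewrite (reindex_omap h h'); last first.
  move=> e /eqP; have [y [q [Cy qy ->]]] := edge_ex e.
  rewrite brngE // => /(congr1 val); rewrite !val_mk_vertex // => tE.
  have qn : q < n by rewrite /n -size_sg // -tE size_sg.
  by rewrite /h' val_mk_edge // insubT /= /h /= tE.
have hE p : height (bsrc (h p)) = size (tower j (nth x0 (blocks j x) p)).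
  have Cb : C j (nth x0 (blocks j x) p) by apply: (blocks_base Cx); exact: mem_nth.
  by rewrite /h bsrcE // IH // size_tower.
rewrite (eq_big (fun=> true) (fun p => size (tower j (nth x0 (blocks j x) (nat_of_ord p))))).
- rewrite -(big_mkord xpredT (fun p => size (tower j (nth x0 (blocks j x) p)))).
  rewrite -size_tower // towerS // size_flatten /shape.
  have -> : sumn [seq size t | t <- [seq tower j b | b <- blocks j x]] =
      \sum_(b <- blocks j x) size (tower j b) by rewrite sumnE !big_map.
  by rewrite [RHS](big_nth x0).
- by move=> p; rewrite /h brngE // eqxx /h' val_mk_edge // valK eqxx.
- by move=> p _; exact: hE.
Qed.

Lemma height_bounds i (v : bvertex i.+2) :
  hN i <= height v <= hN i + hN i %/ i.+1.
Proof.
have [x Cx ->] := vertex_ex (v : vertex_label i.+1).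
by rewrite height_tower //; exact: (good_rt (Hgood i)).
Qed.

Lemma path_numbers i : 0 < hN i <= min_paths B i.+2 /\
  min_paths B i.+2 <= max_paths B i.+2 <= hN i + hN i %/ i.+1.
Proof.
have [N0 _] := good_N (Hgood i).
have mx : hN i <= max_paths B i.+2 <= hN i + hN i %/ i.+1.
  rewrite /max_paths; apply/andP; split.
    have v : bvertex i.+2 := mk_vertex i.+1 (tau T (st i.+1) x0).
    by rewrite (bigD1 v) //=; apply: leq_trans (leq_maxl _ _); have /andP[] := height_bounds v.
  by apply/bigmax_leqP => v _; have /andP[] := height_bounds v.
move/andP: mx => [mx1 mx2]; rewrite N0 mx2 andbT /min_paths /=; split.
  by elim/big_ind: _ => // [a b ha hb|v _]; [rewrite leq_min ha hb|have /andP[] := height_bounds v].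
elim/big_rec: _ => // v a _ h; exact: leq_trans (geq_minr _ _) h.
Qed.

(** At level [i.+2] the heights lie between [N] and [N + N %/ i.+1], so the quotient exceeds [1] by
    at most [1 / i.+1]. *)
Lemma tower_pseudo_ERS (R : realType) : pseudo_ERS R B.
Proof.
split; first exact: tower_simple.
apply/cvgrPdist_le => e e0.
near=> n.
have n2 : 2 <= n by near: n; exact: nbhs_infty_ge.
have ne : (n.-1%:R^-1 <= e :> R)%R.
  have h : (e^-1 + 1 <= n%:R :> R)%R by near: n; exact: nbhs_infty_ger.
  have n1 : (0 < n.-1%:R :> R)%R by rewrite ltr0n; lia.
  rewrite invf_ple ?posrE //; move: h; rewrite -lerBrDr => /le_trans; apply.
  by rewrite -subn1 natrB //; lia.
have [i ni] : exists i, n = i.+2 by exists n.-2; lia.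
rewrite ni in ne *; rewrite /= in ne; have [/andP[N0 mn] /andP[mm mx]] := path_numbers i.
set M := max_paths _ _ in mm mx *; set m := min_paths _ _ in mn mm *.
have m0 : (0 < m%:R :> R)%R by rewrite ltr0n (leq_trans N0).
rewrite distrC ger0_norm; last by rewrite subr_ge0 ler_pdivlMr // mul1r ler_nat.
apply: le_trans ne; rewrite lerBlDr ler_pdivrMr // mulrDl mul1r.
have : (M%:R <= m%:R + (m %/ i.+1)%:R :> R)%R.
  rewrite -natrD ler_nat; apply: leq_trans mx _; apply: leq_add => //; exact: leq_div2r.
move=> /le_trans; apply; rewrite addrC lerD2r mulrC ler_pdivlMr // -natrM ler_nat.
exact: leq_divM.
Unshelve. all: by end_near. Qed.

(** * Complexity of the coding *)

(** The letters read along a tower. No tower appears in the definition, because [sg] is a function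
    of the vertex. *)
Fixpoint word i (v : nat) : seq nat :=
  if i is j.+1 then flatten [seq word j w | w <- map (spt (st j)) (sg j v)] else [:: v].

Lemma tower_word i x : C i x -> map (tau T (st 0)) (tower i x) = word i (tau T (st i) x).
Proof.
elim: i x => [|i IH] x Cx.
  have r1 : rt (C 0) x = 1 by apply: return_time_eq; rewrite ?HC0 // => -[].
  by rewrite tower_traject // r1.
rewrite towerS // map_flatten [word _ _]/=.
have -> : map (spt (st i)) (sg i (tau T (st i.+1) x)) = map (tau T (st i)) (blocks i x).
  by rewrite -blocks_kap // -map_comp.
have : forall b, b \in blocks i x -> C i b by move=> b; exact: blocks_base.
elim: (blocks i x) => //= b l IHl h; rewrite IH ?h ?mem_head //.
by rewrite IHl // => c cl; apply: h; rewrite inE cl orbT.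
Qed.

(** Going down one level at a time, vertices of points in the next base occur exactly at the starts
    of towers, which cuts the concatenation; [good_inj] then identifies each piece. *)
Lemma word_inj i u u' : {subset u <= levels i} -> {subset u' <= levels i} ->
  flatten (map (word i) u) = flatten (map (word i) u') -> u = u'.
Proof.
elim: i u u' => [|i IH] u u' uL u'L.
  by rewrite !flatten_map1 !map_id.
pose F v := map (spt (st i)) (sg i v).
have FE x : C i.+1 x -> F (tau T (st i.+1) x) = map (tau T (st i)) (blocks i x).
  by move=> Cx; rewrite /F -blocks_kap // -map_comp.
have wE w : flatten (map (word i.+1) w) = flatten (map (word i) (flatten (map F w))).
  by elim: w => //= v w ->; rewrite map_cat flatten_cat.
have FL w : {subset w <= levels i.+1} -> {subset flatten (map F w) <= levels i}.
  move=> wL z /flattenP[l /mapP[v vw ->]].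
  have [x Cx <-] := (levelsP i.+1 v).1 (wL _ vw).
  by rewrite FE // => /mapP[b bx ->]; apply: tau_levels; exact: blocks_base bx.
rewrite !wE => /(IH _ _ (FL _ uL) (FL _ u'L)).
pose Q v := `[< exists2 x, C i.+1 x & tau T (st i) x = v >].
apply: (flatten_map_inj (L := levels i.+1) (Q := Q)) => //.
  move=> v /levelsP[x Cx <-]; rewrite FE //.
  have [w bw] := blocks_cons Cx; rewrite bw /=; eexists; eexists; split; first by [].
    by apply/asboolP; exists x.
  apply/allP => _ /mapP[z zw ->]; apply/negP => /asboolP[y Cy ty].
  have zb : z \in blocks i x by rewrite bw inE zw orbT.
  have Cz : C i z := blocks_base Cx zb.
  have Cz1 : C i.+1 z.
    by rewrite -sC1E; apply: (inv_class (Hinv i) (base_decr Cy) Cz ty); rewrite sC1E.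
  have zt : z \in tower i.+1 x.
    by rewrite towerS //; apply/flattenP; exists (tower i z); [exact: map_f|exact: base_tower].
  have e := tower_disj Cx Cz1 zt (base_tower Cz1).
  have := tower_uniq Cx; rewrite tower_traject // => un.
  by have := filter_uniq (C i) un; rewrite -blocks_filter // bw /= e zw.
move=> v v' /levelsP[x Cx <-] /levelsP[y Cy <-] e.
exact: (good_inj (Hgood i)).
Qed.

(** [D] is the run of blocks in the tower of [x0] that spells [bits]. Its length does not depend on
    [bits], since every bit contributes one tower of each of the two kinds. *)
Lemma pattern_word i (bits : seq bool) : size bits = kk i ->
  exists z, map (tau T (st 0)) (traject S z (kk i * (size (spix (st i) (aa i)) + size (spix (st i) (bb i)))))
    = flatten (map (word i) (pair_word (spt (st i) (aa i)) (spt (st i) (bb i)) bits)).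
Proof.
move=> sb; have Cx := Cx0 i.+1.
have [u [v E]] := good_rich (Hgood i) Cx sb; rewrite -blocks_kap // in E.
pose D := take (size (pair_word (aa i) (bb i) bits)) (drop (size u) (blocks i x0)).
have kD : map (kap T (st i)) D = pair_word (aa i) (bb i) bits.
  by rewrite /D map_take map_drop E drop_size_cat // take_size_cat.
have [A [F AF]] : exists A F, blocks i x0 = A ++ D ++ F.
  exists (take (size u) (blocks i x0)),
    (drop (size (pair_word (aa i) (bb i) bits)) (drop (size u) (blocks i x0))).
  by rewrite /D !cat_take_drop.
have Cb b : b \in D -> C i b.
  by move=> bD; apply: (blocks_base Cx); rewrite AF !mem_cat bD orbT.
have tE := towerS Cx; rewrite AF !map_cat !flatten_cat in tE.
set n := _ * _; set G := flatten (map (tower i) D) in tE.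
have sG : size G = n.
  rewrite /G size_flatten /shape -map_comp.
  have -> : [seq (size \o tower i) b | b <- D] = map (fun c => size (spix (st i) c)) (map (kap T (st i)) D).
    by rewrite -map_comp; apply/eq_map => b /=; rewrite size_map.
  rewrite kD /n -sb; elim: (bits) => //= c s IH.
  by rewrite map_cat sumn_cat IH mulSn; case: c => /=; rewrite addn0 // [X in X + _]addnC.
exists (iter (size (flatten (map (tower i) A))) S x0).
have -> : traject S (iter (size (flatten (map (tower i) A))) S x0) n = G.
  have := congr1 (fun l => take n (drop (size (flatten (map (tower i) A))) l)) tE.
  rewrite drop_size_cat // take_size_cat // => <-.
  have le : size (flatten (map (tower i) A)) + n <= rt (C i.+1) x0.
    by rewrite -size_tower // tE !size_cat sG addnA leq_addr.
  rewrite tower_traject // -(subnKC le) -addnA !trajectD drop_size_cat ?size_traject //.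
  by rewrite take_size_cat ?size_traject.
rewrite /G map_flatten -map_comp -map_pair_word -kD -!map_comp; congr flatten.
by apply/eq_in_map => b bD /=; rewrite tower_word // Cb.
Qed.

Lemma consecutive_towers i b m : C i.+1 b -> exists ls len,
  [/\ size ls = m, {subset ls <= sW i}, m * hN i <= len &
   map (tau T (st 0)) (traject S b len) = flatten (map (word i.+1) ls)].
Proof.
elim: m b => [|m IH] b Cb; first by exists [::], 0.
have [ls [len [sl lW ml e]]] := IH _ (iter_step_base Cb).
exists (tau T (st i.+1) b :: ls), (rt (C i.+1) b + len); split.
- by rewrite /= sl.
- by move=> z; rewrite inE => /predU1P[->|/lW//]; exact: (good_sW (Hgood i)).
- by rewrite mulSn leq_add //; have /andP[] := good_rt (Hgood i) Cb.
- by rewrite trajectD map_cat; congr (_ ++ _); [rewrite -tower_word // tower_traject|exact: e].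
Qed.

(** * The subshift and bounds on its language *)

Lemma coding_range_closed : closed (range coding).
Proof.
apply: compact_closed; first by apply: hausdorff_product => i; exact: discrete_hausdorff.
by apply: continuous_compact; [apply: continuous_subspaceT; exact: coding_continuous|].
Qed.

Lemma coding_range_invariant : shift_map 'I_3 @` range coding = range coding.
Proof.
apply/seteqP; split => [_ [_ [x _ <-] <-]|_ [x _ <-]].
  by exists (S x) => //; rewrite coding_step.
by exists (coding (hinv S x)); [exists (hinv S x)|rewrite -coding_step hinvK].
Qed.

Definition coding_subshift : subshift 'I_3 := Subshift coding_range_closed coding_range_invariant.
Local Notation Y := coding_subshift.

Lemma coding_homeo : exists h : homeo X (set_type (points Y)),
  forall x, h (S x) = subshift_map Y (h x).
Proof.
have [h hE] := @embedding_homeo _ (full_shift 'I_3) coding (range coding) cX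
  (hausdorff_product (fun=> @discrete_hausdorff _)) coding_continuous coding_inj erefl.
exists h => x; apply: val_inj.
by rewrite hE coding_step /= -hE.
Qed.

Lemma languageP n (w : n.-tuple 'I_3) :
  w \in language Y n <-> exists x, tval w = map letter (traject S x n).
Proof.
rewrite inE; split => [/asboolP[_ [j [[x _ <-] h]]]|[x e]].
  exists (zpow S j x); apply: (@eq_from_nth _ ord0); first by rewrite size_map size_traject size_tuple.
  move=> k; rewrite size_tuple => kn.
  rewrite (nth_map (zpow S j x)) ?size_traject // nth_traject //.
  by rewrite -[k]/(nat_of_ord (Ordinal kn)) -tnth_nth -h /coding addrC zpowD.
apply/asboolP; exists (coding x), 0%R; split; first by exists x.
by move=> k; rewrite (tnth_nth ord0) e (nth_map x) ?size_traject // nth_traject.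
Qed.

Lemma complexity_gt0 n : 0 < complexity Y n.
Proof.
apply/card_gt0P; exists [tuple of map letter (Tuple (introT eqP (size_traject S x0 n)))].
by apply/languageP; exists x0.
Qed.

Lemma pattern_levels i (bits : seq bool) : size bits = kk i ->
  {subset pair_word (spt (st i) (aa i)) (spt (st i) (bb i)) bits <= levels i}.
Proof.
move=> sb; have Cx := Cx0 i.+1; have [u [v E]] := good_rich (Hgood i) Cx sb.
move=> z; rewrite -map_pair_word => /mapP[c cp ->].
have : c \in map (kap T (st i)) (blocks i x0) by rewrite blocks_kap // E !mem_cat cp orbT.
by move=> /mapP[b bx ->]; apply: tau_levels; exact: blocks_base bx.
Qed.

Lemma complexity_lower i :
  2 ^ kk i <= complexity Y (kk i * (size (spix (st i) (aa i)) + size (spix (st i) (bb i)))).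
Proof.
set n := kk i * _.
have /choice[z Hz] (t : (kk i).-tuple bool) := pattern_word (size_tuple t).
pose f t : n.-tuple 'I_3 := [tuple of map letter (Tuple (introT eqP (size_traject S (z t) n)))].
have fI : injective f.
  move=> t t' /(congr1 (fun w : n.-tuple 'I_3 => map (@nat_of_ord 3) w)) /=.
  have L x : map (@nat_of_ord 3) (map letter (traject S x n)) = map (tau T (st 0)) (traject S x n).
    by rewrite -map_comp; apply/eq_map => y /=; rewrite inordK.
  rewrite !L !Hz => /word_inj h; apply: val_inj.
  by apply: (pair_word_inj (good_ab (Hgood i))); apply: h; apply: pattern_levels; exact: size_tuple.
have -> : 2 ^ kk i = #|(f @: [set: (kk i).-tuple bool])%SET|.
  by rewrite card_imset // cardsT card_tuple card_bool.
apply: subset_leq_card; apply/fintype.subsetP => _ /imsetP[t _ ->].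
by apply/languageP; exists (z t).
Qed.

(** A word is determined by its offset in the first tower it meets and by the vertices of enough
    consecutive towers, each of height at least [N]. *)
Lemma complexity_upper i n :
  complexity Y n <= 2 * hN i * size (sW i) ^ (n %/ hN i + 3).
Proof.
(* The offset is below [2 * N] and [n] is below [(n %/ N + 1) * N], so [n %/ N + 3] towers cover the
   word. *)
set N := hN i; set m := _ + 3; have [N0 _] := good_N (Hgood i).
pose F (qt : 'I_(2 * N) * m.-tuple 'I_(size (sW i))) : n.-tuple 'I_3 :=
  [tuple inord (nth 0 (drop qt.1 (flatten (map (word i.+1)
    [seq nth 0 (sW i) (nat_of_ord j) | j <- qt.2]))) (nat_of_ord k)) | k < n].
have -> : 2 * N * size (sW i) ^ m = #|{: 'I_(2 * N) * m.-tuple 'I_(size (sW i))}|.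
  by rewrite card_prod card_ord card_tuple card_ord.
apply: leq_trans (leq_imset_card F _); apply: subset_leq_card.
apply/fintype.subsetP => w /languageP[x e].
have [Cb d] := baseSP i.+1 x; have [ls [len [sl lW ml E]]] := consecutive_towers m Cb.
have d2 : depthS i.+1 x < 2 * N.
  apply: leq_trans d _; have /andP[_ h] := good_rt (Hgood i) Cb.
  by apply: leq_trans h _; rewrite mul2n -addnn leq_add2l leq_div.
have [t tls] : exists t : m.-tuple 'I_(size (sW i)), [seq nth 0 (sW i) (nat_of_ord j) | j <- t] = ls.
  have W0 : 0 < size (sW i) by have := good_sW (Hgood i) (Cx0 i.+1); case: (sW i).
  have ts : size [seq insubd (Ordinal W0) (index v (sW i)) | v <- ls] == m by rewrite size_map sl.
  exists (Tuple ts); rewrite /= -map_comp -[RHS]map_id; apply/eq_in_map => v vl /=.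
  by rewrite val_insubd index_mem lW // nth_index // lW.
apply/imsetP; exists (Ordinal d2, t) => //.
apply: eq_from_tnth => k; rewrite tnth_mktuple (tnth_nth ord0) e tls -E nth_drop.
rewrite (nth_map x) ?size_traject // nth_traject //.
have qk : depthS i.+1 x + k < len.
  apply: leq_trans ml; rewrite /m mulnDl.
  by have := divn_eq n N; have := ltn_pmod n N0; have := ltn_ord k; lia.
by rewrite (nth_map (baseS i.+1 x)) ?size_traject // nth_traject // addnC iterD depthK.
Qed.

Lemma tower_conclusion (R : realType) : exists Y : subshift 'I_3,
  [/\ pseudo_toeplitz R Y, strong_orbit_equivalent (subshift_map Y) T,
      forall n, 0 < complexity Y n,
      forall i, exists N w, [/\ 0 < N, w ^ i.+1 <= 2 ^ N &
        forall n, complexity Y n <= 2 * N * w ^ (n %/ N + 3)] &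
      forall i, exists k L, [/\ i <= k * L, grows i k L & 2 ^ k <= complexity Y (k * L)]].
Proof.
exists coding_subshift; have [h hS] := coding_homeo; split.
- split; last first.
    by exists tower_ordered; split; [exact: tower_representation hS|exact: tower_pseudo_ERS].
  split.
    by case: cantorX => c; constructor; exact: homeo_comp h c.
  move=> y O [z Oz] openO.
  have Oh : (h @^-1` O) !=set0 by exists (hinv h z); rewrite /= hinvK.
  have oh : open (h @^-1` O) by apply: open_comp => // x _; exact: hfun_continuous.
  have [v [/= Ov [n _ nz]]] := step_minimal (hinv h y) Oh oh.
  by exists (h v); split => //; exists n => //; rewrite -nz (zpow_conj n _ hS) hinvK.
- exact: tower_conjugate_soe hS.
- exact: complexity_gt0.
- move=> i; exists (hN i), (size (sW i)); split; last exact: complexity_upper.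
    by have [] := good_N (Hgood i).
  exact: good_size (Hgood i).
move=> i; exists (kk i), (size (spix (st i) (aa i)) + size (spix (st i) (bb i))); split.
- have [k0|k0] := posnP (kk i); first by have := good_k (Hgood i); rewrite k0 leqn0 => /eqP ->.
  apply: leq_trans (good_k (Hgood i)) _; rewrite leq_pmulr // addn_gt0; apply/orP; left.
  have [u [v E]] := good_rich (Hgood i) (Cx0 i.+1) (size_nseq (kk i) true).
  have : aa i \in map (kap T (st i)) (blocks i x0).
    rewrite blocks_kap // E !mem_cat; apply/orP; right; apply/orP; left.
    by case: (kk i) k0 => //= n _; rewrite mem_head.
  move=> /mapP[b bx ->]; have Cb : C i b by exact: blocks_base bx.
  by rewrite -[spix _ _]/(ix T (st i) b) (perm_size (inv_perm (Hinv i) Cb)) size_iota.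
- exact: good_grows (Hgood i).
- exact: complexity_lower.
Qed.

End Tower.

(** * Growth of the complexity *)

Section Growth.
Variable R : realType.
Local Open Scope ring_scope.

Lemma ln2_bounds : 0 < ln 2 :> R /\ ln 2 <= 1 :> R.
Proof.
split; first by rewrite ln_gt0 // ltr1n.
have := @le_ln1Dx R 1; rewrite -[1 + 1]/(2%:R : R); apply; lra.
Qed.

(** For [n = k * L] with [L] fixed, [ln (g n)] is eventually at most [k * ln 2 / 2]; half of
    [2 ^+ k] bounds it in exponent, and the other half pays for the factor [i]. *)
Lemma subexponential_grows (g : nat -> R) : subexponential g ->
  forall i L, (0 < L)%N -> exists k, (i <= k)%N /\ i%:R * g (k * L)%N <= 2 ^+ k.
Proof.
move=> [g0 gl] i L L0; have [l0 l1] := ln2_bounds.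
have e0 : 0 < ln 2 / (2 * L%:R) :> R by rewrite divr_gt0 // mulr_gt0 // ltr0n.
move/cvgrPdist_le : gl => /(_ _ e0)[N _ HN].
(* With [k = j + j] both factors are at most [2 ^+ j]: [g] by the estimate beyond [N], and [i]
   because [i < j]. *)
pose j := (N + i).+1; exists (j + j)%N; split; first by rewrite /j; lia.
set n := (_ * L)%N.
have n0 : 0 < n%:R :> R by rewrite ltr0n muln_gt0 L0 /j addSn.
have /HN /= : (N <= n)%N by rewrite /n /j; nia.
rewrite sub0r normrN => h.
have : ln (g n) <= j%:R * ln 2.
  have : ln (g n) / n%:R <= ln 2 / (2 * L%:R) by apply: le_trans h; exact: ler_norm.
  rewrite ler_pdivrMr // => /le_trans; apply.
  rewrite /n natrM natrD.
  have L1 : L%:R != 0 :> R by rewrite pnatr_eq0 -lt0n.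
  by rewrite le_eqVlt; apply/orP; left; apply/eqP; field.
rewrite mulr_natl -lnXn // ler_ln ?posrE ?exprn_gt0 // => gj.
rewrite exprD; apply: ler_pM => //; first exact: ltW.
rewrite -natrX ler_nat; apply: ltnW; apply: leq_trans (ltn_expl j _) => //.
by rewrite /j; lia.
Qed.

(** The hypothesis gives [ln w <= N / i.+1], so the main term [(n %/ N) * ln w] is at most
    [n / i.+1]; the remaining terms are bounded by a constant depending on [i]. *)
Lemma entropy_zero (p : nat -> nat) :
  (forall n, (0 < p n)%N) ->
  (forall i, exists N w, [/\ (0 < N)%N, (w ^ i.+1 <= 2 ^ N)%N &
     forall n, (p n <= 2 * N * w ^ (n %/ N + 3))%N]) ->
  (ln (p n)%:R / n%:R : R) @[n --> \oo] --> (0 : R).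
Proof.
move=> p0 pw; apply/cvgrPdist_le => e e0.
have [i ie] : exists i : nat, i.+1%:R^-1 <= e / 2 :> R.
  have : 0 < e / 2 by rewrite divr_gt0.
  by move=> e2; have [i _ /(_ i (leqnn i)) /= /ltW h] := near_infty_natSinv_lt (PosNum e2); exists i.
have [N [w [N0 wN pN]]] := pw i; have [l0 l1] := ln2_bounds.
have w0 : (0 < w)%N.
  by have := leq_trans (p0 0) (pN 0); rewrite muln_gt0 expn_gt0 addn3 orbF => /andP[].
pose K : R := ln (2 * N)%:R + 3 * N%:R.
have K0 : 0 <= K by rewrite addr_ge0 ?mulr_ge0 // ln_ge0 // ler1n; lia.
near=> n.
have n0 : (0 < n)%N by near: n; exact: nbhs_infty_gt.
have n0' : 0 < n%:R :> R by rewrite ltr0n.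
have Kn : K / (e / 2) <= n%:R by near: n; exact: nbhs_infty_ger.
have lw : i.+1%:R * ln w%:R <= N%:R :> R.
  have : ln ((w ^ i.+1)%N%:R) <= ln ((2 ^ N)%N%:R) :> R.
    by rewrite ler_ln ?posrE ?ltr0n ?expn_gt0 ?w0 // ler_nat.
  rewrite !natrX !lnXn ?ltr0n // -[ln w%:R *+ _]mulr_natl -[ln _ *+ N]mulr_natl => /le_trans; apply.
  by rewrite ler_piMr.
have lw0 : 0 <= ln w%:R :> R by rewrite ln_ge0 // ler1n.
have : ln (p n)%:R <= ln (2 * N)%:R + (n %/ N + 3)%:R * ln w%:R :> R.
  have : ln (p n)%:R <= ln (2 * N * w ^ (n %/ N + 3))%N%:R :> R.
    by rewrite ler_ln ?posrE ?ltr0n // ?muln_gt0 ?expn_gt0 ?w0 ?N0 // ler_nat.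
  move=> /le_trans; apply; rewrite natrM lnM ?posrE ?ltr0n ?muln_gt0 ?expn_gt0 ?w0 ?N0 //.
  by rewrite natrX lnXn ?ltr0n // -[ln w%:R *+ _]mulr_natl.
have lp0 : 0 <= ln (p n)%:R :> R by rewrite ln_ge0 // ler1n.
rewrite sub0r normrN ger0_norm ?divr_ge0 // ler_pdivrMr // => /le_trans; apply.
have i0 : 0 < i.+1%:R :> R by rewrite ltr0n.
have lw1 : ln w%:R <= i.+1%:R^-1 * N%:R :> R by rewrite ler_pdivlMl.
have t1 : (n %/ N)%:R * ln w%:R <= n%:R * (e / 2) :> R.
  apply: (@le_trans _ _ ((n %/ N)%:R * (i.+1%:R^-1 * N%:R))); first exact: ler_wpM2l.
  rewrite mulrCA mulrC; apply: ler_pM => //; rewrite ?mulr_ge0 ?invr_ge0 //.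
  by rewrite -natrM ler_nat leq_divM.
have t2 : 3 * ln w%:R <= 3 * N%:R :> R.
  apply: ler_wpM2l => //; apply: le_trans lw1 _.
  by rewrite ler_piMl // invf_le1 // ler1n.
have t3 : K <= n%:R * (e / 2) by move: Kn; rewrite ler_pdivrMr // divr_gt0.
by move: t3; rewrite natrD mulrDl /K; lra.
Unshelve. all: by end_near. Qed.

Lemma limn_einf_zero (u : nat -> R) : (forall n, 0 <= u n) ->
  (forall i, exists2 n, (i <= n)%N & i%:R * u n <= 1) ->
  limn_einf (fun n => (u n)%:E) = 0%E.
Proof.
move=> u0 ui; rewrite limn_einf_lim.
have -> : einfs (fun n => (u n)%:E) = fun=> 0%E.
  apply/funext => m; apply/eqP; rewrite eq_le; apply/andP; split; last first.
    by apply: le_ereal_inf_tmp => _ [n _ <-]; rewrite lee_fin.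
  apply/lee_addgt0Pr => e e0; rewrite add0e.
  have [i ie] : exists i : nat, i.+1%:R^-1 <= e :> R.
    by have [i _ /(_ i (leqnn i)) /= /ltW h] := near_infty_natSinv_lt (PosNum e0); exists i.
  (* The sum serves twice: it places [n] in the tail from [m] and makes [u n] at most [1 / i.+1]. *)
  have [n ni un] := ui (m + i.+1)%N.
  apply: (@le_trans _ _ (u n)%:E).
    by apply: ereal_inf_lbound; exists n => //=; rewrite (leq_trans _ ni) // leq_addr.
  rewrite lee_fin; apply: le_trans ie.
  have i0 : 0 < i.+1%:R :> R by rewrite ltr0n.
  rewrite -[leRHS]mulr1 ler_pdivlMl //; apply: le_trans un.
  by apply: ler_wpM2r => //; rewrite ler_nat leq_addl.
exact: lim_cst.
Qed.

End Growth.

Local Close Scope nat_scope.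
Unset Implicit Arguments.

Theorem corollary1p6 (R : realType) (X : topologicalType) (T : homeo X X)
    (g : nat -> R) :
  minimal_cantor_system T -> subexponential g ->
  exists (A : finType) (Y : subshift A),
    [/\ has_entropy Y (0 : R), pseudo_toeplitz R Y,
        strong_orbit_equivalent (subshift_map Y) T &
        limn_einf (fun n : nat => (g n / (complexity Y n)%:R)%:E) = 0%E].
Proof.
move=> [cantorX minT] subg.
have [chi [lchi schi]] := cantor_coordinates cantorX.
have [x0] : inhabited X by case: cantorX => h; constructor; exact: h (fun=> true).
(* Together with [2 ^ k <= complexity Y (k * L)], the factor [i] bounds the quotient at [k * L] by
   [1 / i] for positive [i]. *)
pose grows i k L := i%:R * g (k * L)%N <= 2 ^+ k.
have [st [Hinv HC0 Htau0 [sg [od [N [sW [k [a [b Hgood]]]]]]]]] :=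
  state_sequence cantorX minT x0 lchi schi (grows := grows) (subexponential_grows subg).
have [Y [pT soe p0 pU pL]] := tower_conclusion cantorX minT schi Hinv HC0 Htau0 Hgood R.
exists 'I_3, Y; split => //; first exact: entropy_zero.
apply: limn_einf_zero => [n|i]; first by rewrite divr_ge0 // ltW //; exact: (subg.1).
have [l [L [il gl pl]]] := pL i; exists (l * L)%N => //.
rewrite mulrA ler_pdivrMr ?ltr0n // mul1r; apply: le_trans gl _.
by rewrite -natrX ler_nat.
Qed.
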